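(* Let $D$ be a polyhedral distance on $\mathbb{A}^n$ ($n\ge1$) and let $X\subseteq\mathbb{A}^n$ be an irreducible real algebraic variety. If the dual variety $\overline{X}^\vee$ of the complex projective closure $\overline{X}\subseteq\mathbb{P}^n$ is not a hypersurface in $(\mathbb{P}^n)^*$, then no smooth point $x\in X$ has a full-dimensional (i.e., $n$-dimensional) Voronoi cell $V_{D,X}(x)$.
   Context: $\mathbb{A}^n$ is a real affine space of dimension $n$ (embedded as an affine hyperplane of $\mathbb{R}^{n+1}$); after choosing affine coordinates, $\mathbb{A}^n=\mathbb{R}^n\subseteq\mathbb{C}^n\subseteq\mathbb{P}^n_{\mathbb{C}}$, and $\overline{X}$ denotes the Zariski closure of $X$ in complex projective space $\mathbb{P}^n$. A polyhedral distance on $\mathbb{A}^n$ is a translation-invariant metric $D$ such that every closed ball $B_{D,r}(c)=\{z\in\mathbb{A}^n: D(z,c)\le r\}$ with $r>0$ is an $n$-dimensional convex polytope. For $X\subseteq\mathbb{A}^n$ and $x\in X$, the Voronoi cell is $V_{D,X}(x)=\{y\in\mathbb{A}^n : D(x,y)<D(x',y) \text{ for all } x'\in X\setminus\{x\}\}$. The dual variety $\overline{X}^\vee\subseteq(\mathbb{P}^n)^*$ is the Zariski closure of the set of hyperplanes of $\mathbb{P}^n$ that are tangent to $\overline{X}$ at some smooth point (i.e., contain the embedded tangent space there). *)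

(* Defs.v *)
From HB Require Import structures.
From mathcomp Require Import all_boot all_order all_algebra.
From mathcomp Require Import Rstruct.
From Stdlib Require Import Rdefinitions.
From mathcomp.real_closed Require Import complex.
From mathcomp Require Import mpoly.

Set Implicit Arguments.
Unset Strict Implicit.
Unset Printing Implicit Defensive.
Import GRing.Theory Num.Theory.
Local Open Scope ring_scope.

Notation RR := Rdefinitions.R.
Notation CC := (Rdefinitions.R[i]).

Definition full_dimensional (n : nat) (S : 'rV[RR]_n -> Prop) : Prop :=
  exists (c : 'rV[RR]_n) (r : RR), 0 < r /\
    forall z : 'rV[RR]_n, (forall i, `|z 0 i - c 0 i| < r) -> S z.

Definition convex_polytope (n : nat) (S : 'rV[RR]_n -> Prop) : Prop :=
  exists (m : nat) (V : 'I_m -> 'rV[RR]_n),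
    forall z, S z <-> exists lam : 'I_m -> RR,
      (forall j, 0 <= lam j) /\ \sum_j lam j = 1 /\ z = \sum_j lam j *: V j.

Definition closed_ball (n : nat) (D : 'rV[RR]_n -> 'rV[RR]_n -> RR)
  (r : RR) (c : 'rV[RR]_n) : 'rV[RR]_n -> Prop := fun z => D z c <= r.

Definition is_metric (n : nat) (D : 'rV[RR]_n -> 'rV[RR]_n -> RR) : Prop :=
  (forall x y, 0 <= D x y) /\
  (forall x y, D x y = 0 <-> x = y) /\
  (forall x y, D x y = D y x) /\
  (forall x y z, D x z <= D x y + D y z).

Definition polyhedral_distance (n : nat) (D : 'rV[RR]_n -> 'rV[RR]_n -> RR) : Prop :=
  is_metric D /\
  (forall x y t, D (x + t) (y + t) = D x y) /\
  (forall (r : RR) (c : 'rV[RR]_n), 0 < r ->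
     convex_polytope (closed_ball D r c) /\ full_dimensional (closed_ball D r c)).

Definition voronoi_cell (n : nat) (D : 'rV[RR]_n -> 'rV[RR]_n -> RR)
  (X : 'rV[RR]_n -> Prop) (x : 'rV[RR]_n) : 'rV[RR]_n -> Prop :=
  fun y => forall x', X x' -> x' <> x -> D x y < D x' y.

Definition rpoint (n : nat) (x : 'rV[RR]_n) : 'I_n -> RR := fun i => x 0 i.

Definition real_algebraic_set (n : nat) (Y : 'rV[RR]_n -> Prop) : Prop :=
  exists S : {mpoly RR[n]} -> Prop,
    forall x, Y x <-> (forall f, S f -> f.@[rpoint x] = 0).

Definition irreducible_real_variety (n : nat) (X : 'rV[RR]_n -> Prop) : Prop :=
  real_algebraic_set X /\ (exists x, X x) /\
  forall X1 X2 : 'rV[RR]_n -> Prop,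
    real_algebraic_set X1 -> real_algebraic_set X2 ->
    (forall x, X x <-> X1 x \/ X2 x) ->
    (forall x, X x <-> X1 x) \/ (forall x, X x <-> X2 x).

(* homogeneous coordinates: vectors of C^(n+1); coordinate 0 is x_0 *)
Definition nonzero_vec (n : nat) (p : 'I_n.+1 -> CC) : Prop := exists i, p i != 0.

(* A^n = {x_0 <> 0} in P^n :  x |-> [1 : x_1 : ... : x_n] *)
Definition embed (n : nat) (x : 'rV[RR]_n) : 'I_n.+1 -> CC :=
  fun j => match unlift ord0 j with
           | None => 1
           | Some i => Complex (x 0 i) 0
           end.

Definition hom_vanishes_on (n : nat) (S : ('I_n.+1 -> CC) -> Prop)
  (F : {mpoly CC[n.+1]}) : Prop :=
  (exists d, F \is d.-homog) /\ forall p, S p -> F.@[p] = 0.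

(* Zariski closure in P^n (as a cone minus the origin) *)
Definition proj_zariski_closure (n : nat) (S : ('I_n.+1 -> CC) -> Prop) :
  ('I_n.+1 -> CC) -> Prop :=
  fun p => nonzero_vec p /\ forall F, hom_vanishes_on S F -> F.@[p] = 0.

Definition proj_closure (n : nat) (X : 'rV[RR]_n -> Prop) : ('I_n.+1 -> CC) -> Prop :=
  proj_zariski_closure (fun p => exists x, X x /\ p = embed x).

Definition jac_rank_ge (n : nat) (Z : ('I_n.+1 -> CC) -> Prop)
  (p : 'I_n.+1 -> CC) (k : nat) : Prop :=
  exists F : 'I_k -> {mpoly CC[n.+1]},
    (forall j, hom_vanishes_on Z (F j)) /\
    \rank (\matrix_(j < k, i < n.+1) (mderiv i (F j)).@[p]) = k.

(* Smooth point of the irreducible projective variety Z (Jacobian criterion):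
   the Jacobian rank at p is maximal (= codimension of Z). *)
Definition smooth_point (n : nat) (Z : ('I_n.+1 -> CC) -> Prop)
  (p : 'I_n.+1 -> CC) : Prop :=
  Z p /\ forall q k, Z q -> jac_rank_ge Z q k -> jac_rank_ge Z p k.

Definition tangent_hyperplane (n : nat) (Z : ('I_n.+1 -> CC) -> Prop)
  (p a : 'I_n.+1 -> CC) : Prop :=
  nonzero_vec a /\
  forall v : 'I_n.+1 -> CC,
    (forall F, hom_vanishes_on Z F -> \sum_i (mderiv i F).@[p] * v i = 0) ->
    \sum_i a i * v i = 0.

Definition dual_variety (n : nat) (Z : ('I_n.+1 -> CC) -> Prop) :
  ('I_n.+1 -> CC) -> Prop :=
  proj_zariski_closure
    (fun a => exists p, smooth_point Z p /\ tangent_hyperplane Z p a).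

Definition is_hypersurface (n : nat) (W : ('I_n.+1 -> CC) -> Prop) : Prop :=
  exists (f : {mpoly CC[n.+1]}) (d : nat),
    leq 1 d /\ f != 0 /\ f \is d.-homog /\
    forall a, W a <-> (nonzero_vec a /\ f.@[a] = 0).

Definition smooth_point_of (n : nat) (X : 'rV[RR]_n -> Prop) (x : 'rV[RR]_n) : Prop :=
  X x /\ smooth_point (proj_closure X) (embed x).

(* Main.v *)
(* Let x be a smooth point with a full-dimensional Voronoi cell; the dual variety
   is shown to be a hypersurface. Choose equations g_1, ..., g_c of X with
   independent gradients at x, c being the generic rank, and parametrize the
   conormal variety by a_i = sum_k lam_k dg_k/dx_i and a_0 = - sum_i x_i a_i, with
   x' in X. The polynomials vanishing on it form a homogeneous prime ideal I.
   - I is not zero: otherwise d/da_0 would extend to the function field, whereas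
     sum_i a_i dx_i = 0 forces da_0 = - sum_i x_i da_i.
   - I contains no nonzero polynomial in a_1, ..., a_n alone. The cell contains a
     point y for which x lies in the relative interior of a facet of the ball
     around y touching X at x, so a linear form has a strict local minimum on X at
     x. Every nearby linear form then has a local minimum at some x' close to x,
     and is conormal there, because X contains the integral curves of the tangent
     fields.
   In the factorial ring R[a_0, ..., a_n] such an ideal is principal, and its
   generator defines the dual variety. *)
Require Import Defs.
From HB Require Import structures.
From mathcomp Require Import all_boot all_order all_algebra.
From mathcomp Require Import Rstruct.
From Stdlib Require Import Rdefinitions.
From mathcomp.real_closed Require Import complex.
From mathcomp Require Import mpoly.
From mathcomp Require Import ring lra zify.
From mathcomp Require boolp.
From Coquelicot Require Rbar PSeries Derive.

Set Implicit Arguments.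
Unset Strict Implicit.
Unset Printing Implicit Defensive.
Import Order.TTheory GRing.Theory Num.Theory.
Local Open Scope ring_scope.
(* The Stdlib reals rebind these delimiting keys. *)
Delimit Scope nat_scope with N.
Delimit Scope ring_scope with R.
Bind Scope ring_scope with Rdefinitions.R.

(** * Unique factorization *)

(** Codimension one is never obtained by counting dimensions. Over the fraction field of
    R[a_1, ..., a_n] the ideal I becomes a nonzero ideal in the single variable a_0, proper because
    I meets R[a_1, ..., a_n] in 0; there a generator exists, and factoriality brings divisibility
    back to the polynomial ring. Three obstacles shape the rest. [D] need not be homogeneous: the
    maximum of a polyhedral norm and the square root of another is allowed, so balls of different
    radii need not be similar, and in general the distance to the origin may even be constant on an
    open set. Local minima are located only by compactness, and no local parametrization of X is
    constructed there; the curves are power series whose Taylor coefficients are values of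
    polynomials vanishing on X. Finally, a hyperplane may be tangent at a non-real point, out of
    reach of the real parametrization: the equation evaluated on a combination of gradients is a
    homogeneous polynomial in the point of tangency, and it vanishes on the closure as soon as it
    vanishes on X. *)

Definition divides (R : comUnitRingType) (a b : R) : Prop := exists c, b = c * a.

Definition irreducible_elt (R : comUnitRingType) (p : R) : Prop :=
  [/\ p != 0, p \isn't a GRing.unit &
      forall a b, p = a * b -> a \is a GRing.unit \/ b \is a GRing.unit].

Definition prime_elt (R : comUnitRingType) (p : R) : Prop :=
  [/\ p != 0, p \isn't a GRing.unit &
      forall a b, divides p (a * b) -> divides p a \/ divides p b].

(* The additive length function replaces the existence of factorizations. *)
Definition length_function (R : idomainType) (mu : R -> nat) : Prop :=
  (forall a b, a != 0 -> b != 0 -> mu (a * b) = (mu a + mu b)%N) /\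
  (forall a, a != 0 -> mu a = 0%N -> a \is a GRing.unit).

Definition ufd (R : idomainType) : Prop :=
  (exists mu : R -> nat, length_function mu) /\
  (forall p : R, irreducible_elt p -> prime_elt p).

(** Strong induction on the length: non-units have positive length, so both factors of a reducible
    element are shorter. The decrease [mu d < mu c] drives the Gauss lemmas, which strip a constant
    one prime at a time. *)
Lemma ufd_prime_divisor (R : idomainType) (mu : R -> nat) :
  length_function mu ->
  (forall p : R, irreducible_elt p -> prime_elt p) ->
  forall c, c != 0 -> c \isn't a GRing.unit ->
  exists p d, [/\ prime_elt p, c = d * p, d != 0 & (mu d < mu c)%N].
Proof.
move=> [muM mu0] ip c; have [k] := ubnP (mu c); elim: k c => // k IH c ck c0 cu.
have mu_gt0 (a : R) : a != 0 -> a \isn't a GRing.unit -> (0 < mu a)%N.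
  by move=> a0 au; rewrite lt0n; apply/eqP => /(mu0 _ a0); apply/negP.
have mu1 : mu 1 = 0%N.
  have : mu (1 * 1) = (mu 1%R + mu 1%R)%N by rewrite muM ?oner_eq0.
  by rewrite mulr1; lia.
have [ic|nic] := boolp.EM (irreducible_elt c).
  exists c, 1; split; rewrite ?mul1r ?oner_eq0 ?mu1 //; first exact: ip.
  exact: mu_gt0.
have [a [b [cab au bu]]] : exists a b, [/\ c = a * b, a \isn't a GRing.unit & b \isn't a GRing.unit].
  apply: boolp.contrapT => h; apply: nic; split=> // a b e.
  have [?|au] := boolP (a \is a GRing.unit); first by left.
  have [?|bu] := boolP (b \is a GRing.unit); first by right.
  by case: h; exists a, b.
have : a * b != 0 by rewrite -cab.
rewrite mulf_eq0 negb_or => /andP[a0 b0].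
have mc : mu c = (mu a + mu b)%N by rewrite cab muM.
have ma := mu_gt0 _ a0 au; have mb := mu_gt0 _ b0 bu.
have [|p [d [pp ad d0 md]]] := IH a _ a0 au; first by lia.
exists p, (b * d); split=> //; rewrite ?mulf_neq0 //.
  by rewrite cab ad; ring.
by rewrite muM // mc; lia.
Qed.

Lemma dividesC (R : idomainType) (p : R) (f : {poly R}) :
  divides p%:P f <-> forall i, divides p f`_i.
Proof.
split=> [[g ->] i|h]; first by exists g`_i; rewrite coefMC.
have [g hg] := boolp.choice h.
exists (\poly_(i < size f) g i); apply/polyP => i.
rewrite coefMC coef_poly; case: ltnP => [_|le]; first exact: hg.
by rewrite mul0r nth_default.
Qed.

(** The first coefficients [f_i] and [g_j] not divisible by [p] meet in degree [i + j] of the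
    product, where every other term contains an earlier coefficient of [f] or of [g]. *)
Lemma prime_polyC (R : idomainType) (p : R) : prime_elt p -> prime_elt p%:P.
Proof.
move=> [p0 pu pp]; split; first by rewrite polyC_eq0.
  by rewrite poly_unitE coefC /= (negPf pu) andbF.
move=> f g; rewrite !dividesC => h.
apply: boolp.contrapT => /boolp.not_orP [nf ng].
have ex (u : {poly R}) : ~ (forall i, divides p u`_i) -> exists i, boolp.asbool (~ divides p u`_i).
  by move/boolp.existsNP => [i hi]; exists i; apply/boolp.asboolP.
case: (ex_minnP (ex _ nf)) => i /boolp.asboolP fi mi.
case: (ex_minnP (ex _ ng)) => j /boolp.asboolP gj mj.
have lti k : (k < i)%N -> divides p f`_k.
  move=> lt; apply: boolp.contrapT => hk.
  by have := mi k; rewrite leqNgt lt => H; have // := H (introT (boolp.asboolP _) hk).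
have ltj k : (k < j)%N -> divides p g`_k.
  move=> lt; apply: boolp.contrapT => hk.
  by have := mj k; rewrite leqNgt lt => H; have // := H (introT (boolp.asboolP _) hk).
have dS (I : finType) (P : pred I) (F : I -> R) :
  (forall k, P k -> divides p (F k)) -> divides p (\sum_(k | P k) F k).
  move=> H; elim/big_ind: _ => //; first by exists 0; rewrite mul0r.
  by move=> x y [a ->] [b ->]; exists (a + b); rewrite mulrDl.
have lt : (i < (i + j).+1)%N by lia.
have := h (i + j)%N; rewrite coefM (bigD1 (Ordinal lt)) //= addKn.
have [] : divides p (\sum_(i0 < (i + j).+1 | i0 != Ordinal lt) f`_i0 * g`_(i + j - i0)).
  apply: dS => -[k hk] /=; rewrite -val_eqE /= => ki.
  have [/lti[a ->]|ge] := ltnP k i; first by exists (a * g`_(i + j - k)); ring.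
  have /ltj[a ->] : (i + j - k < j)%N by lia.
  by exists (f`_k * a); ring.
move=> a -> [b e].
case: (pp f`_i g`_j) => //; exists (b - a).
by rewrite mulrBl -e; ring.
Qed.

Lemma prime_elt_cancel (R : idomainType) (p a b : R) :
  prime_elt p -> divides p (a * b) -> ~ divides p a -> divides p b.
Proof. by move=> [_ _ pp] /pp[]. Qed.

(** Pseudo-division by a nonzero element of least size: the remainder stays in the ideal, hence
    vanishes. This stands for a generator over the fraction field of [R], with [c] as
    denominator. *)
Lemma ideal_min_elt (R : idomainType) (J : {poly R} -> Prop) (f : {poly R}) :
  J f -> f != 0 -> (forall a u b v, J u -> J v -> J (a * u + b * v)) ->
  exists r, [/\ J r, r != 0 & forall g, J g -> exists c q, c != 0 /\ c%:P * g = q * r].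
Proof.
move=> Jf f0 JD.
have exI : exists k, boolp.asbool (exists r, [/\ J r, r != 0 & size r = k]).
  by exists (size f); apply/boolp.asboolP; exists f.
case: (ex_minnP exI) => k /boolp.asboolP [r [Jr r0 <-]] rmin.
exists r; split=> // g Jg; exists (lead_coef r ^+ scalp g r), (g %/ r).
split; first by rewrite expf_neq0 // lead_coef_eq0.
have := Pdiv.Idomain.divp_eq g r; rewrite -mul_polyC => e; rewrite e.
have [->|m0] := eqVneq (g %% r) 0; first by rewrite addr0.
have := rmin (size (g %% r)); rewrite leqNgt ltn_modpN0 // => H.
have // : false; apply: H; apply/boolp.asboolP; exists (g %% r); split=> //.
have -> : g %% r = (lead_coef r ^+ scalp g r)%:P * g + (- (g %/ r)) * r.
  by rewrite e mulNr addrAC subrr add0r.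
exact: JD.
Qed.

(* Otherwise a common multiple of [f] and [g] of lower degree would give a
   nonzero constant in [J]. *)
Lemma prime_divides_ideal (R : idomainType) (J : {poly R} -> Prop) (f g : {poly R}) :
  prime_elt f -> J f -> J g -> (forall a u b v, J u -> J v -> J (a * u + b * v)) ->
  (forall b, J b%:P -> b = 0) -> divides f g.
Proof.
move=> [f0 _ pf] Jf Jg JD J0.
have [r [Jr r0 hr]] := ideal_min_elt Jf f0 JD.
have [c1 [q1 [c10 e1]]] := hr f Jf; have [c2 [q2 [c20 e2]]] := hr g Jg.
have nconst (p : {poly R}) : J p -> p != 0 -> (size p <= 1)%N -> False.
  by move=> Jp p0 /size1_polyC e; move: Jp p0; rewrite e => /J0 ->; rewrite eqxx.
have [|[q eq]|[r' er]] := pf q1 r; first by exists c1%:P.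
- case: (nconst r) => //.
  have e : c1%:P = q * r by apply: (mulIf f0); rewrite e1 eq; ring.
  have q0 : q != 0 by apply: contraNneq c10 => q0; rewrite -polyC_eq0 e q0 mul0r.
  have := size_mul q0 r0; rewrite -e size_polyC c10.
  by move: q0 r0; rewrite -!size_poly_gt0; lia.
- have [|[q eq]|//] := pf c2%:P g; first by exists (q2 * r'); rewrite e2 er mulrA.
  case: (nconst f) => //.
  have q0 : q != 0 by apply: contraNneq c20 => q0; rewrite -polyC_eq0 eq q0 mul0r.
  have := size_mul q0 f0; rewrite -eq size_polyC c20.
  by move: q0 f0; rewrite -!size_poly_gt0; lia.
Qed.

(** * Gauss's lemma: polynomials over a factorial domain *)

Section GaussLemma.
Variables (R : idomainType) (mu : R -> nat).
Hypotheses (mu_len : length_function mu).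
Hypothesis (irr_prime : forall p : R, irreducible_elt p -> prime_elt p).

Definition primitive (f : {poly R}) := forall p : R, prime_elt p -> ~ divides p%:P f.

(** A prime of [c] divides [f * w] but not the primitive [f], so it divides [w] and cancels; this
    repeats until [c] is a unit. *)
Lemma primitive_cancel (c : R) (f g w : {poly R}) :
  c != 0 -> primitive f -> c%:P * g = f * w -> divides f g.
Proof.
have [k] := ubnP (mu c); elim: k c w => // k IH c w ck c0 pf e.
have [cu|cu] := boolP (c \is a GRing.unit).
  exists (c^-1%:P * w).
  have -> : c^-1%:P * w * f = c^-1%:P * (f * w) by ring.
  by rewrite -e mulrA -polyCM mulVr // mul1r.
have [p [d [pp cd d0 dc]]] := ufd_prime_divisor mu_len irr_prime c0 cu.
have [|w' ew] := prime_elt_cancel (prime_polyC pp) _ (pf p pp) (b := w).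
  by exists (d%:P * g); rewrite -e cd polyCM; ring.
apply: (IH d w') => //; first by lia.
have [p0 _ _] := pp.
apply: (mulIf (_ : p%:P != 0)); first by rewrite polyC_eq0.
by rewrite -mulrA (mulrC g) mulrA -polyCM -cd e ew mulrA.
Qed.

(** Turns a factorization over the fraction field into one over [R]: each prime of [c] divides [q]
    or [r], and is moved out of that factor. *)
Lemma gauss_factor (c : R) (f q r : {poly R}) :
  c != 0 -> f != 0 -> c%:P * f = q * r ->
  exists q' r' (d e : R), [/\ f = q' * r', d != 0, e != 0, q = d%:P * q' & r = e%:P * r'].
Proof.
have [k] := ubnP (mu c); elim: k c q r => // k IH c q r ck c0 f0 e.
have [cu|cu] := boolP (c \is a GRing.unit).
  exists (c^-1%:P * q), r, c, 1; split; rewrite ?oner_eq0 ?mul1r //.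
    by rewrite -mulrA -e mulrA -polyCM mulVr // mul1r.
  by rewrite mulrA -polyCM divrr // mul1r.
have [p [d [pp cd d0 dc]]] := ufd_prime_divisor mu_len irr_prime c0 cu.
have [p0 _ _] := pp.
have p0' : p%:P != 0 by rewrite polyC_eq0.
have [_ _ pp'] := prime_polyC pp.
have [|[q1 eq]|[r1 er]] := pp' q r.
- by exists (d%:P * f); rewrite -e cd polyCM; ring.
- have [||q' [r' [d1 [e1 [h1 h2 h3 h4 h5]]]]] := IH d q1 r _ d0 f0; first by lia.
    by apply: (mulIf p0'); rewrite mulrAC -polyCM -cd e eq; ring.
  exists q', r', (p * d1), e1; split; rewrite ?mulf_neq0 //.
  by rewrite eq h4 polyCM; ring.
- have [||q' [r' [d1 [e1 [h1 h2 h3 h4 h5]]]]] := IH d q r1 _ d0 f0; first by lia.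
    by apply: (mulIf p0'); rewrite mulrAC -polyCM -cd e er; ring.
  exists q', r', d1, (p * e1); split; rewrite ?mulf_neq0 //.
  by rewrite er h5 polyCM; ring.
Qed.

Lemma irreducible_primitive (f : {poly R}) :
  irreducible_elt f -> (1 < size f)%N -> primitive f.
Proof.
move=> [f0 fu fi] sf p pp [g e].
have [p0 pu _] := pp.
case: (fi _ _ e).
  by rewrite poly_unitE => /andP[/eqP s1 _]; move: sf; rewrite e mulrC size_Cmul // s1.
by rewrite poly_unitE coefC /= (negPf pu) andbF.
Qed.

Lemma irreducible_polyC (p : R) : irreducible_elt p%:P -> irreducible_elt p.
Proof.
move=> [p0 pu pi]; have p0' : p != 0 by rewrite -polyC_eq0.
split=> //; first by apply: contra pu => pu; rewrite poly_unitE size_polyC p0' coefC.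
move=> a b e; case: (pi a%:P b%:P); first by rewrite e polyCM.
  by rewrite poly_unitE coefC => /andP[_ ->]; left.
by rewrite poly_unitE coefC => /andP[_ ->]; right.
Qed.

(** The least element [r] of the ideal generated by [f] and [u] acts as their gcd over the fraction
    field. Either [f] equals [r] up to constants and units, and divides [u], or [r] is a nonzero
    constant, and the Bezout relation multiplied by [v] shows that [f] divides [v]. *)
Lemma irreducible_poly_prime (f : {poly R}) : irreducible_elt f -> prime_elt f.
Proof.
move=> irf; have [f0 fu fi] := irf.
have [le1|sf] := leqP (size f) 1.
  move: irf; rewrite (size1_polyC le1) => /irreducible_polyC/irr_prime; exact: prime_polyC.
have pf := irreducible_primitive irf sf.
split=> // u v [w euv].
have [->|u0] := eqVneq u 0; first by left; exists 0; rewrite mul0r.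
pose J (r : {poly R}) := exists s t, r = s * f + t * u.
have Jf : J f by exists 1, 0; ring.
have Ju : J u by exists 0, 1; ring.
have [|r [[s [t er]] r0 pdiv]] := ideal_min_elt Jf f0.
  move=> a _ b _ [s1 [t1 ->]] [s2 [t2 ->]].
  by exists (a * s1 + b * s2), (a * t1 + b * t2); ring.
have [c [q [c0 e]]] := pdiv f Jf.
have [q' [r' [d [d' [ef d0 d'0 eq er']]]]] := gauss_factor c0 f0 e.
case: (fi _ _ ef) => [q'u|r'u].
- left; have [c2 [q2 [c20 e2]]] := pdiv u Ju.
  have [q'V q'VK] : exists q'V, q'V * q' = 1 by exists q'^-1; rewrite mulVr.
  apply: (primitive_cancel c20 pf (w := q2 * d'%:P * q'V)).
  rewrite e2 er'.
  have -> : r' = q'V * f by rewrite ef mulrA q'VK mul1r.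
  by ring.
- right; move: r'u; rewrite poly_unitE => /andP[/eqP sr' _].
  have sr : (size r <= 1)%N by rewrite er' size_Cmul // sr'.
  have er2 : r = (r`_0)%:P by rewrite -size1_polyC.
  apply: (@primitive_cancel r`_0 f v (s * v + t * w)) => //.
    by rewrite -polyC_eq0 -er2.
  rewrite -er2 er mulrDl -mulrA (mulrC f) -(mulrA t) euv; ring.
Qed.

(** Over a domain the degree and the length of the leading coefficient are both additive, and they
    vanish together only on unit constants. *)
Lemma length_function_poly :
  length_function (fun f : {poly R} => ((size f).-1 + mu (lead_coef f))%N).
Proof.
case: mu_len => muM mu0; split=> [f g f0 g0|f f0].
  rewrite lead_coefM muM ?lead_coef_eq0 // size_mul //.
  by move: f0 g0; rewrite -!size_poly_gt0; lia.
move=> e; have s1 : size f = 1%N by move: f0; rewrite -size_poly_gt0; lia.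
have lf : lead_coef f = f`_0 by rewrite lead_coefE s1.
by rewrite poly_unitE s1 eqxx -lf /= mu0 ?lead_coef_eq0 //; lia.
Qed.

End GaussLemma.

Lemma ufd_poly (R : idomainType) : ufd R -> ufd {poly R}.
Proof.
move=> [[mu mulen] ip]; split; last exact: (irreducible_poly_prime mulen ip).
by exists (fun f : {poly R} => ((size f).-1 + mu (lead_coef f))%N); apply: length_function_poly.
Qed.

Lemma prime_elt_iso (R S : idomainType) (f : {rmorphism R -> S}) (g : {rmorphism S -> R}) (p : R) :
  cancel f g -> cancel g f -> prime_elt p -> prime_elt (f p).
Proof.
move=> fK gK [p0 pu pp]; split.
- by apply: contraNneq p0 => e; rewrite -[p]fK e rmorph0.
- by apply: contra pu => /(rmorph_unit g); rewrite fK.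
- move=> a b [w e]; have [|[u eu]|[u eu]] := pp (g a) (g b).
  + by exists (g w); rewrite -rmorphM e rmorphM fK.
  + by left; exists (f u); rewrite -rmorphM -eu gK.
  + by right; exists (f u); rewrite -rmorphM -eu gK.
Qed.

Lemma prime_divides_ideal_iso (A R : idomainType) (sp : {rmorphism A -> {poly R}})
  (jn : {rmorphism {poly R} -> A}) (J : A -> Prop) (f g : A) :
  cancel sp jn -> cancel jn sp -> prime_elt f -> J f -> J g ->
  (forall a u b v, J u -> J v -> J (a * u + b * v)) ->
  (forall b, J (jn b%:P) -> b = 0) -> divides f g.
Proof.
move=> spK jnK pf Jf Jg JD J0.
have [||||w e] := @prime_divides_ideal _ (fun u => J (jn u)) (sp f) (sp g) (prime_elt_iso spK jnK pf).
- by rewrite spK.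
- by rewrite spK.
- by move=> a u b v hu hv; rewrite rmorphD !rmorphM; apply: JD.
- exact: J0.
by exists (jn w); rewrite -[g]spK e rmorphM spK.
Qed.

Lemma ufd_iso (R S : idomainType) (f : {rmorphism R -> S}) (g : {rmorphism S -> R}) :
  cancel f g -> cancel g f -> ufd R -> ufd S.
Proof.
move=> fK gK [[mu [muM mu0]] ip].
have g0 a : (g a == 0) = (a == 0) by rewrite -(inj_eq (can_inj gK)) rmorph0.
have gu a : (g a \is a GRing.unit) = (a \is a GRing.unit).
  by apply/idP/idP => [/(rmorph_unit f)|/(rmorph_unit g)]; rewrite ?gK.
have fu a : (f a \is a GRing.unit) = (a \is a GRing.unit) by rewrite -gu fK.
split.
  exists (mu \o g); split=> [a b a0 b0|a a0] /=; first by rewrite rmorphM muM ?g0.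
  by rewrite -gu; apply: mu0; rewrite g0.
move=> p [p0 pu pi]; rewrite -[p]gK; apply: (prime_elt_iso fK gK); apply: ip.
split; rewrite ?g0 ?gu // => a b e.
by rewrite -(fu a) -(fu b); apply: pi; rewrite -rmorphM -e gK.
Qed.

Lemma mpoly_ring_ind (n : nat) (R : nzRingType) (P : {mpoly R[n]} -> Prop) :
  (forall c, P c%:MP) -> (forall i, P 'X_i) ->
  (forall p q, P p -> P q -> P (p + q)) -> (forall p q, P p -> P q -> P (p * q)) ->
  forall p, P p.
Proof.
move=> PC PX PD PM p; rewrite [p]mpolyE; apply: (big_ind P) => //.
  by rewrite -(mpolyC0 n R).
move=> m _; rewrite -mul_mpolyC; apply: (PM) => //.
rewrite mpolyXE_id; apply: (big_ind P) => [||i _]; [by rewrite -(mpolyC1 n R)|exact: PM|].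
elim: (m i) => [|k IH]; first by rewrite expr0 -(mpolyC1 n R).
by rewrite exprS; apply: (PM).
Qed.

Lemma mpoly_rmorph_eq (n : nat) (R : comNzRingType) (S : nzRingType)
  (f g : {rmorphism {mpoly R[n]} -> S}) :
  (forall c, f c%:MP = g c%:MP) -> (forall i, f 'X_i = g 'X_i) -> f =1 g.
Proof.
move=> hC hX p; rewrite [p]mpolyE !rmorph_sum; apply: eq_bigr => m _.
rewrite -mul_mpolyC !rmorphM hC mpolyXE_id !rmorph_prod; congr (_ * _).
by apply: eq_bigr => i _; rewrite !rmorphXn /= hX.
Qed.

(** * Polynomials in [X_0] over the ring of the other variables *)

Section SplitVariable.
Variables (n : nat) (K : comNzRingType).

(** The variable split off is the dual coordinate a_0: the coefficients then lie in
    R[a_1, ..., a_n], the ring that meets the conormal ideal in 0. *)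
Definition msplit_var (j : 'I_n.+1) : {poly {mpoly K[n]}} :=
  if unlift ord0 j is Some i then ('X_i)%:P else 'X.

Definition msplit : {rmorphism {mpoly K[n.+1]} -> {poly {mpoly K[n]}}} :=
  mmap (polyC \o @mpolyC n K) msplit_var.

Definition mlift : {rmorphism {mpoly K[n]} -> {mpoly K[n.+1]}} :=
  mmap (@mpolyC n.+1 K) (fun i : 'I_n => 'X_(lift ord0 i)).

Definition mjoin : {rmorphism {poly {mpoly K[n]}} -> {mpoly K[n.+1]}} :=
  horner_eval ('X_ord0 : {mpoly K[n.+1]}) \o map_poly mlift.

Lemma msplitC c : msplit c%:MP = c%:MP%:P.
Proof. exact: mmapC. Qed.

Lemma msplitX j : msplit 'X_j = msplit_var j.
Proof. by rewrite /= mmapX mmap1U. Qed.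

Lemma mliftC c : mlift c%:MP = c%:MP.
Proof. exact: mmapC. Qed.

Lemma mliftX i : mlift 'X_i = 'X_(lift ord0 i).
Proof. by rewrite /= mmapX mmap1U. Qed.

Lemma mjoinC p : mjoin p%:P = mlift p.
Proof. by rewrite /= map_polyC /horner_eval hornerC. Qed.

Lemma mjoinX : mjoin 'X = 'X_ord0.
Proof. by rewrite /= map_polyX /horner_eval hornerX. Qed.

Lemma msplit_lift p : msplit (mlift p) = p%:P.
Proof.
apply: (mpoly_rmorph_eq (f := msplit \o mlift) (g := polyC)) => [c|i].
  by rewrite -[LHS]/(msplit (mlift _)) mliftC msplitC.
by rewrite -[LHS]/(msplit (mlift _)) mliftX msplitX /msplit_var liftK.
Qed.

Lemma msplitK : cancel msplit mjoin.
Proof.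
apply: (mpoly_rmorph_eq (f := mjoin \o msplit) (g := idfun)) => [c|j].
  by rewrite -[LHS]/(mjoin (msplit _)) msplitC mjoinC mliftC.
rewrite -[LHS]/(mjoin (msplit _)) msplitX /msplit_var; case: unliftP => [i|] ->.
  by rewrite mjoinC mliftX.
by rewrite mjoinX.
Qed.

Lemma mjoinK : cancel mjoin msplit.
Proof.
move=> p; rewrite -[p]coefK poly_def !rmorph_sum; apply: eq_bigr => i _.
by rewrite -mul_polyC !rmorphM !rmorphXn mjoinC mjoinX msplit_lift msplitX /msplit_var unlift_none.
Qed.

End SplitVariable.

Lemma meval_split (n : nat) (K : comNzRingType) (G : {mpoly K[n.+1]}) (v : 'I_n.+1 -> K) :
  G.@[v] = (map_poly (meval (fun i => v (lift ord0 i))) (msplit n K G)).[v ord0].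
Proof.
apply: (mpoly_rmorph_eq (f := meval v)
  (g := horner_eval (v ord0) \o map_poly (meval (fun i => v (lift ord0 i))) \o msplit n K)).
  by move=> c; rewrite -[RHS]/((map_poly _ (msplit n K _)).[_]) -[LHS]/(_.@[v]) mevalC msplitC map_polyC hornerC /= mevalC.
move=> j; rewrite -[RHS]/((map_poly _ (msplit n K _)).[_]) -[LHS]/(_.@[v]) mevalXU msplitX /msplit_var.
case: unliftP => [i|] -> /=; first by rewrite map_polyC hornerC /= mevalXU.
by rewrite map_polyX hornerX.
Qed.

Lemma ufd_mpoly (K : fieldType) (n : nat) : ufd {mpoly K[n]}.
Proof.
elim: n => [|n IH]; last first.
  exact: (ufd_iso (@mjoinK n K) (@msplitK n K) (ufd_poly IH)).
have un (p : {mpoly K[0]}) : p != 0 -> p \is a GRing.unit.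
  rewrite [p]nvar0_mpolyC mpolyC_eq0 => p0.
  by apply: (rmorph_unit (@mpolyC 0 K)); rewrite unitfE.
split; first by exists (fun=> 0%N); split=> // a a0 _; apply: un.
by move=> p [/un ->].
Qed.

Lemma poly_eq0_interval (R : realFieldType) (p : {poly R}) (c r : R) :
  0 < r -> (forall t, `|t - c| < r -> p.[t] = 0) -> p = 0.
Proof.
move=> r0 h; apply: contraTeq isT => p0.
(* [size p] exceeds the degree by one, and the offsets [r / (k + 2)] are distinct and smaller than
   [r]. *)
pose s := [seq c + r / (k.+2)%:R | k <- iota 0 (size p)].
have us : uniq s.
  rewrite map_inj_uniq ?iota_uniq // => i j /addrI /(mulfI (lt0r_neq0 r0)) /invr_inj /eqP.
  by rewrite eqr_nat => /eqP[].
have rs : all (root p) s.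
  apply/allP => _ /mapP[k _ ->]; apply/rootP/h.
  rewrite addrC addKr ger0_norm ?divr_ge0 ?ler0n ?(ltW r0) //.
  by rewrite ltr_pdivrMr ?ltr0n // ltr_pMr // ltr1n.
by have := max_poly_roots p0 rs us; rewrite size_map size_iota ltnn.
Qed.

Lemma mpoly_eq0_box (R : realFieldType) (n : nat) (p : {mpoly R[n]}) (c : 'I_n -> R) (r : R) :
  0 < r -> (forall v, (forall i, `|v i - c i| < r) -> p.@[v] = 0) -> p = 0.
Proof.
move=> r0; elim: n p c => [|n IH] p c h.
  have := h c; rewrite [p]nvar0_mpolyC mevalC => -> //; last by case.
rewrite -[p]msplitK; suff -> : msplit n R p = 0 by rewrite rmorph0.
apply/polyP => k; rewrite coef0; apply: (IH _ (fun i => c (lift ord0 i))) => v hv.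
rewrite -coef_map; suff -> : map_poly (meval v) (msplit n R p) = 0 by rewrite coef0.
apply: (poly_eq0_interval r0 (c := c ord0)) => t ht.
pose w j := if unlift ord0 j is Some i then v i else t.
have -> : (map_poly (meval v) (msplit n R p)).[t] = p.@[w].
  rewrite meval_split {2}/w unlift_none; congr (_.[_]).
  by apply: eq_map_poly => q; apply: meval_eq => i; rewrite /w liftK.
by apply: h => j; rewrite /w; case: unliftP => [i|] ->.
Qed.

Lemma mpoly_eq0_all (R : realFieldType) (n : nat) (p : {mpoly R[n]}) :
  (forall v, p.@[v] = 0) -> p = 0.
Proof. by move=> h; apply: (mpoly_eq0_box (c := fun=> 0) ltr01). Qed.

(** * Extension of derivations *)

Lemma mderivXU (n : nat) (K : comNzRingType) (i j : 'I_n) :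
  mderiv i 'X_j = (i == j)%:R :> {mpoly K[n]}.
Proof.
rewrite mderivX mnm1E eq_sym; case: eqVneq => [->|_]; last by rewrite scale0r.
by rewrite scale1r -[X in (X - _)%MM]add0m addmK mpolyX0.
Qed.

(** The third clause makes [D] factor through the image of [iota]: this is a derivation of a subring
    of [L] with values in [L], presented on a ring that merely maps onto the subring. *)
Definition derivation_along (B : comNzRingType) (L : fieldType)
  (iota : {rmorphism B -> L}) (D : B -> L) : Prop :=
  [/\ forall a b, D (a + b) = D a + D b,
      forall a b, D (a * b) = iota a * D b + iota b * D a
    & forall a, iota a = 0 -> D a = 0].

Section DerivationTheory.
Variables (B : comNzRingType) (L : fieldType) (iota : {rmorphism B -> L}) (D : B -> L).
Hypothesis derD : derivation_along iota D.

Lemma derivation0 : D 0 = 0.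
Proof. by case: derD => _ _ ->; rewrite ?rmorph0. Qed.

Lemma derivation_sum (I : Type) (r : seq I) (P : pred I) (F : I -> B) :
  D (\sum_(i <- r | P i) F i) = \sum_(i <- r | P i) D (F i).
Proof. by case: derD => DD _ _; apply: (big_morph D DD derivation0). Qed.

Lemma derivationN a : D (- a) = - D a.
Proof. by apply/eqP; rewrite -addr_eq0; case: derD => DD _ _; rewrite -DD addNr derivation0. Qed.

Lemma derivation_congr a b : iota a = iota b -> D a = D b.
Proof.
move=> e; apply/eqP; rewrite -subr_eq0 -derivationN.
by case: derD => DD _ Dk; rewrite -DD Dk // rmorphB e subrr.
Qed.

Lemma derivation_mmap (K : fieldType) (kap : {rmorphism K -> B}) (n : nat)
  (x : 'I_n -> B) (g : {mpoly K[n]}) :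
  (forall c, D (kap c) = 0) ->
  D (mmap kap x g) = \sum_i iota (mmap kap x (mderiv i g)) * D (x i).
Proof.
move=> Dc; have [DD DM Dk] := derD.
elim/mpoly_ring_ind: g => [c|i|p q hp hq|p q hp hq].
- by rewrite [X in D X]mmapC Dc big1 // => i _; rewrite mderivC !rmorph0 mul0r.
- rewrite mmapX mmap1U (bigD1 i) //= big1 ?addr0 => [|j ji].
    by rewrite mderivXU eqxx !rmorph1 mul1r.
  by rewrite mderivXU (negPf ji) !rmorph0 mul0r.
- rewrite rmorphD DD hp hq -big_split; apply: eq_bigr => i _.
  by rewrite mderivD !rmorphD mulrDl.
- rewrite rmorphM DM hp hq !mulr_sumr -big_split; apply: eq_bigr => i _.
  rewrite mderivM rmorphD !rmorphM rmorphD !rmorphM /=; ring.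
Qed.

End DerivationTheory.

Section ExtendDerivation.
Variables (B : comNzRingType) (L : fieldType) (iota : {rmorphism B -> L}) (D : B -> L).
Hypothesis derD : derivation_along iota D.
Hypothesis char0 : forall k, (k.+1)%:R != 0 :> L.
Variable y : L.

Definition eval_ext : {rmorphism {poly B} -> L} := horner_eval y \o map_poly iota.

Lemma eval_extC b : eval_ext b%:P = iota b.
Proof. by rewrite /= map_polyC /horner_eval hornerC. Qed.

Lemma eval_extX : eval_ext 'X = y.
Proof. by rewrite /= map_polyX /horner_eval hornerX. Qed.

Definition coef_der (p : {poly B}) : L := \sum_(i < size p) D p`_i * y ^+ i.

Lemma coef_der_wide (p : {poly B}) k : (size p <= k)%N -> coef_der p = \sum_(i < k) D p`_i * y ^+ i.
Proof.
move=> le; rewrite /coef_der (big_ord_widen _ (fun i => D p`_i * y ^+ i) le) big_mkcond.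
apply: eq_bigr => i _; case: ltnP => // h.
by rewrite nth_default // (derivation0 derD) mul0r.
Qed.

Lemma coef_derD p q : coef_der (p + q) = coef_der p + coef_der q.
Proof.
pose k := maxn (size p) (size q).
rewrite !(@coef_der_wide _ k) ?leq_maxl ?leq_maxr ?size_polyD // -big_split.
by case: derD => DD _ _; apply: eq_bigr => i _; rewrite coefD DD mulrDl.
Qed.

Lemma coef_der_sum (I : Type) (r : seq I) (P : pred I) (F : I -> {poly B}) :
  coef_der (\sum_(i <- r | P i) F i) = \sum_(i <- r | P i) coef_der (F i).
Proof. by apply: (big_morph _ coef_derD); rewrite /coef_der size_poly0 big_ord0. Qed.

Lemma coef_derZXn c k : coef_der (c *: 'X^k) = D c * y ^+ k.
Proof.
rewrite (@coef_der_wide _ k.+1); last first.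
  by apply: leq_trans (size_scale_leq _ _) _; rewrite size_polyXn.
rewrite (bigD1 ord_max) //= coefZ coefXn eqxx mulr1 big1 ?addr0 // => i ik.
rewrite coefZ coefXn; suff -> : (i == k :> nat) = false by rewrite mulr0 (derivation0 derD) mul0r.
by apply: negbTE; move: ik; rewrite -val_eqE.
Qed.

Lemma coef_derM p q :
  coef_der (p * q) = eval_ext p * coef_der q + eval_ext q * coef_der p.
Proof.
have [DD DM _] := derD.
have e (r : {poly B}) : eval_ext r = \sum_(i < size r) iota r`_i * y ^+ i.
  rewrite -[in LHS](coefK r) poly_def rmorph_sum; apply: eq_bigr => i _.
  by rewrite -mul_polyC rmorphM rmorphXn eval_extC eval_extX.
rewrite -[in LHS](coefK p) -[in LHS](coefK q) !poly_def mulr_suml coef_der_sum.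
under eq_bigr do rewrite mulr_sumr coef_der_sum.
rewrite !e [coef_der q]/coef_der [coef_der p]/coef_der !mulr_suml.
under [X in _ = _ + X]eq_bigr do rewrite mulr_sumr.
rewrite [X in _ = _ + X]exchange_big /= -big_split; apply: eq_bigr => i _.
rewrite mulr_sumr -big_split; apply: eq_bigr => j _ /=.
rewrite -scalerAl -scalerAr -exprD scalerA coef_derZXn DM exprD; ring.
Qed.

(** [w] is the value prescribed for the derivative of [y]; [coef_der] differentiates the
    coefficients only. *)
Definition poly_der (w : L) (p : {poly B}) : L := coef_der p + w * eval_ext p^`().

Lemma poly_derD w p q : poly_der w (p + q) = poly_der w p + poly_der w q.
Proof. by rewrite /poly_der coef_derD derivD rmorphD; ring. Qed.

Lemma poly_derM w p q :
  poly_der w (p * q) = eval_ext p * poly_der w q + eval_ext q * poly_der w p.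
Proof. by rewrite /poly_der coef_derM derivM rmorphD !rmorphM; ring. Qed.

Lemma poly_derC w b : poly_der w b%:P = D b.
Proof.
rewrite /poly_der derivC rmorph0 mulr0 addr0.
have -> : b%:P = b *: 'X^0 by rewrite expr0 alg_polyC.
by rewrite coef_derZXn mulr1.
Qed.

Lemma poly_der0 w : poly_der w 0 = 0.
Proof. by rewrite /poly_der deriv0 rmorph0 mulr0 addr0 /coef_der size_poly0 big_ord0. Qed.

(** If [y] is transcendental over the image of [iota], its derivative is arbitrary. Otherwise it is
    forced by a relation [Q] of least degree: the derivative of [Q] does not vanish at [y], by
    minimality and characteristic 0. The real content is the third clause, that elements evaluating
    to 0 are killed; it follows by descent on the degree. *)
Lemma extend_derivation :
  exists D' : {poly B} -> L, derivation_along eval_ext D' /\ forall b, D' b%:P = D b.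
Proof.
(* A relation for [y] whose degree survives in [L]; since [iota] may have a kernel, the leading
   coefficient has to be tested after mapping. *)
pose good (Q : {poly B}) := eval_ext Q = 0 /\ iota (lead_coef Q) != 0.

have small w (p : {poly B}) : iota (lead_coef p) = 0 ->
    exists2 p0 : {poly B}, (p = 0 \/ (size p0 < size p)%N) &
      eval_ext p0 = eval_ext p /\ poly_der w p = poly_der w p0.
  move=> lp; have [_ _ Dk] := derD.
  exists (p - lead_coef p *: 'X^((size p).-1)).
    have [->|p0] := eqVneq p 0; [by left|right].
    have sp : (0 < size p)%N by rewrite size_poly_gt0.
    rewrite -[X in (_ < X)%N]prednK // ltnS; apply/leq_sizeP => j le.
    rewrite coefB coefZ coefXn; have [->|ne] := eqVneq j (size p).-1.
      by rewrite mulr1 lead_coefE subrr.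
    by rewrite mulr0 subr0 nth_default //; move: le; rewrite leq_eqVlt eq_sym (negPf ne) /=; case: (size p) sp.
  split; first by rewrite rmorphB -mul_polyC rmorphM eval_extC lp mul0r subr0.
  have := poly_derD w (p - lead_coef p *: 'X^((size p).-1)) (lead_coef p *: 'X^((size p).-1)).
  rewrite subrK => ->; rewrite -[in X in _ + X]mul_polyC poly_derM.
  by rewrite eval_extC lp poly_derC Dk // mul0r mulr0 !addr0.
have [exQ|nQ] := boolp.EM (exists Q, good Q); last first.
  (* The transcendental case: any value would do for [w], and 0 is taken. *)
  exists (poly_der 0); split; last exact: poly_derC.
  split; [exact: poly_derD|exact: poly_derM|] => p.
  have [k] := ubnP (size p); elim: k p => // k IH p; rewrite ltnS => pk p0.
  have lp : iota (lead_coef p) = 0.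
    by apply/eqP/negPn/negP => h; apply: nQ; exists p.
  have [q [pz|qp] [eq e']] := small 0 p lp.
    by rewrite pz poly_der0.
  by rewrite e'; apply: IH; rewrite ?eq //; apply: leq_trans qp pk.
have ex : exists k, boolp.asbool (exists Q, good Q /\ size Q = k).
  by case: exQ => Q hQ; exists (size Q); apply/boolp.asboolP; exists Q.
case: (ex_minnP ex) => k /boolp.asboolP [Q [[Q0 lQ] sQ]] Qmin.
have {}Qmin p : good p -> (k <= size p)%N.
  by move=> gp; apply: Qmin; apply/boolp.asboolP; exists p.
have k2 : (1 < k)%N.
  rewrite ltnNge -sQ; apply/negP => /size1_polyC e; move: Q0 lQ.
  by rewrite e eval_extC lead_coefC => ->; rewrite eqxx.
have Q'0 : eval_ext Q^`() != 0.
  apply/eqP => e; have lc : iota (Q^`()`_k.-2) != 0.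
    rewrite coef_deriv (_ : k.-2.+1 = k.-1); last by move: k2; lia.
    rewrite -sQ -lead_coefE rmorphMn -mulr_natr mulf_neq0 //.
    rewrite (_ : (size Q).-1 = k.-2.+1); first exact: char0.
    by rewrite sQ; move: k2; lia.
  have s1 : size Q^`() = k.-1.
    apply/eqP; rewrite eqn_leq; apply/andP; split.
      by have := lt_size_deriv (p := Q); rewrite -size_poly_gt0 sQ => h; have := h _; lia.
    rewrite leqNgt; apply/negP => h; case/negP: lc; apply/eqP.
    by rewrite nth_default ?rmorph0 // -ltnS (_ : k.-2.+1 = k.-1) //; move: k2; lia.
  have := Qmin Q^`(); rewrite s1; suff g : good Q^`() by move/(_ g); lia.
  by split=> //; rewrite lead_coefE s1.
(* The only value that makes the extended derivation kill [Q]. *)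
pose w := - coef_der Q / eval_ext Q^`().
have wQ : poly_der w Q = 0 by rewrite /poly_der /w divfK // addrN.
exists (poly_der w); split; last exact: poly_derC.
split; [exact: poly_derD|exact: poly_derM|] => p.
have [l] := ubnP (size p); elim: l p => // l IH p; rewrite ltnS => pl p0.
have [lp|lp] := eqVneq (iota (lead_coef p)) 0.
  have [q [pz|qp] [eq e']] := small w p lp.
    by rewrite pz poly_der0.
  by rewrite e'; apply: IH; rewrite ?eq //; apply: leq_trans qp pl.
have kp : (k <= size p)%N by apply: Qmin.
pose s := lead_coef p *: 'X^(size p - k).
(* One step of pseudo-division by [Q]. The factor [lead_coef Q] is nonzero in [L], so what holds for
   [p1] can be divided back to [p]. *)
pose p1 := (lead_coef Q)%:P * p - s * Q.
have sp1 : (size p1 < size p)%N.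
  have sp : (0 < size p)%N by lia.
  rewrite -[X in (_ < X)%N]prednK // ltnS; apply/leq_sizeP => j le.
  rewrite coefB coefCM /s -scalerAl coefZ coefXnM.
  have -> : (j < size p - k)%N = false by lia.
  have [->|ne] := eqVneq j (size p).-1.
    rewrite (_ : ((size p).-1 - (size p - k) = (size Q).-1)%N); last by lia.
    by rewrite -!lead_coefE mulrC subrr.
  have [h1 h2] : (size p <= j)%N /\ (size Q <= j - (size p - k))%N.
    by move: kp sp le ne; rewrite sQ; move: (size p) => a; clear -k; lia.
  by rewrite !nth_default ?mulr0 ?subrr.
have := IH p1 (leq_trans sp1 pl); rewrite rmorphB !rmorphM p0 Q0 !mulr0 subr0 => /(_ erefl).
rewrite poly_derD -mulNr !poly_derM wQ p0 Q0 !mulr0 !mul0r !addr0 eval_extC => /eqP.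
by rewrite mulf_eq0 (negPf lQ) => /eqP.
Qed.

End ExtendDerivation.

(** Adjoining the elements one by one gives an iterated polynomial ring over [B0]. Its image in [L]
    contains the listed elements, here the coordinates x_i, which is all of the function field that
    has to be differentiated. *)
Lemma extend_derivation_seq (L : fieldType) (B0 : comNzRingType) (iota0 : {rmorphism B0 -> L})
  (D0 : B0 -> L) (ys : seq L) :
  (forall k, (k.+1)%:R != 0 :> L) -> derivation_along iota0 D0 ->
  exists (B : comNzRingType) (iota : {rmorphism B -> L}) (D : B -> L) (j : {rmorphism B0 -> B}),
    [/\ derivation_along iota D, forall b, iota (j b) = iota0 b, forall b, D (j b) = D0 b
      & forall y, y \in ys -> exists b, iota b = y].
Proof.
move=> ch der0; elim: ys => [|y ys [B [iota [D [j [dD ij Dj lift]]]]]].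
  by exists B0, iota0, D0, idfun.
have [D' [dD' DC]] := extend_derivation dD ch y.
exists {poly B}, (eval_ext iota y), D', (polyC \o j); split=> //.
- by move=> b; rewrite -ij -(eval_extC iota y).
- by move=> b; rewrite -Dj -DC.
- move=> z; rewrite inE => /orP[/eqP ->|/lift[b e]].
    by exists 'X; apply: eval_extX.
  by exists b%:P; rewrite eval_extC.
Qed.

(* If the [a_k] were independent, [d/da_0] would extend to the field; but
   [sum a_i dx_i = 0] on the conormal variety, so [da_0 = - sum x_i da_i]. *)
Lemma conormal_dependent (K L : fieldType) (kap : {rmorphism K -> L}) (n c : nat)
  (g : 'I_c -> {mpoly K[n]}) (x : 'I_n -> L) (lam : 'I_c -> L) (a : 'I_n.+1 -> L) :
  (forall k, (k.+1)%:R != 0 :> L) ->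
  (forall j, mmap kap x (g j) = 0) ->
  (forall i, a (lift ord0 i) = \sum_j lam j * mmap kap x (mderiv i (g j))) ->
  a ord0 = - \sum_i x i * a (lift ord0 i) ->
  exists2 G : {mpoly K[n.+1]}, G != 0 & mmap kap a G = 0.
Proof.
move=> ch gx0 aE a0E; apply: boolp.contrapT => nG.
have inj (G : {mpoly K[n.+1]}) : mmap kap a G = 0 -> G = 0.
  by move=> e; apply/eqP/negPn/negP => G0; apply: nG; exists G.
pose iota0 : {rmorphism {mpoly K[n.+1]} -> L} := mmap kap a.
pose D0 (G : {mpoly K[n.+1]}) := iota0 (mderiv ord0 G).
have dD0 : derivation_along iota0 D0.
  split=> [p q|p q|p /inj ->]; rewrite /D0; first by rewrite mderivD rmorphD.
    by rewrite mderivM rmorphD !rmorphM; ring.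
  by rewrite mderiv0 rmorph0.
have [B [iota [D [j [dD ij Dj lift]]]]] :=
  extend_derivation_seq [seq x i | i <- enum 'I_n] ch dD0.
have liftx i : exists b, iota b = x i by apply: lift; rewrite map_f ?mem_enum.
have [X hX] := boolp.choice liftx.
pose kB : {rmorphism K -> B} := j \o @mpolyC n.+1 K.
have ikB t : iota (kB t) = kap t by rewrite ij; apply: mmapC.
have DkB t : D (kB t) = 0 by rewrite Dj /D0 mderivC rmorph0.
have imm p : iota (mmap kB X p) = mmap kap x p.
  apply: (mpoly_rmorph_eq (f := iota \o mmap kB X) (g := mmap kap x)) => [t|i].
    by rewrite -[LHS]/(iota (mmap kB X _)) [X in iota X]mmapC ikB [RHS]mmapC.
  rewrite -[LHS]/(iota (mmap kB X _)) -[RHS]/(mmap kap x _) !mmapX !mmap1U. exact: hX.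
pose A k := j 'X_k.
have iA k : iota (A k) = a k by rewrite ij; rewrite /iota0 /= mmapX mmap1U.
have DA k : D (A k) = (k == ord0)%:R.
  by rewrite Dj /D0 mderivXU eq_sym rmorph_nat.
have [DD DM Dk] := dD.
have grad k : \sum_i mmap kap x (mderiv i (g k)) * D (X i) = 0.
  have h : D (mmap kB X (g k)) = 0 by apply: Dk; rewrite imm.
  rewrite -[RHS]h (derivation_mmap dD _ _ DkB).
  by apply: eq_bigr => i _; rewrite imm.
have : D (A ord0) = D (- \sum_i X i * A (fintype.lift ord0 i)).
  apply: (derivation_congr dD); rewrite iA a0E rmorphN rmorph_sum; congr (- _).
  by apply: eq_bigr => i _; rewrite rmorphM hX iA.
rewrite DA eqxx (derivationN dD) (derivation_sum dD).
have -> : \sum_i D (X i * A (fintype.lift ord0 i)) = \sum_i a (fintype.lift ord0 i) * D (X i).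
  by apply: eq_bigr => i _; rewrite DM DA iA eq_sym (negPf (neq_lift _ _)) mulr0 add0r.
under eq_bigr do rewrite aE mulr_suml.
(* Summing over [i] first pairs the gradient of each [g k] with the dx_i and gives 0, so [lam] is
   never differentiated. What remains is 1 = 0. *)
rewrite exchange_big big1 ?oppr0 => [/eqP|k _]; first by rewrite oner_eq0.
rewrite -[RHS](mulr0 (lam k)) -[X in _ = _ * X](grad k) mulr_sumr.
by apply: eq_bigr => i _; rewrite mulrA.
Qed.

(** * The field attached to a prime ideal *)

Section PrimeQuotient.
Variables (R : comNzRingType) (I : prime_idealr R).

Definition prime_quot := {ideal_quot I}.

HB.instance Definition _ := GRing.ComNzRing.on prime_quot.

(** Units and inverses are chosen classically: an integral domain structure on the quotient, from
    which fractions are formed, includes them. *)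
Definition prime_quot_unit : pred prime_quot := fun x => boolp.asbool (exists y, y * x = 1).

Definition prime_quot_inv (x : prime_quot) : prime_quot :=
  match boolp.pselect (exists y, y * x = 1) with
  | left e => projT1 (boolp.cid e)
  | right _ => x
  end.

Lemma prime_quot_mulVx : {in prime_quot_unit, left_inverse 1 prime_quot_inv *%R}.
Proof.
move=> x /boolp.asboolP h; rewrite /prime_quot_inv.
by case: boolp.pselect => // e; case: (boolp.cid e).
Qed.

Lemma prime_quot_unitP (x y : prime_quot) : y * x = 1 -> prime_quot_unit x.
Proof. by move=> e; apply/boolp.asboolP; exists y. Qed.

Lemma prime_quot_inv_out : {in [predC prime_quot_unit], prime_quot_inv =1 id}.
Proof.
move=> x /negP h; rewrite /prime_quot_inv.
by case: boolp.pselect => // e; case: h; apply/boolp.asboolP.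
Qed.

HB.instance Definition _ := GRing.ComNzRing_hasMulInverse.Build prime_quot
  prime_quot_mulVx prime_quot_unitP prime_quot_inv_out.

HB.instance Definition _ := GRing.ComUnitRing_isIntegral.Build prime_quot
  (@Quotient.rquot_IdomainAxiom R I).

End PrimeQuotient.

Local Open Scope quotient_scope.

Lemma prime_ideal_field (R : comNzRingType) (P : R -> Prop) :
  P 0 -> ~ P 1 -> (forall a u v, P u -> P v -> P (a * u + v)) ->
  (forall u v, P (u * v) -> P u \/ P v) ->
  exists (L : fieldType) (phi : {rmorphism R -> L}), forall r, phi r = 0 <-> P r.
Proof.
move=> P0 P1 PD PM.
pose S : R -> bool := fun x => boolp.asbool (P x).
have SE x : (x \in S) = boolp.asbool (P x) by [].
have cS : idealr_closed S.
  split; rewrite ?SE; [exact/boolp.asboolP|exact/boolp.asboolPn|].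
  by move=> a u v; rewrite !SE => /boolp.asboolP ? /boolp.asboolP ?; apply/boolp.asboolP/PD.
have pS : prime_idealr_closed S.
  by move=> u v; rewrite !SE => /boolp.asboolP/PM[] h; apply/orP; [left|right]; apply/boolp.asboolP.
pose zC := GRing.isZmodClosed.Build R S (idealr_closedB cS).
pose pI := isProperIdeal.Build R S (idealr_closed_nontrivial cS).
pose prI := isPrimeIdealrClosed.Build R S pS.
pose I : prime_idealr R := HB.pack S zC pI prI.
have pi_mor : monoid_morphism (\pi_({ideal_quot I}) : R -> prime_quot I).
  by split=> [|x y]; rewrite ?pi_oner ?pi_mulr.
have pi_add : zmod_morphism (\pi_({ideal_quot I}) : R -> prime_quot I).
  by move=> x y; rewrite pi_addr pi_oppr.
pose a1 := GRing.isZmodMorphism.Build _ _ _ pi_add.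
pose a2 := GRing.isMonoidMorphism.Build _ _ _ pi_mor.
pose pi : {rmorphism R -> prime_quot I} := HB.pack (\pi_({ideal_quot I}) : R -> prime_quot I) a1 a2.
exists {fraction (prime_quot I)}, (@tofrac _ \o pi) => r.
rewrite -[X in X = _]/(tofrac (pi r)).
have e : (pi r == 0) = (r \in S).
  rewrite -[in RHS](subr0 r); apply/esym; rewrite -(rmorph0 pi).
  exact: (Quotient.idealrBE I r 0).
split=> [/eqP|/boolp.asboolP]; first by rewrite tofrac_eq0 e => /boolp.asboolP.
by rewrite -SE -e => /eqP ->; rewrite rmorph0.
Qed.

Local Close Scope quotient_scope.

(** * Integral curves of polynomial vector fields *)

Section LieDerivative.
Variables (n : nat) (v : 'I_n -> {mpoly RR[n]}).

Definition lie (f : {mpoly RR[n]}) : {mpoly RR[n]} := \sum_i v i * mderiv i f.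

Lemma lieD f g : lie (f + g) = lie f + lie g.
Proof.
by rewrite /lie -big_split; apply: eq_bigr => i _; rewrite mderivD mulrDr.
Qed.

Lemma lieZ c f : lie (c *: f) = c *: lie f.
Proof.
by rewrite /lie scaler_sumr; apply: eq_bigr => i _; rewrite mderivZ scalerAr.
Qed.

Lemma lie_sum (I : Type) (r : seq I) (P : pred I) (F : I -> {mpoly RR[n]}) :
  lie (\sum_(i <- r | P i) F i) = \sum_(i <- r | P i) lie (F i).
Proof.
by apply: (big_morph _ lieD); rewrite /lie big1 // => i _; rewrite mderiv0 mulr0.
Qed.

Lemma lieM f g : lie (f * g) = lie f * g + f * lie g.
Proof.
rewrite /lie mulr_suml mulr_sumr -big_split; apply: eq_bigr => i _.
by rewrite mderivM /=; ring.
Qed.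

Lemma lieC c : lie c%:MP = 0.
Proof. by rewrite /lie big1 // => i _; rewrite mderivC mulr0. Qed.

Lemma lieX i : lie 'X_i = v i.
Proof.
rewrite /lie (bigD1 i) //= big1 ?addr0 => [|j ji]; first by rewrite mderivXU eqxx mulr1.
by rewrite mderivXU (negPf ji) mulr0.
Qed.

(** The Taylor coefficient of order [k] at time 0 of [f] along the flow of [v]. *)
Definition lie_coef (k : nat) (f : {mpoly RR[n]}) : {mpoly RR[n]} :=
  (k`!%:R)^-1 *: iter k lie f.

Lemma lie_coefD k f g : lie_coef k (f + g) = lie_coef k f + lie_coef k g.
Proof.
rewrite /lie_coef; suff -> : iter k lie (f + g) = iter k lie f + iter k lie g.
  by rewrite scalerDr.
by elim: k => //= k ->; rewrite lieD.
Qed.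

Lemma lie_coefC k c : lie_coef k c%:MP = if k is 0 then c%:MP else 0.
Proof.
rewrite /lie_coef; case: k => [|k]; first by rewrite fact0 invr1 scale1r.
suff -> : iter k.+1 lie c%:MP = 0 by rewrite scaler0.
by elim: k => [|k IH]; rewrite iterS ?IH ?lieC // -mpolyC0 lieC.
Qed.

Lemma lie_lie_coef k f : lie (lie_coef k f) = k.+1%:R *: lie_coef k.+1 f.
Proof.
rewrite /lie_coef lieZ -iterS scalerA factS natrM invfM mulrA divff ?mul1r //.
by rewrite pnatr_eq0.
Qed.

(** The formal flow exp(t v) is multiplicative. Multiplication by [k + 1] turns the coefficient of
    order [k + 1] into the Lie derivative of that of order [k], where the Leibniz rule applies. *)
Lemma lie_coefM k f g :
  lie_coef k (f * g) = \sum_(j < k.+1) lie_coef j f * lie_coef (k - j) g.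
Proof.
elim: k => [|k IH].
  by rewrite big_ord1 subn0 /lie_coef fact0 invr1 !scale1r.
apply: (@scalerI _ _ (k.+1%:R : RR)); first by rewrite pnatr_eq0.
rewrite -lie_lie_coef IH lie_sum scaler_sumr.
under eq_bigr do rewrite lieM !lie_lie_coef.
rewrite big_split /=.
(* The weights [j] and [k + 1 - j] come from differentiating the left and the right factor; they add
   up to [k + 1]. *)
pose F (j : nat) := (j%:R : RR) *: (lie_coef j f * lie_coef (k.+1 - j) g).
pose H (j : nat) := ((k.+1 - j)%:R : RR) *: (lie_coef j f * lie_coef (k.+1 - j) g).
rewrite (eq_bigr (fun j : 'I_k.+1 => F j.+1)); last first.
  by move=> j _; rewrite /F subSS scalerAl.
rewrite [X in _ + X](eq_bigr (fun j : 'I_k.+1 => H j)); last first.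
  by move=> j _; rewrite /H -scalerAr subSn // -ltnS.
rewrite (eq_bigr (fun j : 'I_k.+2 => F j + H j)); last first.
  move=> j _; rewrite /F /H -scalerDl -natrD subnKC //; by have := ltn_ord j.
rewrite big_split /= [in RHS]big_ord_recl /= /F scale0r add0r; congr (_ + _).
by rewrite [RHS]big_ord_recr /= /H subnn scale0r addr0.
Qed.

End LieDerivative.

(** A weighted l1 norm, bounded through some list of monomials in which repetitions are allowed;
    sums, products and derivatives then act on lists without collecting terms. The degree bound [d]
    is the price of one derivative. *)
Definition norm_bound (n : nat) (rho : RR) (d : nat) (C : RR) (p : {mpoly RR[n]}) : Prop :=
  exists l : seq (RR * 'X_{1..n}),
    [/\ p = \sum_(x <- l) x.1 *: 'X_[x.2],
        \sum_(x <- l) `|x.1| * rho ^+ mdeg x.2 <= C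
      & all (fun x : RR * 'X_{1..n} => (mdeg x.2 <= d)%N) l].

Section NormBound.
Variables (n : nat) (rho : RR).
Hypothesis rho1 : 1 <= rho.

Lemma rho_ge0 : 0 <= rho.
Proof. exact: le_trans rho1. Qed.

Lemma norm_bound_exists (p : {mpoly RR[n]}) : exists d C, norm_bound rho d C p.
Proof.
pose l := [seq (p@_m, m) | m <- msupp p].
exists (msize p), (\sum_(x <- l) `|x.1| * rho ^+ mdeg x.2), l; split=> //.
  by rewrite /l big_map -mpolyE.
by apply/allP => _ /mapP[m /msize_mdeg_lt h ->] /=; apply: ltnW.
Qed.

Lemma norm_bound_ge0 d C (p : {mpoly RR[n]}) : norm_bound rho d C p -> 0 <= C.
Proof.
move=> [l [_ h _]]; apply: le_trans h; apply: sumr_ge0 => x _.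
by rewrite mulr_ge0 ?exprn_ge0 // (le_trans ler01).
Qed.

Lemma norm_bound_weaken d d' C C' (p : {mpoly RR[n]}) :
  (d <= d')%N -> C <= C' -> norm_bound rho d C p -> norm_bound rho d' C' p.
Proof.
move=> dd CC [l [h1 h2 h3]]; exists l; split=> //; first exact: le_trans CC.
by apply: sub_all h3 => x /= h; apply: leq_trans dd.
Qed.

Lemma norm_bound_eval d C (p : {mpoly RR[n]}) (u : 'I_n -> RR) :
  (forall i, `|u i| <= rho) -> norm_bound rho d C p -> `|p.@[u]| <= C.
Proof.
move=> hu [l [-> h2 _]]; apply: le_trans h2; rewrite rmorph_sum.
apply: le_trans (ler_norm_sum _ _ _) _; apply: ler_sum => x _.
rewrite /= mevalZ normrM ler_wpM2l // mevalX normr_prod mdegE -prodrXr.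
by apply: ler_prod => i _; rewrite normr_ge0 normrX lerXn2r ?nnegrE // (le_trans ler01).
Qed.

Lemma norm_boundD d C1 C2 (p q : {mpoly RR[n]}) :
  norm_bound rho d C1 p -> norm_bound rho d C2 q -> norm_bound rho d (C1 + C2) (p + q).
Proof.
move=> [l [-> h2 h3]] [l' [-> h2' h3']]; exists (l ++ l'); split.
- by rewrite big_cat.
- by rewrite big_cat lerD.
- by rewrite all_cat h3.
Qed.

Lemma norm_bound_sum d C (m : nat) (F : 'I_m -> {mpoly RR[n]}) :
  (forall i, norm_bound rho d C (F i)) -> norm_bound rho d (m%:R * C) (\sum_i F i).
Proof.
elim: m F => [|m IH] F h.
  by exists [::]; split=> //; rewrite ?big_nil ?big_ord0 ?mulr0n ?mul0r.
rewrite big_ord_recr -natr1 mulrDl mul1r.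
by apply: norm_boundD => //; apply: IH.
Qed.

Lemma norm_boundM d1 d2 C1 C2 (p q : {mpoly RR[n]}) :
  norm_bound rho d1 C1 p -> norm_bound rho d2 C2 q ->
  norm_bound rho (d1 + d2) (C1 * C2) (p * q).
Proof.
move=> hp hq; have C10 := norm_bound_ge0 hp; have C20 := norm_bound_ge0 hq.
have [l [-> h2 h3]] := hp; have [l' [-> h2' h3']] := hq.
exists [seq (x.1 * y.1, (x.2 + y.2)%MM) | x <- l, y <- l']; split.
- rewrite big_allpairs_dep /= mulr_suml; apply: eq_bigr => x _.
  rewrite mulr_sumr; apply: eq_bigr => y _.
  by rewrite mpolyXD -scalerAl -scalerAr scalerA.
- rewrite big_allpairs_dep /=; apply: (@le_trans _ _ ((\sum_(x <- l) `|x.1| * rho ^+ mdeg x.2) * (\sum_(x <- l') `|x.1| * rho ^+ mdeg x.2))).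
    rewrite mulr_suml; apply: ler_sum => x _; rewrite mulr_sumr; apply: ler_sum => y _.
    by rewrite normrM mdegD exprD le_eqVlt; apply/orP; left; apply/eqP; ring.
  have s0 (s : seq (RR * 'X_{1..n})) : 0 <= \sum_(x <- s) `|x.1| * rho ^+ mdeg x.2.
    by apply: sumr_ge0 => x _; rewrite mulr_ge0 ?exprn_ge0 // (le_trans ler01).
  by apply: ler_pM.
- apply/allP => _ /allpairsP[[x y] [/= hx hy ->]] /=; rewrite mdegD.
  by apply: leq_add; [exact: (allP h3)|exact: (allP h3')].
Qed.

Lemma norm_bound_deriv d C (p : {mpoly RR[n]}) i :
  norm_bound rho d C p -> norm_bound rho d (d%:R * C) (mderiv i p).
Proof.
move=> [l [-> h2 h3]].
exists [seq ((x.2 i)%:R * x.1, (x.2 - U_(i))%MM) | x : RR * 'X_{1..n} <- l]; split.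
- rewrite big_map raddf_sum; apply: eq_bigr => x _ /=.
  by rewrite mderivZ mderivX scalerA mulrC.
- rewrite big_map /=; apply: (@le_trans _ _ (d%:R * \sum_(x <- l) `|x.1| * rho ^+ mdeg x.2)).
    rewrite mulr_sumr big_seq [leRHS]big_seq; apply: ler_sum => x xl.
    rewrite normrM normr_nat -mulrA; apply: ler_pM; rewrite ?ler0n ?mulr_ge0 ?exprn_ge0 ?rho_ge0 //.
      rewrite ler_nat; apply: leq_trans (allP h3 _ xl).
      by rewrite mdegE (bigD1 i) //= leq_addr.
    by rewrite ler_wpM2l // ler_weXn2l // mdegB.
  by rewrite ler_wpM2l.
- apply/allP => _ /mapP[x xl ->] /=.
  by apply: leq_trans (mdegB _ _) (allP h3 _ xl).
Qed.

Lemma norm_bound_lie (v : 'I_n -> {mpoly RR[n]}) e V d C (p : {mpoly RR[n]}) :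
  (forall i, norm_bound rho e V (v i)) -> norm_bound rho d C p ->
  norm_bound rho (d + e) (n%:R * (V * (d%:R * C))) (lie v p).
Proof.
move=> hv hp; rewrite addnC; apply: norm_bound_sum => i.
by apply: norm_boundM => //; apply: norm_bound_deriv.
Qed.

(** The degree grows by [e] at each step, so step [k + 1] costs a factor [n V (1 + k e)], at most
    [n V (1 + e) (k + 1)]. The product of the factors [k + 1] is the factorial that [lie_coef]
    divides out, and geometric growth remains. *)
Lemma norm_bound_lie_coef (v : 'I_n -> {mpoly RR[n]}) e V C (p : {mpoly RR[n]}) :
  (forall i, norm_bound rho e V (v i)) -> 0 <= V -> norm_bound rho 1 C p ->
  forall k, norm_bound rho (1 + k * e) (C * (n%:R * V * (1 + e)%:R) ^+ k * k`!%:R) (iter k (lie v) p).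
Proof.
move=> hv V0 hp; elim=> [|k IH].
  by rewrite /= fact0 expr0 !mulr1.
have C0 := norm_bound_ge0 hp.
rewrite iterS; apply: norm_bound_weaken (norm_bound_lie hv IH).
  by rewrite mulSn addnCA addnC addnA.
set A := n%:R * V * (1 + e)%:R.
have -> : n%:R * (V * ((1 + k * e)%:R * (C * A ^+ k * (k`!)%:R))) =
  (C * A ^+ k * k`!%:R) * (n%:R * V * (1 + k * e)%:R) by ring.
have -> : C * A ^+ k.+1 * (k.+1)`!%:R = (C * A ^+ k * k`!%:R) * (A * k.+1%:R).
  by rewrite factS natrM exprS; ring.
have A0 : 0 <= A by rewrite !mulr_ge0.
rewrite ler_wpM2l ?mulr_ge0 ?exprn_ge0 //.
have -> : A * k.+1%:R = n%:R * V * ((1 + e) * k.+1)%:R by rewrite natrM /A mulrA.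
by rewrite ler_wpM2l ?mulr_ge0 // ler_nat mulnDl mul1n mulnS; nia.
Qed.

End NormBound.

(** A lower bound on the radius of convergence, with a separate constant for each smaller radius; in
    this form it passes to Cauchy products with the same [T]. *)
Definition radius_ge (T : RR) (a : nat -> RR) : Prop :=
  forall r, 0 < r -> r < T -> exists C, forall k, `|a k| * r ^+ k <= C.

Lemma radius_ge_lt (T : RR) (a : nat -> RR) (t : RR) :
  radius_ge T a -> `|t| < T ->
  Coquelicot.Rbar.Rbar_lt (Coquelicot.Rbar.Finite (Rbasic_fun.Rabs t)) (Coquelicot.PSeries.CV_radius a).
Proof.
move=> h tT.
pose r := (`|t| + T) / 2%:R.
have tr : `|t| < r by rewrite /r; lra.
have rT : r < T by rewrite /r; lra.
have r0 : 0 < r by apply: le_lt_trans tr; rewrite normr_ge0.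
have [C hC] := h r r0 rT.
have [ub _] := Coquelicot.PSeries.CV_radius_bounded a.
apply: (Coquelicot.Rbar.Rbar_lt_le_trans _ (Coquelicot.Rbar.Finite r)); first by rewrite /=; apply/RltP; rewrite RabsE.
apply: ub; exists C => k; apply/RleP; rewrite RabsE RpowE normrM normrX.
by rewrite (ger0_norm (ltW r0)).
Qed.

Lemma radius_geD (T : RR) (a b : nat -> RR) :
  radius_ge T a -> radius_ge T b -> radius_ge T (fun k => a k + b k).
Proof.
move=> ha hb r r0 rT; have [A hA] := ha r r0 rT; have [B hB] := hb r r0 rT.
exists (A + B) => k; apply: (@le_trans _ _ ((`|a k| + `|b k|) * r ^+ k)).
  by rewrite ler_wpM2r ?ler_normD // exprn_ge0 // ltW.
by rewrite mulrDl lerD.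
Qed.

Lemma geometric_linear_bound (s : RR) : 1 < s -> exists2 B, 0 < B & forall k, k.+1%:R <= B * s ^+ k.
Proof.
move=> s1; pose B := 1 + (s - 1)^-1.
have i0 : 0 < (s - 1)^-1 by rewrite invr_gt0 subr_gt0.
have B1 : 1 <= B by rewrite /B lerDl ltW.
exists B; first by apply: lt_le_trans B1.
elim=> [|k IH]; first by rewrite expr0 mulr1.
have sk : 1 <= s ^+ k by apply: exprn_ege1; apply: ltW.
have hB : B * (s - 1) = s by rewrite /B mulrDl mul1r mulVf ?subrK // gt_eqF ?subr_gt0.
have -> : B * s ^+ k.+1 = B * s ^+ k + B * (s - 1) * s ^+ k by rewrite exprS; ring.
rewrite -natr1 hB; apply: lerD => //.
by apply: le_trans sk _; rewrite ler_peMl ?exprn_ge0 ?(ltW s1) // (le_trans ler01 (ltW s1)).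
Qed.

Lemma radius_geM (T : RR) (a b : nat -> RR) :
  radius_ge T a -> radius_ge T b ->
  radius_ge T (fun k => \sum_(j < k.+1) a j * b (k - j)%N).
Proof.
move=> ha hb r r0 rT.
(* A Cauchy product has [k + 1] terms in degree [k]. Bounding them at the larger radius [r'] leaves
   the factor [(r' / r) ^ k], which absorbs this linear growth. *)
pose r' := (r + T) / 2%:R.
have rr' : r < r' by rewrite /r'; lra.
have r'T : r' < T by rewrite /r'; lra.
have r'0 : 0 < r' by apply: lt_trans rr'.
have [A hA] := ha r' r'0 r'T; have [B hB] := hb r' r'0 r'T.
have s1 : 1 < r' / r by rewrite ltr_pdivlMr ?mul1r.
have [M M0 hM] := geometric_linear_bound s1.
exists (M * (A * B)) => k.
have A0 : 0 <= A by apply: (le_trans _ (hA 0%N)); rewrite mulr_ge0 // exprn_ge0 // ltW.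
have rk0 : 0 < r' ^+ k by rewrite exprn_gt0.
have term j : (j <= k)%N -> `|a j * b (k - j)%N| * r' ^+ k <= A * B.
  move=> jk; have -> : r' ^+ k = r' ^+ j * r' ^+ (k - j) by rewrite -exprD subnKC.
  rewrite normrM mulrACA; apply: ler_pM => //; rewrite mulr_ge0 // exprn_ge0 // ltW //.
have sum_le : `|\sum_(j < k.+1) a j * b (k - j)%N| * r' ^+ k <= k.+1%:R * (A * B).
  apply: (@le_trans _ _ (\sum_(j < k.+1) `|a j * b (k - j)%N| * r' ^+ k)).
    by rewrite -mulr_suml ler_wpM2r ?ler_norm_sum // ltW.
  apply: (@le_trans _ _ (\sum_(j < k.+1) A * B)); first by apply: ler_sum => j _; apply: term; rewrite -ltnS.
  by rewrite sumr_const card_ord mulr_natl.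
have e : r ^+ k = r' ^+ k / (r' / r) ^+ k.
  by rewrite -expr_div_n invf_div mulrA mulrC mulrA mulVf ?mul1r // gt_eqF.
have q0 : 0 < (r' / r) ^+ k by rewrite exprn_gt0 // divr_gt0.
rewrite e mulrA ler_pdivrMr //; apply: le_trans sum_le _.
rewrite mulrAC ler_wpM2r //.
by apply: mulr_ge0 => //; apply: (le_trans _ (hB 0%N)); rewrite mulr_ge0 // exprn_ge0 // ltW.
Qed.

Lemma PS_multE (a b : nat -> RR) k :
  Coquelicot.PSeries.PS_mult a b k = \sum_(j < k.+1) a j * b (k - j)%N.
Proof.
rewrite /Coquelicot.PSeries.PS_mult.
suff h m : Rfunctions.sum_f_R0 (fun j => Rdefinitions.Rmult (a j) (b (Nat.sub k j))) m =
  \sum_(j < m.+1) a j * b (k - j)%N by exact: h.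
elim: m => [|m IH]; first by rewrite big_ord1.
by rewrite big_ord_recr /= IH.
Qed.

Section LieSeries.
Variables (n : nat) (v : 'I_n -> {mpoly RR[n]}) (u : 'I_n -> RR).

Definition lie_series (f : {mpoly RR[n]}) (k : nat) : RR := (lie_coef v k f).@[u].

(** Only the coordinates are estimated: [lie_series_curve] carries the same [T] to every polynomial
    by sums and products. *)
Lemma lie_series_radius_var : exists2 T, 0 < T & forall i, radius_ge T (lie_series 'X_i).
Proof.
pose rho := 1 + \sum_i `|u i|.
have rho1 : 1 <= rho by rewrite /rho lerDl sumr_ge0.
have hu i : `|u i| <= rho.
  by rewrite /rho (bigD1 i) //= addrCA lerDl addr_ge0 // sumr_ge0.
have [eV heV] : exists eV : 'I_n -> nat * RR, forall i, norm_bound rho (eV i).1 (eV i).2 (v i).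
  have h i : exists x : nat * RR, norm_bound rho x.1 x.2 (v i).
    by have [d [C hC]] := norm_bound_exists rho (v i); exists (d, C).
  by have [f hf] := boolp.choice h; exists f.
pose e := (\sum_i (eV i).1)%N.
pose V := \sum_i (eV i).2.
have V0 i : 0 <= (eV i).2 by apply: norm_bound_ge0 (heV i).
have hv i : norm_bound rho e V (v i).
  apply: norm_bound_weaken (heV i); first by rewrite /e (bigD1 i) //= leq_addr.
  by rewrite /V (bigD1 i) //= lerDl sumr_ge0.
have VV : 0 <= V by rewrite sumr_ge0.
(* The growth rate of the Lie coefficients; the added 1 makes it invertible. *)
pose A := 1 + n%:R * V * (1 + e)%:R.
have A0 : 0 < A by rewrite /A ltr_pwDl // !mulr_ge0.
exists A^-1 => [|i r r0 rA]; first by rewrite invr_gt0.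
exists rho => k.
have hX : norm_bound rho 1 rho ('X_i : {mpoly RR[n]}).
  exists [:: (1, U_(i)%MM)]; rewrite !big_seq1 /= mdeg1 scale1r normr1 mul1r expr1.
  by split.
have := norm_bound_eval rho1 hu (norm_bound_lie_coef rho1 hv VV hX k).
rewrite /lie_series /lie_coef mevalZ normrM normfV normr_nat => h.
have k0 : 0 < k`!%:R :> RR by rewrite ltr0n fact_gt0.
have h1 : `|(iter k (lie v) 'X_i).@[u]| / k`!%:R <= rho * A ^+ k.
  rewrite ler_pdivrMr //; apply: le_trans h _; rewrite ler_wpM2r ?(ltW k0) // ler_wpM2l //.
    by apply: le_trans rho1.
  by rewrite lerXn2r ?nnegrE ?mulr_ge0 // ?(ltW A0) // /A lerDr.
rewrite mulrC in h1; apply: (@le_trans _ _ (rho * A ^+ k * r ^+ k)).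
  by rewrite ler_wpM2r // exprn_ge0 // ltW.
rewrite -mulrA -exprMn ger_pMr ?(lt_le_trans ltr01) // exprn_ile1 //.
  by rewrite mulr_ge0 ?ltW.
by rewrite -(mulfV (lt0r_neq0 A0)) ler_pM2l // ltW.
Qed.

(* The Lie series is a ring morphism into convergent power series, so it is
   the substitution of the curve given by the series of the coordinates. *)
Lemma lie_series_curve (T : RR) :
  (forall i, radius_ge T (lie_series 'X_i)) ->
  forall f, radius_ge T (lie_series f) /\
    forall t, `|t| < T ->
      Coquelicot.PSeries.PSeries (lie_series f) t =
      f.@[fun i => Coquelicot.PSeries.PSeries (lie_series 'X_i) t].
Proof.
move=> hT; elim/mpoly_ring_ind => [c|i|p q [hp ep] [hq eq]|p q [hp ep] [hq eq]].
- have e k : lie_series c%:MP k = if k is 0 then c else 0.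
    by rewrite /lie_series lie_coefC; case: k => [|k]; rewrite ?mevalC ?meval0.
  split=> [r r0 rT|t tT].
    exists `|c| => k; rewrite e; case: k => [|k]; first by rewrite expr0 mulr1.
    by rewrite normr0 mul0r.
  rewrite mevalC (Coquelicot.PSeries.PSeries_ext _ (fun k => if k is 0 then c else 0)) //.
  rewrite Coquelicot.PSeries.PSeries_decr_1.
    rewrite (Coquelicot.PSeries.PSeries_ext _ (fun=> 0)) // Coquelicot.PSeries.PSeries_const_0.
    by rewrite -[LHS]/(c + t * 0) mulr0 addr0.
  apply: Coquelicot.PSeries.CV_radius_inside; apply: (radius_ge_lt _ tT) => r r0 rT.
  exists `|c| => k; case: k => [|k]; first by rewrite expr0 mulr1.
  by rewrite normr0 mul0r.
- by split=> // t tT; rewrite mevalXU.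
- have e k : lie_series (p + q) k = lie_series p k + lie_series q k.
    by rewrite /lie_series lie_coefD mevalD.
  split=> [r r0 rT|t tT].
    have [C hC] := radius_geD hp hq r0 rT.
    by exists C => k; rewrite e.
  rewrite mevalD -ep // -eq // (Coquelicot.PSeries.PSeries_ext _ _ _ e).
  by apply: Coquelicot.PSeries.PSeries_plus;
    apply: Coquelicot.PSeries.CV_radius_inside; apply: (radius_ge_lt _ tT).
- have e k : lie_series (p * q) k = \sum_(j < k.+1) lie_series p j * lie_series q (k - j)%N.
    rewrite /lie_series lie_coefM rmorph_sum; apply: eq_bigr => j _.
    by rewrite -[LHS]/(_.@[u]) mevalM.
  split=> [r r0 rT|t tT].
    have [C hC] := radius_geM hp hq r0 rT.
    by exists C => k; rewrite e.
  rewrite mevalM -ep // -eq // -[RHS]Coquelicot.PSeries.PSeries_mult; try exact: (radius_ge_lt _ tT).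
  by apply: Coquelicot.PSeries.PSeries_ext => k; rewrite e PS_multE.
Qed.

End LieSeries.

(* The integral curve through [u] stays in the zero set of [S]. *)
Lemma local_min_critical (n : nat) (v : 'I_n -> {mpoly RR[n]}) (S : {mpoly RR[n]} -> Prop)
  (u al : 'I_n -> RR) (eps : RR) :
  (forall f, S f -> S (lie v f)) -> (forall f, S f -> f.@[u] = 0) -> 0 < eps ->
  (forall w, (forall f, S f -> f.@[w] = 0) -> (forall i, `|w i - u i| < eps) ->
     \sum_i al i * u i <= \sum_i al i * w i) ->
  \sum_i al i * (v i).@[u] = 0.
Proof.
move=> Sv Su eps0 hmin.
have [T T0 hT] := lie_series_radius_var v u.
have curve := lie_series_curve hT.
pose gam t i := Coquelicot.PSeries.PSeries (lie_series v u 'X_i) t.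
have eps0' : Rdefinitions.Rlt 0 eps by apply/RltP.
pose F := \sum_i al i *: 'X_i : {mpoly RR[n]}.
have FE w : F.@[w] = \sum_i al i * w i.
  rewrite /F rmorph_sum; apply: eq_bigr => i _.
  by rewrite -[LHS]/(_.@[w]) mevalZ mevalXU.
have gam0 i : gam 0 i = u i.
  rewrite /gam Coquelicot.PSeries.PSeries_0 /lie_series /lie_coef fact0 invr1 scale1r.
  exact: mevalXU.
(* Along the curve, the Taylor coefficients of [f] are multiples of iterated Lie derivatives
   evaluated at [u], and these stay in [S]. *)
have inX t : `|t| < T -> forall f, S f -> f.@[gam t] = 0.
  move=> tT f Sf; rewrite -(curve f).2 // -[RHS](Coquelicot.PSeries.PSeries_const_0 t).
  apply: Coquelicot.PSeries.PSeries_ext => k; rewrite /lie_series /lie_coef mevalZ.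
  have Sk : S (iter k (lie v) f) by elim: k => //= k; apply: Sv.
  by rewrite Su // mulr0.
have T0' : `|0 : RR| < T by rewrite normr0.
have [del del0 hdel] : exists2 del, 0 < del & forall t, `|t| < del -> forall i, `|gam t i - u i| < eps.
  have cont i : exists d, 0 < d /\ forall t, `|t| < d -> `|gam t i - u i| < eps.
    have := Coquelicot.PSeries.PSeries_continuity _ _ (radius_ge_lt (hT i) T0').
    move=> /(_ eps eps0') [d [/RltP d0 hd]].
    exists d; split=> // t td; rewrite -gam0.
    have [->|t0] := eqVneq t 0; first by rewrite subrr normr0.
    have := hd t; rewrite /= /Rfunctions.R_dist => h; apply/RltP; rewrite -RabsE.
    apply: h; split; first by split=> //; apply/eqP; rewrite eq_sym.
    by rewrite RabsE; apply/RltP; rewrite -[X in `|X|]/(t - 0) subr0.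
  have [d hd] := boolp.choice cont.
  exists (\big[Order.min/1]_i d i).
    by apply: (big_ind (fun x : RR => 0 < x)) => // [x y x0 y0|i _]; rewrite ?lt_min ?x0 ?(hd i).1.
  move=> t ht i; apply: (hd i).2; apply: lt_le_trans ht _.
  by rewrite (bigD1 i) //= ge_min lexx.
pose a := Num.min del T.
have a0 : 0 < a by rewrite lt_min del0.
have der := Coquelicot.PSeries.is_derive_PSeries _ _ (radius_ge_lt (curve F).1 T0').
move/Coquelicot.Derive.is_derive_Reals in der.
pose pr : Ranalysis1.derivable_pt (Coquelicot.PSeries.PSeries (lie_series v u F)) 0 := exist _ _ der.
have := Ranalysis1.deriv_minimum (Coquelicot.PSeries.PSeries (lie_series v u F)) (- a) a 0 pr.
have -> : Ranalysis1.derive_pt (Coquelicot.PSeries.PSeries (lie_series v u F)) 0 pr = \sum_i al i * (v i).@[u].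
  rewrite (Ranalysis1.derive_pt_eq_0 _ _ _ _ der) Coquelicot.PSeries.PSeries_0.
  rewrite /Coquelicot.PSeries.PS_derive /lie_series /lie_coef (_ : 1`! = 1%N) // invr1 scale1r [iter 1 _ _]/=.
  rewrite INRE RmultE mul1r /F lie_sum rmorph_sum; apply: eq_bigr => i _.
  by rewrite -[LHS]/(_.@[u]) lieZ lieX mevalZ.
apply; [by apply/RltP; rewrite oppr_lt0|by apply/RltP|].
move=> t /RltP t1 /RltP t2.
have tn : `|t| < a by rewrite ltr_norml t1.
have tT : `|t| < T by apply: lt_le_trans tn _; rewrite ge_min lexx orbT.
have td : `|t| < del by apply: lt_le_trans tn _; rewrite ge_min lexx.
apply/RleP; rewrite !(curve F).2 // !FE.
under eq_bigr do rewrite -/(gam 0 _) gam0.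
by apply: hmin; [exact: inX|exact: hdel].
Qed.

(** * Polyhedral distances *)

Section PolyhedralNorm.
Variables (n : nat) (D : 'rV[RR]_n -> 'rV[RR]_n -> RR).
Hypothesis polyD : polyhedral_distance D.

Local Notation N z := (D z 0).

Lemma dist_sub x y : D x y = N (x - y).
Proof. by case: polyD => _ [tr _]; rewrite -(tr x y (- y)) subrr. Qed.

Lemma dist0_0 : N 0 = 0.
Proof. by case: polyD => -[_ [h _]] _; apply/h. Qed.

Lemma dist0_eq0 z : N z = 0 -> z = 0.
Proof. by case: polyD => -[_ [h _]] _ /h. Qed.

Lemma dist0_ge0 z : 0 <= N z.
Proof. by case: polyD => -[]. Qed.

Lemma dist0N z : N (- z) = N z.
Proof. by case: polyD => -[_ [_ [sym _]]] _; rewrite -[- z]sub0r -dist_sub sym. Qed.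

Lemma dist0D z w : N (z + w) <= N z + N w.
Proof.
case: polyD => -[_ [_ [_ tri]]] _; apply: le_trans (tri _ w _) _.
by rewrite dist_sub addrK.
Qed.

Lemma ball_convex r z w s : 0 < r -> 0 <= s <= 1 -> N z <= r -> N w <= r ->
  N (s *: z + (1 - s) *: w) <= r.
Proof.
move=> r0 /andP[s0 s1] hz hw; case: polyD => _ [_ /(_ r 0 r0)[[m [V hV]] _]].
have [l [l0 [l1 ez]]] := (hV z).1 hz; have [k [k0 [k1 ew]]] := (hV w).1 hw.
apply/(hV _); exists (fun j => s * l j + (1 - s) * k j); split; [|split].
- by move=> j; rewrite addr_ge0 // mulr_ge0 // subr_ge0.
- by rewrite big_split /= -!mulr_sumr l1 k1 !mulr1 addrCA subrr addr0.
- rewrite ez ew !scaler_sumr -big_split; apply: eq_bigr => j _.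
  by rewrite /= !scalerA -scalerDl.
Qed.

(** The ball contains a box around some [c] and, by symmetry, its reflection around [-c]; midpoints
    of the two fill a box around the origin. *)
Lemma dist0_small r : 0 < r -> exists2 d, 0 < d & forall w : 'rV_n, (forall i, `|w 0 i| < d) -> N w <= r.
Proof.
move=> r0; case: polyD => _ [_ /(_ r 0 r0)[_ [c [d [d0 hd]]]]].
exists d => // w hw.
have -> : w = 2%:R^-1 *: (c + w) + (1 - 2%:R^-1) *: (w - c).
  by apply/rowP => i; rewrite !mxE; field.
apply: ball_convex => //; first by apply/andP; split; lra.
  by apply: hd => i; rewrite !mxE addrAC subrr add0r.
rewrite -dist0N; apply: hd => i; rewrite !mxE (_ : _ - _ = - w 0 i) ?normrN //; ring.
Qed.

Lemma dist0_dist z w : `|N z - N w| <= N (z - w).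
Proof.
rewrite ler_norml; apply/andP; split.
  by have := dist0D z (w - z); rewrite addrCA subrr addr0 -(dist0N (w - z)) opprB; lra.
by have := dist0D w (z - w); rewrite addrCA subrr addr0; lra.
Qed.

(* [0] is interior to the ball, so points of the open segment from [0] to a
   point of the ball are interior too. *)
Lemma ball_shrink_interior r z s : 0 < r -> 0 <= s < 1 -> N z <= r ->
  exists2 d, 0 < d & forall w : 'rV_n, (forall i, `|w 0 i| < d) -> N (s *: z + w) <= r.
Proof.
move=> r0 /andP[s0 s1] hz; have [d d0 hd] := dist0_small r0.
have s1' : 0 < 1 - s by rewrite subr_gt0.
exists (d * (1 - s)) => [|w hw]; first by rewrite mulr_gt0.
have -> : w = (1 - s) *: ((1 - s)^-1 *: w) by rewrite scalerA divff ?scale1r // gt_eqF.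
apply: ball_convex => //; first by rewrite s0 ltW.
apply: hd => i; rewrite mxE normrM normfV (gtr0_norm s1') mulrC ltr_pdivrMr //.
Qed.

Lemma dist0_ray_continuous (w : 'rV[RR]_n) r :
  Ranalysis1.continuity (fun t : RR => N (t *: w) - r).
Proof.
move=> t eps /RltP eps0.
have {}eps0 : 0 < eps := eps0.
have e2 : 0 < eps / 2%:R by lra.
have [d d0 hd] := dist0_small e2.
pose M := 1 + \sum_i `|w 0 i|.
have M0 : 0 < M by rewrite /M ltr_pwDl // sumr_ge0.
exists (d / M); split; first by apply/RltP; rewrite divr_gt0.
move=> s [_ /RltP]; rewrite /= /Rfunctions.R_dist RabsE => hs.
apply/RltP; rewrite RabsE.
have -> : Rdefinitions.Rminus (N (s *: w) - r) (N (t *: w) - r) = N (s *: w) - N (t *: w).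
  by rewrite RminusE; ring.
apply: le_lt_trans (dist0_dist _ _) _; rewrite -scalerBl.
apply: le_lt_trans (hd _ _) _; last by lra.
move=> i; rewrite mxE normrM; apply: le_lt_trans (_ : _ <= `|s - t| * M) _.
  by rewrite ler_wpM2l // /M (bigD1 i) //= addrCA lerDl addr_ge0 // sumr_ge0.
by rewrite -ltr_pdivlMr.
Qed.

Lemma dist0_ray_level (w : 'rV[RR]_n) (r a b : RR) : a <= b ->
  N (a *: w) <= r -> r <= N (b *: w) -> exists t, [/\ a <= t, t <= b & N (t *: w) = r].
Proof.
move=> ab ha hb.
have [||t [[/RleP ta /RleP tb] ht]] := Rsqrt_def.IVT_cor _ a b (dist0_ray_continuous w r).
- exact/RleP.
- by apply/RleP; rewrite mulr_le0_ge0 // ?subr_le0 // subr_ge0.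
- by exists t; split=> //; apply/eqP; rewrite -subr_eq0; apply/eqP.
Qed.

(** Each family of vertices that does not span lies in a hyperplane; finitely many hyperplanes have
    to be avoided near [z0]. Vertices outside [S] become zero rows so that all the matrices have one
    size. *)
Lemma generic_direction (m : nat) (V : 'I_m -> 'rV[RR]_n) (z0 : 'rV[RR]_n) (d : RR) : 0 < d ->
  exists w : 'rV[RR]_n, (forall i, `|w 0 i - z0 0 i| < d) /\
    forall S : {set 'I_m}, (w <= \matrix_j (if j \in S then V j else 0))%MS ->
      row_full (\matrix_j (if j \in S then V j else 0)).
Proof.
move=> d0; pose M (S : {set 'I_m}) := \matrix_j (if j \in S then V j else 0).
have hb S : exists b : 'cV[RR]_n, ~~ row_full (M S) -> b != 0 /\ M S *m b = 0.
  have [h|h] := boolP (row_full (M S)); first by exists 0.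
  have : cokermx (M S) != 0 by rewrite -mxrank_eq0 mxrank_coker subn_eq0 -ltnNge ltn_neqAle rank_leq_col andbT.
  move=> /matrix0Pn[i [j hij]]; exists (col j (cokermx (M S))) => _; split.
    apply: contraNneq hij => e; have := congr1 (fun A : 'cV[RR]_n => A i 0) e.
    by rewrite mxE [RHS]mxE => ->.
  by rewrite colE mulmxA mulmx_coker mul0mx.
have [b {}hb] := boolp.choice hb.
(* The equation of the hyperplane restricted to the moment curve [z0 + (t, t^2, ..., t^n)]. Its
   coefficients of positive degree are the entries of [b S], so it is a nonzero polynomial in
   [t]. *)
pose p (S : {set 'I_m}) : {poly RR} :=
  \sum_(i < n) (b S i 0) *: ((z0 0 i)%:P + 'X^(i.+1)).
have pE S t : (p S).[t] = \sum_i (z0 0 i + t ^+ i.+1) * b S i 0.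
  by rewrite horner_sum; apply: eq_bigr => i _; rewrite !hornerE mulrC.
have p0 S : ~~ row_full (M S) -> p S != 0.
  move=> /hb[b0 _]; apply: contraNneq b0 => e; apply/eqP/matrixP => i j; rewrite ord1 mxE.
  have := congr1 (fun q : {poly RR} => q`_(i.+1)) e; rewrite coef_sum coef0 (bigD1 i) //=.
  rewrite coefZ coefD coefC coefXn eqxx add0r mulr1 big1 ?addr0 // => k ki.
  rewrite coefZ coefD coefC coefXn eqSS add0r; suff -> : (i == k :> nat) = false by rewrite mulr0.
  by apply: negbTE; rewrite eq_sym.
pose P := \prod_(S | ~~ row_full (M S)) p S.
have P0 : P != 0 by rewrite prodf_seq_neq0; apply/allP => S _; apply/implyP/p0.
pose d' := Num.min d 1.
have d'0 : 0 < d' by rewrite lt_min d0 ltr01.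
have [t [t1 t2]] : exists t, `|t - d' / 2%:R| < d' / 2%:R /\ P.[t] != 0.
  apply: boolp.contrapT => h; case/eqP: P0.
  apply: (@poly_eq0_interval _ P (d' / 2%:R) (d' / 2%:R)) => [|t ht]; first by rewrite divr_gt0.
  by apply/eqP/negPn/negP => Pt; apply: h; exists t.
have /andP[tp td] : 0 < t < d' by move: t1; rewrite ltr_norml => /andP[]; lra.
have [dd d1] : d' <= d /\ d' <= 1 by rewrite !ge_min !lexx orbT.
exists (\row_i (z0 0 i + t ^+ i.+1)); split=> [i|S].
  rewrite mxE addrC addKr gtr0_norm ?exprn_gt0 //.
  apply: le_lt_trans (lt_le_trans td dd).
  by rewrite exprS ler_piMr ?(ltW tp) // exprn_ile1 ?(ltW tp) //; lra.
rewrite -/(M S) => /submxP[k ek]; apply: contraT => nf; have [_ Mb] := hb S nf.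
have : ((\row_i (z0 0 i + t ^+ i.+1)) *m b S) 0 0 = 0 by rewrite ek -mulmxA Mb mulmx0 mxE.
rewrite mxE; under eq_bigr do rewrite mxE.
rewrite -pE => pt; case/eqP: t2; rewrite horner_prod; apply/eqP; rewrite prodf_seq_eq0.
by apply/hasP; exists S; rewrite ?mem_index_enum // nf pt eqxx.
Qed.

(** Expanding [w] in the vertices of positive weight perturbs the weights; for small [w] they stay
    nonnegative, and their total changes by the linear form [al]. If that change is at most 0, the
    missing mass is given to a convex representation of the centre 0, which does not move the
    point. *)
Lemma ball_half_neighborhood_vertex (m : nat) (V : 'I_m -> 'rV[RR]_n) (r : RR)
  (z : 'rV[RR]_n) (mu : 'I_m -> RR) (S := [set j | 0 < mu j]) : 0 < r ->
  (forall z, closed_ball D r 0 z <-> exists lam : 'I_m -> RR,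
      (forall j, 0 <= lam j) /\ \sum_j lam j = 1 /\ z = \sum_j lam j *: V j) ->
  (forall j, 0 <= mu j) -> \sum_j mu j = 1 -> z = \sum_j mu j *: V j ->
  row_full (\matrix_j (if j \in S then V j else 0)) ->
  exists (al : 'I_n -> RR) (eps : RR), 0 < eps /\
    forall w : 'rV[RR]_n, (forall i, `|w 0 i| < eps) -> \sum_i al i * w 0 i <= 0 -> N (z + w) <= r.
Proof.
move=> rp hV mu0 mu1 emu full.
set MS := \matrix_j _ in full.
pose co (w : 'rV[RR]_n) := w *m pinvmx MS.
have coE w : w = \sum_j (if j \in S then co w 0 j else 0) *: V j.
  have := mulmxKpV (submx_full w full); rewrite -/(co w) mulmx_sum_row => {1}<-.
  by apply: eq_bigr => j _; rewrite rowK; case: ifP; rewrite ?scaler0 ?scale0r.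
pose al i := \sum_(j in S) pinvmx MS i j.
have alE (w : 'rV[RR]_n) : \sum_i al i * w 0 i = \sum_(j in S) co w 0 j.
  rewrite /al; under eq_bigr do rewrite mulr_suml.
  rewrite exchange_big; apply: eq_bigr => j _; rewrite mxE.
  by apply: eq_bigr => i _; rewrite mulrC.
pose mumin := \big[Order.min/1]_(j in S) mu j.
have mumin0 : 0 < mumin.
  by apply: (big_ind (fun x : RR => 0 < x)) => // [x y x0 y0|j]; rewrite ?lt_min ?x0 // inE.
have muminE j : j \in S -> mumin <= mu j.
  by move=> jS; rewrite /mumin (bigD1 j) //= ge_min lexx.
pose Q := 1 + \sum_j \sum_i `|pinvmx MS i j|.
have Q0 : 0 < Q by rewrite /Q ltr_pwDl // sumr_ge0 // => j _; rewrite sumr_ge0.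
have coS (w : 'rV[RR]_n) eps : (forall i, `|w 0 i| <= eps) -> 0 <= eps -> forall j, `|co w 0 j| <= eps * Q.
  move=> hw e0 j; rewrite mxE; apply: le_trans (ler_norm_sum _ _ _) _.
  apply: (@le_trans _ _ (eps * \sum_i `|pinvmx MS i j|)).
    by rewrite mulr_sumr; apply: ler_sum => i _; rewrite normrM ler_wpM2r.
  rewrite ler_wpM2l // /Q (bigD1 j) //= addrCA lerDl addr_ge0 // sumr_ge0 // => k _.
  by rewrite sumr_ge0.
exists al, (mumin / Q); split; first by rewrite divr_gt0.
move=> w hw; rewrite alE => hal.
have hco j : `|co w 0 j| <= mumin.
  have := @coS w (mumin / Q); rewrite divfK ?gt_eqF // => h; apply: h.
    by move=> i; apply: ltW.
  by rewrite divr_ge0 // ltW.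
have h0 : closed_ball D r 0 0 by rewrite /closed_ball dist0_0 ltW.
have [nu [nu0 [nu1 enu]]] := (hV 0).1 h0.
pose c j := mu j + (if j \in S then co w 0 j else 0).
have c0 j : 0 <= c j.
  rewrite /c; case: ifP => jS; last by rewrite addr0.
  by have := hco j; have := muminE j jS; rewrite ler_norml => ? /andP[]; lra.
have c1 : \sum_j c j <= 1.
  rewrite /c big_split /= mu1; rewrite big_mkcond /= in hal *.
  by move: hal; rewrite -[X in _ -> _ <= X]addr0 lerD2l.
apply/(hV _); exists (fun j => c j + (1 - \sum_k c k) * nu j); split; [|split].
- by move=> j; rewrite addr_ge0 // mulr_ge0 // subr_ge0.
- by rewrite big_split /= -mulr_sumr nu1 mulr1 addrC subrK.
- under eq_bigr do rewrite scalerDl -scalerA.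
  rewrite big_split /= -scaler_sumr -enu scaler0 addr0.
  under eq_bigr do rewrite /c scalerDl.
  by rewrite big_split /= -emu -coE.
Qed.

(** The polytope is fixed at radius [N z0] and [z0] is replaced by a generic point of the same
    sphere. The form is then a supporting functional of the facet through that point. *)
Lemma ball_half_neighborhood_aux (z0 : 'rV[RR]_n) (r0 : RR) : 0 < r0 -> z0 != 0 ->
  exists (z : 'rV[RR]_n) (al : 'I_n -> RR) (eps : RR),
    [/\ forall i, `|z 0 i - z0 0 i| < r0, 0 < eps &
      forall w : 'rV[RR]_n, (forall i, `|w 0 i| < eps) -> \sum_i al i * w 0 i <= 0 -> N (z + w) <= N z].
Proof.
move=> r00 z00.
(* If [z0] is interior to its own ball, as on a plateau of a non-homogeneous distance, the zero form
   already works. *)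
have [[eps eps0 heps]|nint] :=
  boolp.EM (exists2 eps, 0 < eps & forall w : 'rV_n, (forall i, `|w 0 i| < eps) -> N (z0 + w) <= N z0).
  exists z0, (fun=> 0), eps; split=> // [i|w hw _]; first by rewrite subrr normr0.
  exact: heps.
pose r := N z0.
have rp : 0 < r.
  by rewrite lt_neqAle dist0_ge0 andbT eq_sym; apply: contraNneq z00 => /dist0_eq0 ->.
pose M := 1 + \sum_i `|z0 0 i|.
have M1 : 1 <= M by rewrite /M lerDl sumr_ge0.
have hM i : `|z0 0 i| <= M.
  by rewrite /M (bigD1 i) //= addrCA lerDl addr_ge0 // sumr_ge0.
(* Scale factors stay in [[1/2, 3/2]]. Moving [z0] radially costs at most [r0 / 4], and the generic
   perturbation at most [3/2] times [r0 / 4], hence less than [r0] altogether. *)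
pose eta := Num.min (2%:R^-1) (r0 / (4%:R * M)).
have M0 : 0 < M by apply: lt_le_trans M1.
have eta0 : 0 < eta by rewrite lt_min invr_gt0 ltr0n divr_gt0 ?mulr_gt0 ?ltr0n.
have eta1 : eta <= 2%:R^-1 by rewrite ge_min lexx.
have etaM : eta * M <= r0 / 4%:R.
  have h : eta <= r0 / (4%:R * M) by rewrite ge_min lexx orbT.
  apply: le_trans (_ : r0 / (4%:R * M) * M <= _); first by rewrite ler_wpM2r // ltW.
  by rewrite invfM -mulrA -mulrA mulVf ?mulr1 // gt_eqF.
have s1 : 0 <= 1 - eta < 1 by apply/andP; split; lra.
have s2 : 0 <= (1 + eta)^-1 < 1.
  have p : 0 < 1 + eta by lra.
  by rewrite invr_ge0 (ltW p) invf_lt1 // ltrDl.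
have [d1 d10 hd1] := ball_shrink_interior rp s1 (lexx r).
(* Were [(1 + eta) *: z0] in the ball, shrinking it towards 0 would make [z0] interior. *)
have out : r < N ((1 + eta) *: z0).
  rewrite ltNge; apply/negP => h; apply: nint.
  have [d d0 hd] := ball_shrink_interior rp s2 h; exists d => // w /hd.
  by rewrite scalerA mulVf ?scale1r //; lra.
have gap : 0 < (N ((1 + eta) *: z0) - r) / 2%:R by lra.
have [d2 d20 hd2] := dist0_small gap.
case: (polyD) => _ [_ /(_ r 0 rp)[[m [V hV]] _]].
pose d := Num.min (Num.min d1 (d2 / 2%:R)) (r0 / 4%:R).
have d0 : 0 < d by rewrite !lt_min d10 !divr_gt0.
have [dd1 dd2 dd3] : [/\ d <= d1, d <= d2 / 2%:R & d <= r0 / 4%:R] by rewrite !ge_min !lexx !orbT.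
have [w0 [hw0 gen]] := generic_direction V z0 d0.
have in1 : N ((1 - eta) *: w0) <= r.
  have -> : (1 - eta) *: w0 = (1 - eta) *: z0 + (1 - eta) *: (w0 - z0).
    by rewrite -scalerDr addrCA subrr addr0.
  apply: hd1 => i; rewrite !mxE normrM ger0_norm; last by lra.
  by have := hw0 i; have := normr_ge0 (w0 0 i - z0 0 i); nra.
have out1 : r < N ((1 + eta) *: w0).
  have h : N ((1 + eta) *: z0 - (1 + eta) *: w0) <= (N ((1 + eta) *: z0) - r) / 2%:R.
    apply: hd2 => i; rewrite -scalerBr !mxE normrM ger0_norm; last by lra.
    by rewrite distrC; have := hw0 i; have := normr_ge0 (w0 0 i - z0 0 i); nra.
  by have := dist0_dist ((1 + eta) *: z0) ((1 + eta) *: w0); rewrite ler_norml => /andP[]; lra.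
(* The generic ray still goes from inside to outside, so it meets the sphere of radius exactly [r],
   the one whose vertices are [V]. *)
have [|t [t1 t2 Nt]] := dist0_ray_level _ in1 (ltW out1); first by lra.
have Nt' : closed_ball D r 0 (t *: w0) by rewrite /closed_ball Nt.
have [mu [mu0 [mu1 emu]]] := (hV (t *: w0)).1 Nt'.
pose S := [set j | 0 < mu j].
have muS j : j \notin S -> mu j = 0.
  by rewrite inE -leNgt => h; apply/eqP; rewrite eq_le h mu0.
have full : row_full (\matrix_j (if j \in S then V j else 0)).
  apply: gen; apply/submxP; exists (t^-1 *: \row_j mu j).
  rewrite -scalemxAl mulmx_sum_row.
  have -> : w0 = t^-1 *: (t *: w0) by rewrite scalerA mulVf ?scale1r //; lra.
  rewrite emu; congr (_ *: _); apply: eq_bigr => j _; rewrite mxE rowK.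
  by case: ifP => // /negbT/muS ->; rewrite !scale0r.
have [al [eps [eps0 hal]]] := ball_half_neighborhood_vertex rp hV mu0 mu1 emu full.
exists (t *: w0), al, eps; split=> //; last by move=> w hw /hal; rewrite Nt; apply.
move=> i; rewrite mxE.
  have -> : t * w0 0 i - z0 0 i = (t - 1) * z0 0 i + t * (w0 0 i - z0 0 i) by ring.
  apply: le_lt_trans (ler_normD _ _) _; rewrite !normrM.
  have h1 : `|t - 1| <= eta by rewrite ler_norml; apply/andP; split; lra.
  have h2 : `|t - 1| * `|z0 0 i| <= eta * M by apply: ler_pM.
  rewrite (ger0_norm (_ : 0 <= t)); last by lra.
  by have := hw0 i; have := normr_ge0 (w0 0 i - z0 0 i); nra.
Qed.

Lemma ball_half_neighborhood (z0 : 'rV[RR]_n) (r0 : RR) : (0 < n)%N -> 0 < r0 ->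
  exists (z : 'rV[RR]_n) (al : 'I_n -> RR) (eps : RR),
    [/\ forall i, `|z 0 i - z0 0 i| < r0, 0 < eps &
      forall w : 'rV[RR]_n, (forall i, `|w 0 i| < eps) -> \sum_i al i * w 0 i <= 0 -> N (z + w) <= N z].
Proof.
move=> n0 r00; have r02 : 0 < r0 / 2%:R by rewrite divr_gt0.
(* The origin lies on no definite ray, so it is first moved by half of the allowance. *)
have [z1 [hz1 z10]] : exists z1 : 'rV[RR]_n, (forall i, `|z1 0 i - z0 0 i| <= r0 / 2%:R) /\ z1 != 0.
  have [->|h] := eqVneq z0 0; last by exists z0; split=> // i; rewrite subrr normr0 ltW.
  exists (const_mx (r0 / 2%:R)); split=> [i|]; first by rewrite !mxE subr0 gtr0_norm.
  apply/eqP => /rowP/(_ (Ordinal n0)); rewrite !mxE => e; by rewrite e ltxx in r02.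
have [z [al [eps [h1 h2 h3]]]] := ball_half_neighborhood_aux r02 z10.
exists z, al, eps; split=> // i.
rewrite -(subrK (z1 0 i) (z 0 i)) -addrA; apply: le_lt_trans (ler_normD _ _) _.
by have := h1 i; have := hz1 i; lra.
Qed.

(** On the half-space where the form does not increase, points near [x] stay in the ball around a
    point of the cell through [x]. A point of X there would be at least as close as [x]. *)
Lemma voronoi_strict_local_min (X : 'rV[RR]_n -> Prop) (x : 'rV[RR]_n) : (0 < n)%N ->
  full_dimensional (voronoi_cell D X x) ->
  exists (al : 'I_n -> RR) (eps : RR), 0 < eps /\
    forall x', X x' -> (forall i, `|x' 0 i - x 0 i| < eps) ->
      \sum_i al i * x' 0 i <= \sum_i al i * x 0 i -> x' = x.
Proof.
move=> n0 [c [r [r0 hc]]].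
have [z [al [eps [h1 h2 h3]]]] := ball_half_neighborhood (x - c) n0 r0.
exists al, eps; split=> // x' Xx' hx' hal; apply/eqP; apply: contraT => /eqP ne.
(* The point of the cell is [x - z]: since [z] is close to [x - c], it is close to [c], and its
   distance to [x] is [N z]. *)
have := hc (x - z) _ x' Xx' ne.
rewrite (dist_sub x) (dist_sub x'); suff h : N (x' - (x - z)) <= N z.
  rewrite subKr ltNge h => H; apply: (H _) => i.
  by have := h1 i; rewrite !mxE -normrN; congr (`|_| < _); ring.
have -> : x' - (x - z) = z + (x' - x) by apply/rowP => i; rewrite !mxE; ring.
apply: h3 => [i|]; first by rewrite !mxE.
by under eq_bigr do rewrite !mxE mulrBr; rewrite sumrB subr_le0.
Qed.

End PolyhedralNorm.

(** * Minima of linear forms *)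

Definition rv_cvg (n : nat) (s : nat -> 'rV[RR]_n) (l : 'rV[RR]_n) : Prop :=
  forall i (e : RR), 0 < e -> exists K, forall k, (K <= k)%N -> `|s k 0 i - l 0 i| < e.

Definition rv_closed (n : nat) (X : 'rV[RR]_n -> Prop) : Prop :=
  forall s l, (forall k, X (s k)) -> rv_cvg s l -> X l.

Lemma inv_nat_small (e : RR) : 0 < e -> exists K, forall k, (K <= k)%N -> (k.+1%:R)^-1 < e.
Proof.
move=> e0; exists (Num.bound e^-1) => k hk.
rewrite -[e]invrK ltf_pV2 ?posrE ?invr_gt0 ?ltr0n //.
apply: lt_le_trans (archi_boundP _) _; first by rewrite invr_ge0 ltW.
by rewrite ler_nat ltnW.
Qed.

(** The condition [k <= phi k], weaker than being increasing, preserves limits and is stable under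
    composition, which serves the coordinatewise extraction. *)
Lemma bolzano_weierstrass_R (s : nat -> RR) (M : RR) : (forall k, `|s k| <= M) ->
  exists phi : nat -> nat, (forall k, (k <= phi k)%N) /\
    exists l, forall e, 0 < e -> exists K, forall k, (K <= k)%N -> `|s (phi k) - l| < e.
Proof.
move=> hs.
have bd k : Rdefinitions.Rle (- M) (s k) /\ Rdefinitions.Rle (s k) M.
  by have := hs k; rewrite ler_norml => /andP[/RleP ? /RleP ?].
have [l hl] := Rtopology.Bolzano_Weierstrass s _ (Rtopology.compact_P3 (- M) M) bd.
have ex k : exists p, (k <= p)%N /\ `|s p - l| < (k.+1%:R)^-1.
  have k0R : Rdefinitions.Rlt 0 (k.+1%:R)^-1 by apply/RltP; rewrite invr_gt0 ltr0n.
  pose d := RIneq.mkposreal _ k0R.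
  have nb : Rtopology.neighbourhood (Rtopology.disc l d) l by exists d => y.
  have [p [kp /RltP hp]] := hl _ k nb; exists p; split; first by apply/ssrnat.leP.
  by rewrite -RabsE.
have [phi hphi] := boolp.choice ex.
exists phi; split; first by move=> k; have [] := hphi k.
exists l => e /inv_nat_small[K hK]; exists K => k /hK.
by apply: lt_trans; have [] := hphi k.
Qed.

Lemma bolzano_weierstrass (n : nat) (s : nat -> 'rV[RR]_n) (M : RR) :
  (forall k i, `|s k 0 i| <= M) ->
  exists (phi : nat -> nat) (l : 'rV[RR]_n),
    (forall k, (k <= phi k)%N) /\ rv_cvg (fun k => s (phi k)) l.
Proof.
move=> hs.
suff /(_ n (leqnn n))[phi [l [h1 h2]]] : forall m, (m <= n)%N ->
    exists phi (l : 'rV[RR]_n), (forall k, (k <= phi k)%N) /\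
      forall i : 'I_n, (i < m)%N -> forall e, 0 < e ->
        exists K, forall k, (K <= k)%N -> `|s (phi k) 0 i - l 0 i| < e.
  by exists phi, l; split=> // i; apply: h2.
elim=> [|m IH] mn; first by exists id, 0.
have [phi [l [h1 h2]]] := IH (ltnW mn).
pose im := Ordinal mn.
have [psi [p1 [l' hl']]] := bolzano_weierstrass_R (fun k => hs (phi k) im).
exists (phi \o psi), (\row_i (if i == im then l' else l 0 i)); split.
  by move=> k; apply: leq_trans (p1 k) (h1 _).
move=> i im1 e e0; rewrite mxE; case: eqVneq => [->|ne]; first exact: hl'.
have im' : (i < m)%N.
  by move: im1; rewrite ltnS leq_eqVlt => /orP[/eqP h|//]; case/eqP: ne; apply: val_inj.
have [K hK] := h2 i im' e e0; exists K => k Kk.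
by apply: hK; apply: leq_trans (p1 k).
Qed.

Section LinearMinimum.
Variables (n : nat).
Implicit Types (al be : 'I_n -> RR) (x u w : 'rV[RR]_n).

Definition lin_form al w : RR := \sum_i al i * w 0 i.

Lemma lin_form_cvg al (s : nat -> 'rV[RR]_n) l : rv_cvg s l ->
  forall e, 0 < e -> exists K, forall k, (K <= k)%N -> `|lin_form al (s k) - lin_form al l| < e.
Proof.
move=> sl e e0; pose Q := 1 + \sum_i `|al i|.
have Q0 : 0 < Q by rewrite /Q ltr_pwDl // sumr_ge0.
have [K hK] := boolp.choice (fun i => sl i (e / Q) (divr_gt0 e0 Q0)).
exists (\max_i K i) => k hk; rewrite /lin_form -sumrB.
apply: le_lt_trans (ler_norm_sum _ _ _) _.
apply: (@le_lt_trans _ _ (\sum_i `|al i| * (e / Q))).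
  apply: ler_sum => i _; rewrite -mulrBr normrM ler_wpM2l // ltW // hK //.
  by apply: leq_trans hk; apply: leq_bigmax.
rewrite -mulr_suml mulrA ltr_pdivrMr // mulrC ltr_pM2l // /Q.
by rewrite ltrDr.
Qed.

Lemma lin_form_min (K : 'rV[RR]_n -> Prop) al (M : RR) x0 :
  rv_closed K -> (forall w, K w -> forall i, `|w 0 i| <= M) -> K x0 ->
  exists2 u, K u & forall w, K w -> lin_form al u <= lin_form al w.
Proof.
move=> cK bK Kx0.
have [m [mub mlub]] : {m | Raxioms.is_lub (fun y => exists2 w, K w & y = - lin_form al w) m}.
  apply: Raxioms.completeness.
    exists (\sum_i `|al i| * M) => _ [w Kw ->]; apply/RleP.
    apply: le_trans (ler_norm _) _; rewrite normrN; apply: le_trans (ler_norm_sum _ _ _) _.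
    by apply: ler_sum => i _; rewrite normrM ler_wpM2l // bK.
  by exists (- lin_form al x0), x0.
have ex k : exists w, K w /\ m - (k.+1%:R)^-1 < - lin_form al w.
  apply: boolp.contrapT => h.
  have /RleP : Rdefinitions.Rle m (m - (k.+1%:R)^-1).
    apply: mlub => _ [w Kw ->]; apply/RleP; rewrite leNgt; apply/negP => h'.
    by apply: h; exists w.
  by rewrite lerBrDr gerDl leNgt invr_gt0 ltr0n.
have [s hs] := boolp.choice ex.
have [phi [l [h1 h2]]] := bolzano_weierstrass (fun k => bK _ (proj1 (hs k))).
exists l; first by apply: cK h2 => k; exact: (proj1 (hs _)).
move=> w Kw; rewrite leNgt; apply/negP => hlt.
have hw : - lin_form al w <= m by apply/RleP; apply: mub; exists w.
pose e := (lin_form al l - lin_form al w) / 2%:R.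
have e0 : 0 < e by rewrite /e; lra.
have [K1 hK1] := lin_form_cvg al h2 e0; have [K2 hK2] := inv_nat_small e0.
have a1 := hK1 (maxn K1 K2) (leq_maxl _ _).
have a2 := hK2 (phi (maxn K1 K2)) (leq_trans (leq_maxr _ _) (h1 _)).
have [_ a3] := hs (phi (maxn K1 K2)).
move: a1 a2 a3; rewrite ltr_norml => /andP[].
by move: (lin_form al (s _)) => y; move: (_^-1) => q; rewrite /e; lra.
Qed.

(** By strictness and compactness the form exceeds its value at [x] by a fixed gap on each face of a
    small box. A slightly perturbed form therefore attains its minimum over the part of X in the box
    off the faces, where it is a local minimum on X. *)
Lemma nearby_local_minima (X : 'rV[RR]_n -> Prop) x al (eps : RR) :
  rv_closed X -> 0 < eps -> X x ->
  (forall w, X w -> (forall i, `|w 0 i - x 0 i| < eps) -> lin_form al w <= lin_form al x -> w = x) ->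
  exists2 del, 0 < del & forall be, (forall i, `|be i - al i| < del) ->
    exists u e, [/\ X u, 0 < e, forall i, `|u 0 i - x 0 i| < eps &
      forall w, X w -> (forall i, `|w 0 i - u 0 i| < e) -> lin_form be u <= lin_form be w].
Proof.
move=> cX e0 Xx strict.
have [h h0 he] : exists2 h : RR, 0 < h & h < eps by exists (eps / 2%:R); lra.
have cvg_box (s : nat -> 'rV[RR]_n) l : (forall k i, `|s k 0 i - x 0 i| <= h) -> rv_cvg s l ->
    forall i, `|l 0 i - x 0 i| <= h.
  move=> hs sl i; rewrite leNgt; apply/negP => lt.
  have [|K /(_ K (leqnn _))] := sl i (`|l 0 i - x 0 i| - h); first by rewrite subr_gt0.
  have := hs K i; have := ler_normD (l 0 i - s K 0 i) (s K 0 i - x 0 i).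
  by rewrite addrA subrK (distrC (l 0 i) (s K 0 i)); lra.
pose Kb w := X w /\ forall i, `|w 0 i - x 0 i| <= h.
have Kb_closed : rv_closed Kb.
  move=> s l hs sl; split; first by apply: cX sl => k; case: (hs k).
  by apply: cvg_box sl => k; case: (hs k).
pose M := h + \sum_i `|x 0 i|.
have Kb_bounded w : Kb w -> forall i, `|w 0 i| <= M.
  move=> [_ hw] i; have := ler_normD (w 0 i - x 0 i) (x 0 i); rewrite subrK => hh.
  apply: le_trans hh _; apply: lerD => //.
  by rewrite (bigD1 i) //= lerDl sumr_ge0.
have Kbx : Kb x by split=> // i; rewrite subrr normr0 ltW.
have gap j : exists2 eta, 0 < eta & forall w, Kb w -> `|w 0 j - x 0 j| = h ->
    lin_form al x + eta <= lin_form al w.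
  pose Kj w := Kb w /\ `|w 0 j - x 0 j| = h.
  have [[w0 Kw0]|nK] := boolp.EM (exists w, Kj w); last first.
    by exists 1 => // w Kw e; case: nK; exists w.
  have Kj_closed : rv_closed Kj.
    move=> s l hs sl; have Kl : Kb l by apply: Kb_closed sl => k; case: (hs k).
    split=> //; apply/eqP; rewrite eq_le (proj2 Kl) /= leNgt; apply/negP => lt.
    have [|K /(_ K (leqnn _))] := sl j (h - `|l 0 j - x 0 j|); first by rewrite subr_gt0.
    have [_ <-] := hs K; have := ler_normD (s K 0 j - l 0 j) (l 0 j - x 0 j).
    by rewrite addrA subrK; lra.
  have [u [Ku uj] umin] := lin_form_min al Kj_closed (fun w Kw => Kb_bounded w (proj1 Kw)) Kw0.
  exists (lin_form al u - lin_form al x); last first.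
    by move=> w Kw wj; rewrite addrC subrK; apply: umin.
  rewrite subr_gt0 ltNge; apply/negP => le.
  have e : u = x by apply: strict => //; [exact: (proj1 Ku)|move=> i; apply: le_lt_trans (proj2 Ku i) he].
  by move: uj; rewrite e subrr normr0 => hh; rewrite -hh ltxx in h0.
have [eta heta] := boolp.choice (fun j => let: ex_intro2 e a b := gap j in ex_intro (fun e => 0 < e /\
  forall w, Kb w -> `|w 0 j - x 0 j| = h -> lin_form al x + e <= lin_form al w) e (conj a b)).
pose et := \big[Order.min/1]_j eta j.
have et0 : 0 < et.
  by apply: (big_ind (fun x : RR => 0 < x)) => // [a b a0 b0|i _]; rewrite ?lt_min ?a0 ?(heta i).1.
have etE j : et <= eta j by rewrite /et (bigD1 j) //= ge_min lexx.
have nh0 : 0 < n.+1%:R * h by rewrite mulr_gt0 ?ltr0n.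
(* The change of the form between two points at distance [h] is at most [n / (n + 1)] times the gap
   [et], hence strictly less. *)
exists (et / (n.+1%:R * h)) => [|be hbe]; first by rewrite divr_gt0.
have [u Ku umin] := lin_form_min be Kb_closed Kb_bounded Kbx.
have inner i : `|u 0 i - x 0 i| < h.
  rewrite lt_neqAle (proj2 Ku) andbT; apply/negP => /eqP ui.
  have a1 := (heta i).2 u Ku ui; have a2 := umin x Kbx; have a3 := etE i.
  have a4 : `|(lin_form be u - lin_form be x) - (lin_form al u - lin_form al x)| < et.
    have -> : (lin_form be u - lin_form be x) - (lin_form al u - lin_form al x) =
        \sum_k (be k - al k) * (u 0 k - x 0 k).
      by rewrite /lin_form -!sumrB; apply: eq_bigr => k _; ring.
    apply: le_lt_trans (ler_norm_sum _ _ _) _.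
    apply: (@le_lt_trans _ _ (\sum_(k < n) et / (n.+1%:R * h) * h)).
      by apply: ler_sum => k _; rewrite normrM; apply: ler_pM => //; [apply: ltW|apply: (proj2 Ku)].
    rewrite sumr_const card_ord -[_ *+ n]mulr_natl (_ : et / _ * h = et / n.+1%:R); last first.
      by rewrite invfM mulrA divfK ?gt_eqF.
    by rewrite mulrCA gtr_pMr // ltr_pdivrMr ?ltr0n // mul1r ltr_nat.
  by move: a4; rewrite ltr_norml => /andP[]; lra.
pose e := \big[Order.min/1]_j (h - `|u 0 j - x 0 j|).
exists u, e; split=> [||i|w Xw hw].
- by case: Ku.
- by apply: (big_ind (fun x : RR => 0 < x)) => // [a b a0 b0|i _]; rewrite ?lt_min ?a0 ?subr_gt0.
- exact: lt_trans (inner i) he.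
apply: umin; split=> // i.
have := ler_normD (w 0 i - u 0 i) (u 0 i - x 0 i); rewrite addrA subrK.
have : e <= h - `|u 0 i - x 0 i| by rewrite /e (bigD1 i) //= ge_min lexx.
by have := hw i; lra.
Qed.

End LinearMinimum.

Lemma meval_continuous (n : nat) (p : {mpoly RR[n]}) (u : 'I_n -> RR) (e : RR) : 0 < e ->
  exists2 d, 0 < d & forall w, (forall i, `|w i - u i| < d) -> `|p.@[w] - p.@[u]| < e.
Proof.
elim/mpoly_ring_ind: p e => [c|i|p q hp hq|p q hp hq] e e0.
- by exists 1 => // w _; rewrite !mevalC subrr normr0.
- by exists e => // w; rewrite !mevalXU; apply.
- have e2 : 0 < e / 2%:R by lra.
  have [d1 d10 h1] := hp _ e2; have [d2 d20 h2] := hq _ e2.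
  exists (Num.min d1 d2) => [|w hw]; first by rewrite lt_min d10.
  have {}h1 : `|p.@[w] - p.@[u]| < e / 2%:R by apply: h1 => i; have := hw i; rewrite lt_min => /andP[].
  have {}h2 : `|q.@[w] - q.@[u]| < e / 2%:R by apply: h2 => i; have := hw i; rewrite lt_min => /andP[].
  rewrite !mevalD opprD addrACA; apply: le_lt_trans (ler_normD _ _) _; lra.
- pose C := 1 + `|p.@[u]| + `|q.@[u]|.
  have C0 : 0 < C by rewrite /C -addrA ltr_pwDl // addr_ge0.
  pose e' := Num.min 1 (e / (2%:R * C)).
  have e'0 : 0 < e' by rewrite lt_min ltr01 divr_gt0 // mulr_gt0 // ltr0n.
  have [d1 d10 h1] := hp _ e'0; have [d2 d20 h2] := hq _ e'0.
  exists (Num.min d1 d2) => [|w hw]; first by rewrite lt_min d10.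
  have {}h1 : `|p.@[w] - p.@[u]| < e' by apply: h1 => i; have := hw i; rewrite lt_min => /andP[].
  have {}h2 : `|q.@[w] - q.@[u]| < e' by apply: h2 => i; have := hw i; rewrite lt_min => /andP[].
  have l1 : e' <= 1 by rewrite ge_min lexx.
  have l2 : e' * (2%:R * C) <= e by rewrite -ler_pdivlMr ?mulr_gt0 ?ltr0n // ge_min lexx orbT.
  have -> : (p * q).@[w] - (p * q).@[u] =
      (p.@[w] - p.@[u]) * (q.@[w] - q.@[u]) + (p.@[w] - p.@[u]) * q.@[u] + p.@[u] * (q.@[w] - q.@[u]).
    by rewrite !mevalM; ring.
  apply: le_lt_trans (ler_normD _ _) _.
  have := ler_normD ((p.@[w] - p.@[u]) * (q.@[w] - q.@[u])) ((p.@[w] - p.@[u]) * q.@[u]).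
  rewrite !normrM; move: h1 h2 l2; rewrite /C.
  have := normr_ge0 (p.@[w] - p.@[u]); have := normr_ge0 (q.@[w] - q.@[u]).
  have := normr_ge0 p.@[u]; have := normr_ge0 q.@[u].
  move: `|p.@[w] - p.@[u]| `|q.@[w] - q.@[u]| `|p.@[u]| `|q.@[u]| e' e'0 l1 => a b c d f.
  move=> f0 f1 d0 c0 b0 a0 af bf.
  move=> hf; have : a * b <= f * 1 by apply: ler_pM => //; [exact: ltW|apply: le_trans f1; apply: ltW].
  have : a * d <= f * d by rewrite ler_wpM2r // ltW.
  have : c * b <= c * f by rewrite ler_wpM2l // ltW.
  by nra.
Qed.

Lemma real_algebraic_closed (n : nat) (X : 'rV[RR]_n -> Prop) :
  real_algebraic_set X -> rv_closed X.
Proof.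
move=> [S hS] s l hs sl; apply/hS => f Sf; apply/eqP/negPn/negP => ne.
have [|d d0 hd] := @meval_continuous _ f (rpoint l) `|f.@[rpoint l]|; first by rewrite normr_gt0.
have [K hK] := boolp.choice (fun i => sl i d d0).
have := hd (rpoint (s (\max_i K i))).
rewrite ((hS _).1 (hs _) f Sf) sub0r normrN ltxx => H; suff : false by [].
by apply: H => i; apply: hK; apply: leq_bigmax.
Qed.

(** * The conormal ideal *)

Definition vanishing (n : nat) (X : 'rV[RR]_n -> Prop) (p : {mpoly RR[n]}) : Prop :=
  forall x, X x -> p.@[rpoint x] = 0.

(** Stated for families because [bundle_ideal_prime] imposes all specializations of [lam] at once;
    each family cuts out an algebraic subset of X. *)
Lemma irreducible_family (n : nat) (X : 'rV[RR]_n -> Prop) (A B : {mpoly RR[n]} -> Prop) :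
  irreducible_real_variety X ->
  (forall x, X x -> (forall p, A p -> p.@[rpoint x] = 0) \/ (forall p, B p -> p.@[rpoint x] = 0)) ->
  (forall p, A p -> vanishing X p) \/ (forall p, B p -> vanishing X p).
Proof.
move=> [[S hS] [_ irr]] h.
pose cut (C : {mpoly RR[n]} -> Prop) (x : 'rV[RR]_n) := X x /\ forall p, C p -> p.@[rpoint x] = 0.
have cutA C : real_algebraic_set (cut C).
  exists (fun p => S p \/ C p) => x; split=> [[/hS h1 h2] p [/h1|/h2] //|hp].
  by split; [apply/hS => p Sp; apply: hp; left|move=> p Cp; apply: hp; right].
have [|e|e] := irr _ _ (cutA A) (cutA B).
- move=> x; split=> [Xx|[[]|[]] //].
  by case: (h x Xx); [left|right].
- by left=> p Ap x /e[_]; apply.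
- by right=> p Bp x /e[_]; apply.
Qed.

Lemma irreducible_mul (n : nat) (X : 'rV[RR]_n -> Prop) (p q : {mpoly RR[n]}) :
  irreducible_real_variety X -> vanishing X (p * q) -> vanishing X p \/ vanishing X q.
Proof.
move=> irr h.
have [|H|H] := @irreducible_family n X (eq p) (eq q) irr; [|by left; apply: H|by right; apply: H].
move=> x /h /eqP; rewrite mevalM mulf_eq0 => /orP[] /eqP e; [left|right] => _ <- //.
Qed.

(* The hyperplanes [sum_i a_i X_i = 0] spanned by the homogenized gradients:
   [a_0 = - sum x_i a_i] is Euler's relation at a point of the variety. *)
Definition conormal (n c : nat) (K S : comNzRingType) (kap : K -> S) (g : 'I_c -> {mpoly K[n]})
  (x : 'I_n -> S) (lam : 'I_c -> S) (j : 'I_n.+1) : S :=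
  let al i := \sum_k lam k * mmap kap x (mderiv i (g k)) in
  if unlift ord0 j is Some i then al i else - \sum_i x i * al i.

Lemma mmap_rmorph (n : nat) (K S T : comNzRingType) (kap : {rmorphism K -> S})
  (psi : {rmorphism S -> T}) (x : 'I_n -> S) (p : {mpoly K[n]}) :
  psi (mmap kap x p) = mmap (psi \o kap) (psi \o x) p.
Proof.
rewrite /mmap rmorph_sum; apply: eq_bigr => m _; rewrite rmorphM /=; congr (_ * _).
by rewrite /mmap1 rmorph_prod; apply: eq_bigr => i _; rewrite rmorphXn.
Qed.

Lemma mmap_ext (n : nat) (K S : comNzRingType) (kap kap' : K -> S)
  (x x' : 'I_n -> S) (p : {mpoly K[n]}) :
  kap =1 kap' -> x =1 x' -> mmap kap x p = mmap kap' x' p.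
Proof.
move=> ek ex; rewrite /mmap; apply: eq_bigr => m _; rewrite ek; congr (_ * _).
by rewrite /mmap1; apply: eq_bigr => i _; rewrite ex.
Qed.

Lemma conormal_ext (n c : nat) (K S : comNzRingType) (kap kap' : K -> S) (g : 'I_c -> {mpoly K[n]})
  (x x' : 'I_n -> S) (lam lam' : 'I_c -> S) :
  kap =1 kap' -> x =1 x' -> lam =1 lam' -> conormal kap g x lam =1 conormal kap' g x' lam'.
Proof.
move=> ek ex el j; have e i : \sum_k lam k * mmap kap x (mderiv i (g k)) =
    \sum_k lam' k * mmap kap' x' (mderiv i (g k)).
  by apply: eq_bigr => k _; rewrite el (mmap_ext _ ek ex).
rewrite /conormal; case: unliftP => [i|] _ //; congr (- _).
by apply: eq_bigr => i _; rewrite ex e.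
Qed.

Lemma conormal_rmorph (n c : nat) (K S T : comNzRingType) (kap : {rmorphism K -> S})
  (psi : {rmorphism S -> T}) (g : 'I_c -> {mpoly K[n]}) (x : 'I_n -> S) (lam : 'I_c -> S) j :
  psi (conormal kap g x lam j) = conormal (psi \o kap) g (psi \o x) (psi \o lam) j.
Proof.
have e i : psi (\sum_k lam k * mmap kap x (mderiv i (g k))) =
    \sum_k psi (lam k) * mmap (psi \o kap) (psi \o x) (mderiv i (g k)).
  by rewrite rmorph_sum; apply: eq_bigr => k _; rewrite rmorphM mmap_rmorph.
rewrite /conormal; case: unliftP => [i|] _; first exact: e.
rewrite rmorphN rmorph_sum; congr (- _); apply: eq_bigr => i _.
by rewrite rmorphM e.
Qed.

Section ConormalIdeal.
Variables (n c : nat) (X : 'rV[RR]_n -> Prop) (g : 'I_c -> {mpoly RR[n]}).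
Hypothesis irrX : irreducible_real_variety X.
Hypothesis gX : forall j, vanishing X (g j).

Local Notation conor x lam := (conormal (@idfun RR) g (rpoint x) lam).

Definition conormal_ideal (G : {mpoly RR[n.+1]}) : Prop :=
  forall x lam, X x -> G.@[conor x lam] = 0.

Definition join_point (S : Type) (x : 'I_n -> S) (lam : 'I_c -> S) (k : 'I_(n + c)) : S :=
  match split k with inl i => x i | inr j => lam j end.

Definition bundle_ideal (p : {mpoly RR[n + c]}) : Prop :=
  forall x lam, X x -> p.@[join_point (rpoint x) lam] = 0.

(** For fixed [x] the product vanishes in the domain of polynomials in [lam], so one factor does.
    The points where [p], respectively [q], vanishes for every [lam] form two algebraic sets
    covering X, and irreducibility selects one. *)
Lemma bundle_ideal_prime p q :
  bundle_ideal (p * q) -> bundle_ideal p \/ bundle_ideal q.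
Proof.
move=> h.
pose at_lam (p : {mpoly RR[n + c]}) lam : {mpoly RR[n]} :=
  mmap (@mpolyC n RR) (join_point (fun i => 'X_i) (fun j => (lam j)%:MP)) p.
pose at_x (p : {mpoly RR[n + c]}) (x : 'rV[RR]_n) : {mpoly RR[c]} :=
  mmap (@mpolyC c RR) (join_point (fun i => (x 0 i)%:MP) (fun j => 'X_j)) p.
have eval_lam p0 lam x : (at_lam p0 lam).@[rpoint x] = p0.@[join_point (rpoint x) lam].
  rewrite -[LHS]/(meval _ _) (mmap_rmorph _ (meval (rpoint x))) /meval.
  apply: mmap_ext => [t|k] /=; first exact: mevalC.
  by rewrite /join_point; case: split => i; rewrite ?mevalXU ?mevalC.
have eval_x p0 lam x : (at_x p0 x).@[lam] = p0.@[join_point (rpoint x) lam].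
  rewrite -[LHS]/(meval _ _) (mmap_rmorph _ (meval lam)) /meval.
  apply: mmap_ext => [t|k] /=; first exact: mevalC.
  by rewrite /join_point; case: split => i; rewrite ?mevalXU ?mevalC.
have [|H|H] := @irreducible_family n X (fun u => exists lam, u = at_lam p lam)
                 (fun u => exists lam, u = at_lam q lam) irrX.
- move=> x Xx; have : at_x p x * at_x q x = 0.
    by apply: mpoly_eq0_all => lam; rewrite mevalM !eval_x -mevalM; apply: h.
  move=> /eqP; rewrite mulf_eq0 => /orP[] /eqP e; [left|right] => _ [lam ->];
    by rewrite eval_lam -eval_x e meval0.
- by left=> x lam Xx; rewrite -eval_lam; apply: H => //; exists lam.
- by right=> x lam Xx; rewrite -eval_lam; apply: H => //; exists lam.
Qed.

Definition generic_conormal : 'I_n.+1 -> {mpoly RR[n + c]} :=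
  conormal (@mpolyC (n + c) RR) g (fun i => 'X_(lshift c i)) (fun j => 'X_(rshift n j)).

Definition bundle_pullback : {rmorphism {mpoly RR[n.+1]} -> {mpoly RR[n + c]}} :=
  mmap (@mpolyC (n + c) RR) generic_conormal.

Lemma join_point_l (S : Type) (x : 'I_n -> S) (lam : 'I_c -> S) i :
  join_point x lam (lshift c i) = x i.
Proof. by rewrite /join_point (unsplitK (inl _ i)). Qed.

Lemma join_point_r (S : Type) (x : 'I_n -> S) (lam : 'I_c -> S) j :
  join_point x lam (rshift n j) = lam j.
Proof. by rewrite /join_point (unsplitK (inr _ j)). Qed.

Lemma bundle_pullback_eval G x lam :
  (bundle_pullback G).@[join_point (rpoint x) lam] = G.@[conor x lam].
Proof.
rewrite -[LHS]/(meval _ (mmap _ _ _)) (mmap_rmorph _ (meval _)) {2}/meval.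
apply: mmap_ext => [t|j] /=; first exact: mevalC.
rewrite -[LHS]/(meval _ (conormal _ _ _ _ _)) conormal_rmorph.
apply: conormal_ext => [t|i|k] /=; first exact: mevalC.
  by rewrite mevalXU join_point_l.
by rewrite mevalXU join_point_r.
Qed.

Lemma conormal_idealE G : conormal_ideal G <-> bundle_ideal (bundle_pullback G).
Proof.
by split=> h x lam Xx; have := h x lam Xx; rewrite bundle_pullback_eval.
Qed.

Lemma conormal_ideal_prime G H :
  conormal_ideal (G * H) -> conormal_ideal G \/ conormal_ideal H.
Proof.
rewrite !conormal_idealE rmorphM; exact: bundle_ideal_prime.
Qed.

Lemma conormal_ideal_lin a G b H :
  conormal_ideal G -> conormal_ideal H -> conormal_ideal (a * G + b * H).
Proof.
by move=> hG hH x lam Xx; rewrite mevalD !mevalM hG // hH // !mulr0 addr0.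
Qed.

(** [conormal_dependent] is applied in the function field of X times R^c. A relation between the
    generic conormal coordinates there is an element of the ideal. *)
Lemma conormal_ideal_neq0 : exists2 G, G != 0 & conormal_ideal G.
Proof.
have [x0 Xx0] := (proj2 irrX).1.
have [||||L [phi hphi]] := @prime_ideal_field _ bundle_ideal.
- by move=> x lam _; rewrite meval0.
- by move=> /(_ x0 (fun=> 0) Xx0)/eqP; rewrite meval1 oner_eq0.
- by move=> a u v hu hv x lam Xx; rewrite mevalD mevalM hu // hv // mulr0 addr0.
- exact: bundle_ideal_prime.
pose kap : {rmorphism RR -> L} := phi \o @mpolyC (n + c) RR.
pose x i := phi 'X_(lshift c i); pose lam j := phi 'X_(rshift n j).
have [k|j|i||G G0 hG] := @conormal_dependent RR L kap n c g x lam
    (fun j => phi (generic_conormal j)).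
- apply/eqP => e.
  have : bundle_ideal k.+1%:R by apply/hphi; rewrite rmorph_nat.
  by move=> /(_ x0 (fun=> 0) Xx0)/eqP; rewrite rmorph_nat pnatr_eq0.
- have e : mmap kap x (g j) = phi (mmap (@mpolyC (n + c) RR) (fun i => 'X_(lshift c i)) (g j)).
    by rewrite mmap_rmorph; apply: mmap_ext.
  rewrite e; apply/hphi => y mu Xy.
  rewrite -[LHS]/(meval _ _) mmap_rmorph -[RHS](gX j Xy) [RHS]/meval.
  apply: mmap_ext => [t|i] /=; first exact: mevalC.
  by rewrite mevalXU join_point_l.
- by rewrite conormal_rmorph /conormal liftK.
- rewrite conormal_rmorph /conormal unlift_none; congr (- _); apply: eq_bigr => i _.
  by rewrite conormal_rmorph /conormal liftK.
exists G => //; apply/conormal_idealE/hphi.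
by rewrite -hG /= mmap_rmorph; apply: mmap_ext.
Qed.

Lemma conormalZ t x lam j : conor x (fun k => t * lam k) j = t * conor x lam j.
Proof.
rewrite /conormal; case: unliftP => [i|] _.
  by rewrite mulr_sumr; apply: eq_bigr => k _; rewrite mulrA.
rewrite mulrN mulr_sumr; congr (- _); apply: eq_bigr => i _.
rewrite mulrCA; congr (_ * _); rewrite mulr_sumr.
by apply: eq_bigr => k _; rewrite mulrA.
Qed.

End ConormalIdeal.

Lemma dhomog_meval (n : nat) (K : comNzRingType) (d : nat) (p : {mpoly K[n]}) (t : K) (v : 'I_n -> K) :
  p \is d.-homog -> p.@[fun i => t * v i] = t ^+ d * p.@[v].
Proof.
move=> /dhomogP hp; rewrite !mevalE mulr_sumr big_seq [RHS]big_seq.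
apply: eq_bigr => m /hp /= <-; rewrite mulrCA; congr (_ * _).
by under eq_bigr do rewrite exprMn; rewrite big_split prodrXr mdegE.
Qed.

(** * Principality of the conormal ideal *)

Section Principal.
Variables (n c : nat) (X : 'rV[RR]_n -> Prop) (g : 'I_c -> {mpoly RR[n]}).
Hypothesis irrX : irreducible_real_variety X.
Hypothesis gX : forall j, vanishing X (g j).

(** Scaling [lam] by [t] scales the conormal vector by [t]; the values of the homogeneous components
    are the coefficients of a polynomial in [t] that vanishes on an interval. *)
Lemma conormal_ideal_homog G d :
  conormal_ideal X g G -> conormal_ideal X g (pihomog mdeg d G).
Proof.
move=> hG x lam Xx; set a := conormal _ _ _ _.
(* Above the degree of [G] for the decomposition, and above [d] so that coefficient [d] can be read
   off. *)
pose k := maxn (msize G) d.+1.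
pose q : {poly RR} := \poly_(e < k) (pihomog mdeg e G).@[a].
have q0 : q = 0.
  apply: (@poly_eq0_interval _ q 0 1) => // t _.
  rewrite horner_poly -[RHS](hG x (fun j => t * lam j) Xx).
  rewrite [in RHS](pihomog_partitionE (leq_maxl (msize G) d.+1)) rmorph_sum; apply: eq_bigr => e _.
  rewrite mulrC -dhomog_meval ?pihomogP //; apply: meval_eq => j.
  by rewrite conormalZ.
have := congr1 (fun u : {poly RR} => u`_d) q0.
by rewrite coef_poly leq_maxr coef0.
Qed.

Lemma conormal_ideal_const b : conormal_ideal X g b%:MP -> b = 0.
Proof.
have [x0 Xx0] := (proj2 irrX).1.
by move=> /(_ x0 (fun=> 0) Xx0); rewrite mevalC.
Qed.

Lemma homog_component_neq0 (G : {mpoly RR[n.+1]}) : G != 0 ->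
  exists2 d, (d < msize G)%N & pihomog mdeg d G != 0.
Proof.
move=> G0; apply: boolp.contrapT => h; case/eqP: G0.
rewrite (pihomog_partitionE (leqnn (msize G))) big1 // => d _.
by apply/eqP/negPn/negP => hd; apply: h; exists d.
Qed.

Hypothesis indep : forall b : {mpoly RR[n]}, conormal_ideal X g (mlift n RR b) -> b = 0.

(** A homogeneous element [f] of least degree is also of least degree in the whole ideal. If it
    factors, primality puts one factor in the ideal, which leaves a constant for the other; so [f]
    is irreducible, hence prime, and [prime_divides_ideal] applies. *)
Lemma conormal_ideal_principal : exists f d,
  [/\ leq 1 d, f != 0, f \is d.-homog, conormal_ideal X g f &
      forall G, conormal_ideal X g G -> divides f G].
Proof.
pose good d := exists f, [/\ f != 0, f \is d.-homog & conormal_ideal X g f].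
have exd : exists d, boolp.asbool (good d).
  have [G G0 hG] := conormal_ideal_neq0 irrX gX.
  have [d _ hd] := homog_component_neq0 G0.
  exists d; apply/boolp.asboolP; exists (pihomog mdeg d G); split=> //.
    exact: pihomogP.
  exact: conormal_ideal_homog.
case: (ex_minnP exd) => d /boolp.asboolP[f [f0 fd hf]] dmin.
have {}dmin u : u != 0 -> conormal_ideal X g u -> (d < msize u)%N.
  move=> u0 hu; have [e lte he] := homog_component_neq0 u0.
  apply: leq_ltn_trans lte; apply: dmin; apply/boolp.asboolP.
  exists (pihomog mdeg e u); split=> //; [exact: pihomogP|exact: conormal_ideal_homog].
have sf : msize f = d.+1.
  apply/eqP; rewrite eqn_leq dmin // andbT msizeE; apply/bigmax_leqP_seq => m hm _.
  by rewrite (dhomog_mf fd hm).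
have unit_small (u : {mpoly RR[n.+1]}) : u != 0 -> (msize u <= 1)%N -> u \is a GRing.unit.
  move=> u0 /msize1_polyC e; move: u0; rewrite e mpolyC_eq0 => u0.
  by apply: (rmorph_unit (@mpolyC n.+1 RR)); rewrite unitfE.
have d1 : (1 <= d)%N.
  rewrite lt0n; apply/eqP => d0; move: hf f0; rewrite [f]msize1_polyC ?sf ?d0 //.
  by move=> /conormal_ideal_const ->; rewrite eqxx.
have fu : f \isn't a GRing.unit.
  apply/negP => fu; have := hf; rewrite /conormal_ideal => h.
  have [x0 Xx0] := (proj2 irrX).1.
  have := h x0 (fun=> 0) Xx0 => e.
  have := rmorph1 (meval (conormal (@idfun RR) g (rpoint x0) (fun=> 0))).
  by rewrite -(divrr fu) rmorphM /= -[meval _ f]/(f.@[_]) e mul0r => /esym/eqP; rewrite oner_eq0.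
have irr_f : irreducible_elt f.
  split=> // u v e.
  have : u * v != 0 by rewrite -e.
  rewrite mulf_eq0 negb_or => /andP[u0 v0].
  have [su0 sv0] : (0 < msize u)%N /\ (0 < msize v)%N.
    by rewrite !lt0n !msize_poly_eq0.
  (* [msize] is the degree plus one, so the two sizes add up to [d + 2]. *)
  have su : (msize u + msize v)%N = d.+2.
    by rewrite -sf e (msizeM u0 v0) prednK // addn_gt0 su0.
  have small a b : (a + b = d.+2)%N -> (d < a)%N -> (b <= 1)%N by clear; lia.
  move: (hf); rewrite {1}e => /(conormal_ideal_prime irrX)[/(dmin _ u0)|/(dmin _ v0)] lt;
    [right|left]; apply: unit_small => //; apply: small lt => //.
  by rewrite addnC.
have pf := (ufd_mpoly RR n.+1).2 f irr_f.
exists f, d; split=> // G hG.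
apply: (prime_divides_ideal_iso (@msplitK n RR) (@mjoinK n RR) pf hf hG).
  by move=> a u b v; apply: conormal_ideal_lin.
by move=> b; rewrite mjoinC; apply: indep.
Qed.

End Principal.

(** * Tangent vector fields *)

Definition jacobian (n c : nat) (g : 'I_c -> {mpoly RR[n]}) : 'M[{mpoly RR[n]}]_(c, n) :=
  \matrix_(j, i) mderiv i (g j).

Definition jacobian_at (n c : nat) (g : 'I_c -> {mpoly RR[n]}) (y : 'I_n -> RR) : 'M[RR]_(c, n) :=
  map_mx (meval y) (jacobian g).

(** Specific to the reals: if [u] kills [A A^T], then [u A] has sum of squares 0. *)
Lemma gram_unit (c n : nat) (A : 'M[RR]_(c, n)) :
  (A *m A^T \in unitmx) = row_free A.
Proof.
apply/idP/idP => [|fA].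
  rewrite -row_free_unit -!row_leq_rank => h; apply: leq_trans h _; exact: mxrankM_maxl.
rewrite -row_free_unit -kermx_eq0; apply/eqP/row_matrixP => i; rewrite row0.
set u := row i _; have uA : u *m (A *m A^T) = 0.
  by apply/sub_kermxP; rewrite row_sub.
have sq : (u *m A) *m (u *m A)^T = 0 by rewrite trmx_mul mulmxA -(mulmxA u) uA mul0mx.
apply: (row_free_inj fA); rewrite mul0mx; apply/rowP => k; rewrite [RHS]mxE.
have := congr1 (fun B : 'M[RR]_1 => B 0 0) sq; rewrite mxE [RHS]mxE => /eqP.
rewrite psumr_eq0 => [/allP/(_ k (mem_index_enum _))|j _]; last first.
  by rewrite [X in _ * X]mxE -expr2 sqr_ge0.
by rewrite /= [X in _ * X]mxE -expr2 sqrf_eq0 => /eqP.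
Qed.

Section TangentFields.
Variables (n c : nat) (X : 'rV[RR]_n -> Prop) (g : 'I_c -> {mpoly RR[n]}).
Hypothesis irrX : irreducible_real_variety X.
Hypothesis gX : forall j, vanishing X (g j).
Hypothesis rank_max : forall (h : 'I_c.+1 -> {mpoly RR[n]}) y,
  (forall j, vanishing X (h j)) -> X y -> (\rank (jacobian_at h (rpoint y)) <= c)%N.

Local Notation M := (jacobian g).

Definition gram_det : {mpoly RR[n]} := \det (M *m M^T).

(* [gram_det] times the orthogonal projection onto the kernel of the Jacobian. *)
Definition tangent_proj : 'M[{mpoly RR[n]}]_n :=
  gram_det%:M - M^T *m \adj (M *m M^T) *m M.

Lemma jacobian_tangent_proj : M *m tangent_proj = 0.
Proof.
by rewrite /tangent_proj mulmxBr !mulmxA mul_mx_adj mul_scalar_mx mul_mx_scalar subrr.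
Qed.

Lemma gram_det_at y : (gram_det.@[y] != 0) = row_free (jacobian_at g y).
Proof.
rewrite -gram_unit unitmxE unitfE /jacobian_at map_trmx -map_mxM.
by rewrite /gram_det -det_map_mx.
Qed.

(** Adding the gradient of [h] to [c] independent rows cannot raise the rank above the maximum
    [c]. *)
Lemma gradient_in_span h y : vanishing X h -> X y -> gram_det.@[rpoint y] != 0 ->
  (\row_i (mderiv i h).@[rpoint y] <= jacobian_at g (rpoint y))%MS.
Proof.
move=> hX Xy; rewrite gram_det_at => fM.
pose H (j : 'I_c.+1) := if unlift ord0 j is Some k then g k else h.
have HX j : vanishing X (H j) by rewrite /H; case: unliftP => [k|] _.
have rk := rank_max HX Xy.
set J := jacobian_at g _ in fM *; set r := \row_i _.
have JH : (J <= jacobian_at H (rpoint y))%MS.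
  apply/row_subP => k; apply: (eq_row_sub (lift ord0 k)); apply/rowP => i.
  by rewrite !mxE /H liftK.
have rH : (r <= jacobian_at H (rpoint y))%MS.
  apply: (eq_row_sub ord0); apply/rowP => i.
  by rewrite !mxE /H unlift_none.
apply: submx_trans rH _; rewrite -(mxrank_leqif_sup JH).
by rewrite eqn_leq mxrankS //= (leq_trans rk) // row_leq_rank.
Qed.

Definition tangent_field (i0 : 'I_n) (i : 'I_n) : {mpoly RR[n]} := tangent_proj i i0.

(** The claim is clear where [gram_det] is nonzero, so the product with [gram_det] vanishes on X,
    and irreducibility removes that factor. *)
Lemma lie_tangent_vanishing i0 h : vanishing X h ->
  ~ vanishing X gram_det -> vanishing X (lie (tangent_field i0) h).
Proof.
move=> hX nD; have [|//|//] := irreducible_mul irrX (_ : vanishing X (gram_det * lie (tangent_field i0) h)).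
move=> y Xy; rewrite mevalM; have [->|D0] := eqVneq gram_det.@[rpoint y] 0; first by rewrite mul0r.
have /submxP[k ek] := gradient_in_span hX Xy D0.
suff -> : (lie (tangent_field i0) h).@[rpoint y] = 0 by rewrite mulr0.
have -> : (lie (tangent_field i0) h).@[rpoint y] =
    ((\row_i (mderiv i h).@[rpoint y]) *m map_mx (meval (rpoint y)) tangent_proj) 0 i0.
  rewrite mxE /lie rmorph_sum; apply: eq_bigr => i _.
  by rewrite rmorphM [(\row_i0 _) _ _]mxE [(map_mx _ _) _ _]mxE mulrC.
by rewrite ek -mulmxA -map_mxM jacobian_tangent_proj map_mx0 mulmx0 mxE.
Qed.

(** The form annihilates every tangent field at [u], that is, all columns of [tangent_proj].
    Unfolding that matrix expresses [gram_det] times the form through the rows of the Jacobian, with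
    explicit multipliers. *)
Lemma local_min_conormal (u : 'rV[RR]_n) (be : 'I_n -> RR) (e : RR) :
  ~ vanishing X gram_det -> X u -> gram_det.@[rpoint u] != 0 -> 0 < e ->
  (forall w, X w -> (forall i, `|w 0 i - u 0 i| < e) -> lin_form be u <= lin_form be w) ->
  exists lam : 'I_c -> RR, forall i, be i = \sum_k lam k * (mderiv i (g k)).@[rpoint u].
Proof.
move=> nD Xu Du e0 hmin; have [[S hS] _] := irrX.
have tang i0 : \sum_i be i * (tangent_field i0 i).@[rpoint u] = 0.
  apply: (@local_min_critical n (tangent_field i0) (vanishing X) (rpoint u) be e) => //.
  - by move=> f hf; apply: lie_tangent_vanishing.
  - by move=> f hf; apply: hf.
  move=> w hw hwu; pose W : 'rV[RR]_n := \row_i w i.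
  have eW : rpoint W =1 w by move=> i; rewrite /rpoint mxE.
  have XW : X W.
    apply/hS => f Sf; rewrite (meval_eq _ eW); apply: hw => y Xy.
    exact: (hS y).1.
  have eL : lin_form be W = \sum_i be i * w i by apply: eq_bigr => i _; rewrite mxE.
  by have := hmin W XW; rewrite eL; apply=> i; rewrite mxE.
pose b : 'rV[RR]_n := \row_i be i; pose ev := meval (rpoint u) : {rmorphism {mpoly RR[n]} -> RR}.
have bP : b *m map_mx ev tangent_proj = 0.
  apply/rowP => i0; rewrite mxE [RHS]mxE -[RHS](tang i0).
  by apply: eq_bigr => i _; rewrite [b _ _]mxE [(map_mx _ _) _ _]mxE.
pose lam : 'rV[RR]_c := (gram_det.@[rpoint u])^-1 *: (b *m map_mx ev (M^T *m \adj (M *m M^T))).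
exists (fun k => lam 0 k) => i.
have bE : b = lam *m map_mx ev M.
  rewrite -scalemxAl -mulmxA -map_mxM; apply: (scalerI Du).
  rewrite scalerA mulfV // scale1r.
  move/eqP: bP; rewrite /tangent_proj map_mxB mulmxBr subr_eq0 => /eqP <-.
  by rewrite map_scalar_mx mul_mx_scalar.
have := congr1 (fun B : 'rV[RR]_n => B 0 i) bE; rewrite [b _ _]mxE [(_ *m _) _ _]mxE => ->.
by apply: eq_bigr => k _; rewrite [(map_mx _ _) _ _]mxE [jacobian g _ _]mxE.
Qed.

Lemma nearby_forms_conormal (x : 'rV[RR]_n) (al : 'I_n -> RR) (eps : RR) :
  X x -> gram_det.@[rpoint x] != 0 -> 0 < eps ->
  (forall w, X w -> (forall i, `|w 0 i - x 0 i| < eps) -> lin_form al w <= lin_form al x -> w = x) ->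
  exists2 del, 0 < del & forall be, (forall i, `|be i - al i| < del) ->
    exists u lam, [/\ X u, gram_det.@[rpoint u] != 0 &
      forall i, be i = \sum_k lam k * (mderiv i (g k)).@[rpoint u]].
Proof.
move=> Xx Dx eps0 strict.
have [|d d0 hd] := @meval_continuous n gram_det (rpoint x) `|gram_det.@[rpoint x]|.
  by rewrite normr_gt0.
(* Within [d] the determinant [gram_det] stays nonzero, so the minimum found is a point where the
   gradients are still independent. *)
pose e := Num.min eps d.
have e0 : 0 < e by rewrite lt_min eps0.
have [ee ed] : e <= eps /\ e <= d by rewrite !ge_min !lexx orbT.
have strict' w : X w -> (forall i, `|w 0 i - x 0 i| < e) -> lin_form al w <= lin_form al x -> w = x.
  by move=> Xw hw; apply: strict => // i; apply: lt_le_trans ee.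
have cX := real_algebraic_closed irrX.1.
have [del del0 hdel] := nearby_local_minima cX e0 Xx strict'.
exists del => // be /hdel[u [e' [Xu e'0 ux umin]]].
have Du : gram_det.@[rpoint u] != 0.
  apply/eqP => Du; have := hd (rpoint u); rewrite Du sub0r normrN ltxx => H.
  have // : false by apply: H => i; apply: lt_le_trans (ux i) ed.
have nD : ~ vanishing X gram_det by move=> /(_ x Xx)/eqP; apply/negP.
have [lam hlam] := local_min_conormal nD Xu Du e'0 umin.
by exists u, lam.
Qed.

Lemma conormal_ideal_mlift (x : 'rV[RR]_n) (al : 'I_n -> RR) (eps : RR) :
  X x -> gram_det.@[rpoint x] != 0 -> 0 < eps ->
  (forall w, X w -> (forall i, `|w 0 i - x 0 i| < eps) -> lin_form al w <= lin_form al x -> w = x) ->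
  forall b, conormal_ideal X g (mlift n RR b) -> b = 0.
Proof.
move=> Xx Dx eps0 strict b hb.
have [del del0 hdel] := nearby_forms_conormal Xx Dx eps0 strict.
apply: (mpoly_eq0_box (c := al) del0) => be /hdel[u [lam [Xu _ hbe]]].
rewrite -[RHS](hb u lam Xu) -[RHS]/(meval _ (mmap _ _ _)) mmap_rmorph [LHS]/meval.
apply: mmap_ext => [t|i] /=; first by rewrite mevalC.
by rewrite mevalXU /conormal liftK hbe.
Qed.

End TangentFields.

(** * The complex projective closure *)

Definition iC : CC := Complex 0 1.

Definition toC : {rmorphism RR -> CC} := real_complex RR.

Lemma complexE (z : CC) : z = toC (complex.Re z) + iC * toC (complex.Im z).
Proof.
case: z => a b; apply/eqP; rewrite eq_complex /=.
by rewrite !mul0r !mul1r ?mulr0 ?subr0 ?addr0 ?add0r !eqxx.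
Qed.

Lemma toC_comb_eq0 (a b : RR) : toC a + iC * toC b = 0 -> a = 0 /\ b = 0.
Proof.
move/eqP; rewrite eq_complex /= !mul0r !mul1r ?mulr0 ?subr0 ?addr0 ?add0r.
by move=> /andP[/eqP ? /eqP ?].
Qed.

Lemma embed_lift (n : nat) (y : 'rV[RR]_n) i : embed y (lift ord0 i) = toC (y 0 i).
Proof. by rewrite /embed liftK. Qed.

Lemma embed0 (n : nat) (y : 'rV[RR]_n) : embed y ord0 = 1.
Proof. by rewrite /embed unlift_none. Qed.

Section HomogeneousPolynomials.
Variables (n : nat) (K : idomainType).

Lemma dhomog_mderiv d (p : {mpoly K[n]}) i : p \is d.-homog -> mderiv i p \is d.-1.-homog.
Proof.
move=> hp; apply/dhomogP => m; rewrite mcoeff_msupp mcoeff_deriv => h.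
have hm : (m + U_(i))%MM \in msupp p.
  by rewrite mcoeff_msupp; apply: contraNneq h => ->; rewrite mul0rn.
by rewrite -(dhomog_mf hp hm) /= mdegD mdeg1 addn1.
Qed.

Lemma dhomog_euler d (p : {mpoly K[n]}) (v : 'I_n -> K) : p \is d.-homog ->
  \sum_i v i * (mderiv i p).@[v] = d%:R * p.@[v].
Proof.
move=> hp; suff e : \sum_i 'X_i * mderiv i p = d%:R *: p.
  rewrite -mevalZ -e rmorph_sum; apply: eq_bigr => i _.
  by rewrite rmorphM /= mevalXU.
rewrite [in RHS](mpolyE p) scaler_sumr.
under eq_bigr => i _ do rewrite [in mderiv i p](mpolyE p) raddf_sum mulr_sumr.
rewrite exchange_big big_seq [RHS]big_seq; apply: eq_bigr => m hm /=.
rewrite -(dhomog_mf hp hm) /= mdegE natr_sum scaler_suml; apply: eq_bigr => i _.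
rewrite mderivZ mderivX -!scalerAr -mpolyXD scalerA [RHS]scalerA mulrC.
have [e|mi] := eqVneq (m i) 0%N; first by rewrite e !mul0r !scale0r.
by rewrite addmC submK // lep1mP.
Qed.

Lemma dhomog_mmap (m d e : nat) (p : {mpoly K[m]}) (F : 'I_m -> {mpoly K[n]}) :
  p \is d.-homog -> (forall j, F j \is e.-homog) ->
  mmap (@mpolyC n K) F p \is (d * e).-homog.
Proof.
move=> hp hF; rewrite /mmap big_seq rpred_sum // => k hk.
rewrite mul_mpolyC; apply: dhomogZ; rewrite -(dhomog_mf hp hk) /= mdegE /mmap1 big_distrl /=.
apply: (big_rec2 (fun (u : {mpoly K[n]}) l => u \is l.-homog)); first exact: dhomog1.
by move=> j l u _ hu; apply: dhomogM => //; rewrite mulnC; apply: dhomogMn.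
Qed.

End HomogeneousPolynomials.

(** The derivative along [ord0] is omitted: at points of X it follows from the others by Euler's
    relation, see [mderiv0_embed]. *)
Definition homogenizes (n : nat) (F : {mpoly CC[n.+1]}) (g : {mpoly RR[n]}) : Prop :=
  forall y : 'rV[RR]_n, F.@[embed y] = toC g.@[rpoint y] /\
    forall i, (mderiv (lift ord0 i) F).@[embed y] = toC (mderiv i g).@[rpoint y].

Lemma homogenization (n : nat) (g : {mpoly RR[n]}) :
  exists F d, F \is d.-homog /\ homogenizes F g.
Proof.
(* All large degrees are reached at once, so that two polynomials can be homogenized in a common
   degree and added. *)
suff [d0 /(_ d0 (leqnn _))[F hF]] : exists d0, forall d, (d0 <= d)%N ->
    exists F, F \is d.-homog /\ homogenizes F g by exists F, d0.
have d0X i d : mderiv (lift ord0 i) ('X_ord0 ^+ d : {mpoly CC[n.+1]}) = 0.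
  elim: d => [|d IH]; first by rewrite expr0 -mpolyC1 mderivC.
  by rewrite exprS mderivM IH mulr0 addr0 mderivXU mul0r.
have hX0 d : ('X_ord0 ^+ d : {mpoly CC[n.+1]}) \is d.-homog.
  by rewrite mpolyXn dhomogX /= mdegMn mdeg1 mul1n.
have eX0 y d : ('X_ord0 ^+ d : {mpoly CC[n.+1]}).@[embed y] = 1.
  by rewrite rmorphXn /= mevalXU embed0 expr1n.
elim/mpoly_ring_ind: g => [c|i|p q [dp hp] [dq hq]|p q [dp hp] [dq hq]].
- exists 0%N => d _; exists ((toC c)%:MP * 'X_ord0 ^+ d); split.
    by rewrite mul_mpolyC; apply: dhomogZ.
  move=> y; split=> [|i]; first by rewrite mevalM eX0 !mevalC mulr1.
  by rewrite mderivM d0X mulr0 addr0 !mderivC mul0r !meval0 rmorph0.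
- exists 1%N => d d1; exists ('X_(lift ord0 i) * 'X_ord0 ^+ d.-1); split.
    rewrite -(prednK d1) -[X in X.-homog]add1n; apply: dhomogM => //.
    by rewrite dhomogX /= mdeg1.
  move=> y; split=> [|k]; first by rewrite mevalM eX0 !mevalXU embed_lift mulr1.
  rewrite mderivM d0X mulr0 addr0 !mderivXU (inj_eq lift_inj) mevalM eX0 mulr1.
  by rewrite !rmorph_nat.
- exists (maxn dp dq) => d; rewrite geq_max => /andP[/hp[F [hF eF]] /hq[G [hG eG]]].
  exists (F + G); split; first exact: dhomogD.
  move=> y; have [e1 e2] := eF y; have [e3 e4] := eG y.
  split=> [|i]; first by rewrite !mevalD e1 e3 rmorphD.
  by rewrite !mderivD !mevalD e2 e4 rmorphD.
- exists (dp + dq)%N => d hd.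
  have [F [hF eF]] := hp dp (leqnn _).
  have [|G [hG eG]] := hq (d - dp)%N; first by lia.
  exists (F * G); split.
    have -> : d = (dp + (d - dp))%N by lia.
    exact: dhomogM.
  move=> y; have [e1 e2] := eF y; have [e3 e4] := eG y.
  split=> [|i]; first by rewrite !mevalM e1 e3 rmorphM.
  by rewrite !mderivM !mevalD !mevalM e1 e2 e3 e4 rmorphD !rmorphM.
Qed.

(** Real and imaginary parts on the real affine chart; if [F] vanishes on X, so do both. *)
Lemma dehomogenization (n : nat) (F : {mpoly CC[n.+1]}) :
  exists p q : {mpoly RR[n]}, forall y : 'rV[RR]_n,
    F.@[embed y] = toC p.@[rpoint y] + iC * toC q.@[rpoint y] /\
    forall i, (mderiv (lift ord0 i) F).@[embed y] =
      toC (mderiv i p).@[rpoint y] + iC * toC (mderiv i q).@[rpoint y].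
Proof.
have ii : iC * iC = -1.
  by apply/eqP; rewrite eq_complex /= !mul0r !mulr0 mulr1 sub0r addr0 eqxx oppr0 eqxx.
elim/mpoly_ring_ind: F => [c|j|F G [p1 [q1 h1]] [p2 [q2 h2]]|F G [p1 [q1 h1]] [p2 [q2 h2]]].
- exists (complex.Re c)%:MP, (complex.Im c)%:MP => y; split=> [|i].
    by rewrite !mevalC -complexE.
  by rewrite !mderivC !meval0 rmorph0 mulr0 addr0.
- case: (unliftP ord0 j) => [i|] ->.
    exists 'X_i, 0 => y; split=> [|k].
      by rewrite !mevalXU embed_lift meval0 rmorph0 mulr0 addr0.
    rewrite mderiv0 meval0 rmorph0 mulr0 addr0 !mderivXU (inj_eq lift_inj).
    by rewrite !rmorph_nat.
  exists 1, 0 => y; split=> [|k].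
    by rewrite mevalXU embed0 meval0 rmorph0 mulr0 addr0 meval1 rmorph1.
  rewrite mderiv0 meval0 rmorph0 mulr0 addr0 mderivXU eq_sym (negPf (neq_lift _ _)).
  by rewrite -mpolyC1 mderivC !meval0 rmorph0.
- exists (p1 + p2), (q1 + q2) => y; have [a1 b1] := h1 y; have [a2 b2] := h2 y.
  split=> [|i]; first by rewrite !mevalD a1 a2 !rmorphD; ring.
  by rewrite !mderivD !mevalD b1 b2 !rmorphD; ring.
- exists (p1 * p2 - q1 * q2), (p1 * q2 + q1 * p2) => y; have [a1 b1] := h1 y; have [a2 b2] := h2 y.
  have key (a b c d : CC) : (a + iC * b) * (c + iC * d) = (a * c - b * d) + iC * (a * d + b * c).
    have -> : (a + iC * b) * (c + iC * d) = a * c + (iC * iC) * (b * d) + iC * (a * d + b * c) by ring.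
    by rewrite ii; ring.
  split=> [|i].
    by rewrite mevalM a1 a2 key mevalB mevalD !mevalM rmorphB rmorphD !rmorphM.
  rewrite mderivM mevalD !mevalM a1 a2 b1 b2 !key mderivB mderivD !mderivM.
  by rewrite mevalB !mevalD !mevalM rmorphB !rmorphD !rmorphM; ring.
Qed.

Section Projective.
Variables (n : nat) (X : 'rV[RR]_n -> Prop).
Local Notation Z := (proj_closure X).

Lemma embed_closure y : X y -> Z (embed y).
Proof.
move=> Xy; split; first by exists ord0; rewrite embed0 oner_eq0.
by move=> F [_]; apply; exists y.
Qed.

Lemma hom_vanishes_closure d F : F \is d.-homog -> (forall y, X y -> F.@[embed y] = 0) ->
  hom_vanishes_on Z F.
Proof.
move=> hF h; split; first by exists d.
move=> p [_]; apply; split; first by exists d.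
by move=> _ [y [Xy ->]]; apply: h.
Qed.

Lemma homogenization_vanishing g : vanishing X g ->
  exists2 F, hom_vanishes_on Z F & homogenizes F g.
Proof.
move=> gX; have [F [d [hF eF]]] := homogenization g; exists F => //.
by apply: (hom_vanishes_closure hF) => y Xy; rewrite (eF y).1 gX // rmorph0.
Qed.

Lemma dehomogenization_vanishing F : hom_vanishes_on Z F ->
  exists p q, [/\ vanishing X p, vanishing X q & forall y i,
    (mderiv (lift ord0 i) F).@[embed y] =
      toC (mderiv i p).@[rpoint y] + iC * toC (mderiv i q).@[rpoint y]].
Proof.
move=> [_ hF]; have [p [q h]] := dehomogenization F.
have pq y : X y -> p.@[rpoint y] = 0 /\ q.@[rpoint y] = 0.
  by move=> Xy; apply: toC_comb_eq0; rewrite -(h y).1 hF //; apply: embed_closure.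
exists p, q; split; [by move=> y /pq[]|by move=> y /pq[]|by move=> y i; apply: (h y).2].
Qed.

Lemma mderiv0_embed F y : hom_vanishes_on Z F -> X y ->
  (mderiv ord0 F).@[embed y] =
    - \sum_i toC (y 0 i) * (mderiv (lift ord0 i) F).@[embed y].
Proof.
move=> [[d hd] hF] Xy; have := dhomog_euler (embed y) hd.
rewrite hF ?mulr0; last exact: embed_closure.
rewrite big_ord_recl embed0 mul1r => /eqP; rewrite addr_eq0 => /eqP ->.
by congr (- _); apply: eq_bigr => i _; rewrite embed_lift.
Qed.

Definition drop0 : 'M[CC]_(n.+1, n) := \matrix_(i, k) (i == lift ord0 k)%:R.

Lemma mul_drop0 k (A : 'M[CC]_(k, n.+1)) : A *m drop0 = \matrix_(j, i) A j (lift ord0 i).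
Proof.
apply/matrixP => j i; rewrite !mxE (bigD1 (lift ord0 i)) //= mxE eqxx mulr1 big1 ?addr0 // => l li.
by rewrite mxE (negPf li) mulr0.
Qed.

Lemma jac_rank_ge_embed k (h : 'I_k -> {mpoly RR[n]}) y :
  (forall j, vanishing X (h j)) -> row_free (jacobian_at h (rpoint y)) ->
  jac_rank_ge Z (embed y) k.
Proof.
move=> hX fJ.
have ex j : exists F, hom_vanishes_on Z F /\ homogenizes F (h j).
  by have [F] := homogenization_vanishing (hX j); exists F.
have [F hF] := boolp.choice ex.
exists F; split; first by move=> j; case: (hF j).
set A := \matrix_(_, _) _.
have e : A *m drop0 = map_mx toC (jacobian_at h (rpoint y)).
  rewrite mul_drop0; apply/matrixP => j i; rewrite !mxE.
  by case: (hF j) => _ /(_ y)[_ ->].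
apply/eqP; rewrite eqn_leq rank_leq_row /=.
apply: leq_trans (mxrankM_maxl A drop0); rewrite e mxrank_map.
by rewrite row_leq_rank.
Qed.

(** Euler's relation recovers column 0 of the complex Jacobian from the others, and those are
    complex combinations of the gradients of real and imaginary parts. The complex rank is thus at
    most a real rank, realized by a choice of independent rows. *)
Lemma embed_jac_rank k y : X y -> jac_rank_ge Z (embed y) k ->
  exists r (h : 'I_r -> {mpoly RR[n]}), [/\ (k <= r)%N, forall j, vanishing X (h j)
    & row_free (jacobian_at h (rpoint y))].
Proof.
move=> Xy [F [hF rF]].
have ex j : exists pq : {mpoly RR[n]} * {mpoly RR[n]}, [/\ vanishing X pq.1, vanishing X pq.2 & forall y i,
    (mderiv (lift ord0 i) (F j)).@[embed y] =
      toC (mderiv i pq.1).@[rpoint y] + iC * toC (mderiv i pq.2).@[rpoint y]].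
  by have [p [q h]] := dehomogenization_vanishing (hF j); exists (p, q).
have [pq hpq] := boolp.choice ex.
pose H (j : 'I_(k + k)) := match split j with inl i => (pq i).1 | inr i => (pq i).2 end.
have HX j : vanishing X (H j).
  by rewrite /H; case: split => i; case: (hpq i).
set A := \matrix_(_, _) _ in rF.
pose back : 'M[CC]_(n, n.+1) :=
  \matrix_(k, i) (if unlift ord0 i is Some l then (k == l)%:R else - toC (y 0 k)).
have eA : A = (A *m drop0) *m back.
  apply/matrixP => j i; rewrite mul_drop0 !mxE.
  case: (unliftP ord0 i) => [l|] ->.
    rewrite (bigD1 l) //= !mxE liftK eqxx mulr1 big1 ?addr0 // => m ml.
    by rewrite !mxE liftK (negPf ml) mulr0.
  rewrite (mderiv0_embed (hF j) Xy) -sumrN; apply: eq_bigr => l _.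
  by rewrite !mxE unlift_none mulrN mulrC.
have eB : A *m drop0 = row_mx 1%:M (iC%:M) *m map_mx toC (jacobian_at H (rpoint y)).
  rewrite -[jacobian_at H _]vsubmxK map_col_mx mul_row_col mul1mx mul_scalar_mx.
  rewrite mul_drop0; apply/matrixP => j i; rewrite !mxE.
  case: (hpq j) => _ _ ->.
  by rewrite /H (unsplitK (inl _ j)) (unsplitK (inr _ j)).
pose B := jacobian_at H (rpoint y).
have rB : (k <= \rank B)%N.
  rewrite -{1}rF eA; apply: leq_trans (mxrankM_maxl _ _) _.
  by rewrite eB; apply: leq_trans (mxrankM_maxr _ _) _; rewrite mxrank_map.
exists (\rank B), (fun j => H (maxrankfun B j)); split=> //.
have -> : jacobian_at (fun j => H (maxrankfun B j)) (rpoint y) = rowsub (maxrankfun B) B.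
  by apply/matrixP => i j; rewrite !mxE.
exact: maxrowsub_free.
Qed.

Lemma jac_rank_ge_leq p k l : (l <= k)%N -> jac_rank_ge Z p k -> jac_rank_ge Z p l.
Proof.
move=> lk [F [hF rF]]; exists (fun j => F (widen_ord lk j)); split=> //.
set A := \matrix_(_, _) _ in rF; set B := \matrix_(_, _) _.
pose S : 'M[CC]_(l, k) := \matrix_(i, j) (widen_ord lk i == j)%:R.
have eB : B = S *m A.
  apply/matrixP => i j; rewrite !mxE (bigD1 (widen_ord lk i)) //= !mxE eqxx mul1r big1 ?addr0 // => m mi.
  by rewrite !mxE eq_sym (negPf mi) mul0r.
have fS : row_free S.
  apply/row_freeP; exists S^T; apply/matrixP => i j.
  rewrite !mxE (bigD1 (widen_ord lk i)) //= !mxE eqxx mul1r big1 ?addr0 => [|m mi].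
    by rewrite eq_sym -(inj_eq val_inj) /= (inj_eq val_inj).
  by rewrite !mxE eq_sym (negPf mi) mul0r.
by rewrite eB mxrankMfree ?(eqP fS) // /row_free rF.
Qed.

End Projective.

Lemma mmap_toC (m : nat) (f : {mpoly RR[m]}) (v : 'I_m -> CC) :
  (map_mpoly toC f).@[v] = mmap toC v f.
Proof.
apply: (mpoly_rmorph_eq (f := meval v \o map_mpoly toC) (g := mmap toC v)) => [c|i].
  by rewrite -[LHS]/((map_mpoly toC _).@[v]) map_mpolyC mevalC [RHS]mmapC.
by rewrite -[LHS]/((map_mpoly toC _).@[v]) map_mpolyX mevalXU [RHS]mmapX mmap1U.
Qed.

Lemma mmap_toC_real (m : nat) (f : {mpoly RR[m]}) (w : 'I_m -> RR) :
  mmap toC (fun i => toC (w i)) f = toC f.@[w].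
Proof. by rewrite /meval mmap_rmorph; apply: mmap_ext. Qed.

Lemma real_imag_parts (m : nat) (F : {mpoly CC[m]}) :
  exists P Q : {mpoly RR[m]}, forall v, F.@[v] = mmap toC v P + iC * mmap toC v Q.
Proof.
have ii : iC * iC = -1.
  by apply/eqP; rewrite eq_complex /= !mul0r !mulr0 mulr1 sub0r addr0 eqxx oppr0 eqxx.
elim/mpoly_ring_ind: F => [c|j|F G [p1 [q1 h1]] [p2 [q2 h2]]|F G [p1 [q1 h1]] [p2 [q2 h2]]].
- exists (complex.Re c)%:MP, (complex.Im c)%:MP => v.
  by rewrite mevalC [in RHS]mmapC [X in _ + iC * X]mmapC -complexE.
- exists 'X_j, 0 => v.
  by rewrite mevalXU mmapX mmap1U rmorph0 mulr0 addr0.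
- exists (p1 + p2), (q1 + q2) => v.
  by rewrite mevalD h1 h2 !rmorphD /=; ring.
- exists (p1 * p2 - q1 * q2), (p1 * q2 + q1 * p2) => v.
  rewrite mevalM h1 h2 rmorphB rmorphD !rmorphM /=.
  set a := mmap _ _ p1; set b := mmap _ _ q1; set c := mmap _ _ p2; set d := mmap _ _ q2.
  have -> : (a + iC * b) * (c + iC * d) = a * c + (iC * iC) * (b * d) + iC * (a * d + b * c) by ring.
  by rewrite ii; ring.
Qed.

(** A finite family of maximal Jacobian rank at [p] spans all gradients there, without generators of
    the ideal being chosen. A tangent hyperplane kills the kernel of these gradients, so it lies in
    their span. *)
Lemma tangent_in_gradient_span (n : nat) (Z : ('I_n.+1 -> CC) -> Prop) (p a : 'I_n.+1 -> CC) :
  tangent_hyperplane Z p a ->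
  exists k (F : 'I_k -> {mpoly CC[n.+1]}) (mu : 'I_k -> CC),
    (forall j, hom_vanishes_on Z (F j)) /\
    forall i, a i = \sum_j mu j * (mderiv i (F j)).@[p].
Proof.
move=> [_ tan].
have ex0 : exists k, boolp.asbool (jac_rank_ge Z p k).
  exists 0%N; apply/boolp.asboolP; exists (fun=> 0); split; first by case.
  by apply/eqP; rewrite -leqn0 rank_leq_row.
have bd k : boolp.asbool (jac_rank_ge Z p k) -> (k <= n.+1)%N.
  by move=> /boolp.asboolP[F [_ <-]]; apply: rank_leq_col.
case: (ex_maxnP ex0 bd) => k /boolp.asboolP[F [hF rF]] kmax.
set A := \matrix_(_, _) _ in rF.
have span G : hom_vanishes_on Z G -> (\row_i (mderiv i G).@[p] <= A)%MS.
  move=> hG; pose H (j : 'I_k.+1) := if unlift ord0 j is Some l then F l else G.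
  have HZ j : hom_vanishes_on Z (H j) by rewrite /H; case: unliftP => [l|] _.
  pose B : 'M[CC]_(k.+1, n.+1) := \matrix_(j, i) (mderiv i (H j)).@[p].
  have rB : (\rank B <= k)%N.
    rewrite leqNgt; apply/negP => lt; have := kmax k.+1; rewrite ltnn => h.
    have // : false by apply: h; apply/boolp.asboolP; exists H; split=> //;
      apply/eqP; rewrite eqn_leq rank_leq_row.
  have AB : (A <= B)%MS.
    apply/row_subP => l; apply: (eq_row_sub (lift ord0 l)); apply/rowP => i.
    by rewrite !mxE /H liftK.
  have GB : (\row_i (mderiv i G).@[p] <= B)%MS.
    by apply: (eq_row_sub ord0); apply/rowP => i; rewrite !mxE /H unlift_none.
  by apply: submx_trans GB _; rewrite -(mxrank_leqif_sup AB) eqn_leq mxrankS //= rF.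
pose ra : 'rV[CC]_n.+1 := \row_i a i.
have /submxP[mu emu] : (ra <= A)%MS.
  rewrite submxE; apply/eqP/rowP => j; rewrite [RHS]mxE mxE.
  rewrite (eq_bigr (fun i => a i * cokermx A i j)) => [|i _]; last by rewrite mxE.
  apply: tan => G /span; rewrite submxE => /eqP/rowP/(_ j); rewrite [RHS]mxE => e; rewrite -[RHS]e.
  by rewrite [RHS]mxE; apply: eq_bigr => i _; rewrite [X in _ = X * _]mxE.
exists k, F, (fun j => mu 0 j); split=> // i.
have := congr1 (fun B : 'rV[CC]_n.+1 => B 0 i) emu; rewrite [ra _ _]mxE [(_ *m _) _ _]mxE => ->.
by apply: eq_bigr => j _; rewrite [A _ _]mxE.
Qed.

(** The maximal complex rank at [x] is realized by real equations of X, and smoothness of [x] makes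
    it a bound at every point. Points where the same equations remain independent reach the bound,
    hence are smooth. *)
Lemma smooth_frame (n : nat) (X : 'rV[RR]_n -> Prop) (x : 'rV[RR]_n) :
  smooth_point_of X x ->
  exists c (g : 'I_c -> {mpoly RR[n]}),
    [/\ forall j, vanishing X (g j), row_free (jacobian_at g (rpoint x)),
        forall (h : 'I_c.+1 -> {mpoly RR[n]}) y,
          (forall j, vanishing X (h j)) -> X y -> (\rank (jacobian_at h (rpoint y)) <= c)%N
      & forall y, X y -> row_free (jacobian_at g (rpoint y)) ->
          smooth_point (proj_closure X) (embed y)].
Proof.
move=> [Xx [_ sm]]; set Z := proj_closure X in sm *.
have ex0 : exists k, boolp.asbool (jac_rank_ge Z (embed x) k).
  exists 0%N; apply/boolp.asboolP; exists (fun=> 0); split; first by case.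
  by apply/eqP; rewrite -leqn0 rank_leq_row.
have bd k : boolp.asbool (jac_rank_ge Z (embed x) k) -> (k <= n.+1)%N.
  by move=> /boolp.asboolP[F [_ <-]]; apply: rank_leq_col.
case: (ex_maxnP ex0 bd) => k /boolp.asboolP rk kmax.
have {}kmax m : jac_rank_ge Z (embed x) m -> (m <= k)%N by move=> h; apply: kmax; apply/boolp.asboolP.
have [c [g [kc gX fg]]] := embed_jac_rank Xx rk.
have ck := kmax c (jac_rank_ge_embed gX fg).
exists c, g; split=> // [h y hX Xy|y Xy fy].
  rewrite leqNgt; apply/negP => lt.
  have fh : row_free (jacobian_at h (rpoint y)) by rewrite /row_free eqn_leq rank_leq_row.
  have := kmax _ (sm _ _ (embed_closure Xy) (jac_rank_ge_embed hX fh)).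
  by rewrite leqNgt ltnS kc.
split; first exact: embed_closure.
move=> q m Zq /(sm _ _ Zq)/kmax mk.
exact: jac_rank_ge_leq (leq_trans mk kc) (jac_rank_ge_embed gX fy).
Qed.

(** * The equation of the dual variety *)

Section DualEquation.
Variables (n c : nat) (X : 'rV[RR]_n -> Prop) (g : 'I_c -> {mpoly RR[n]}).
Hypothesis irrX : irreducible_real_variety X.
Hypothesis gX : forall j, vanishing X (g j).
Hypothesis rank_max : forall (h : 'I_c.+1 -> {mpoly RR[n]}) y,
  (forall j, vanishing X (h j)) -> X y -> (\rank (jacobian_at h (rpoint y)) <= c)%N.
Hypothesis generic_rank : ~ vanishing X (gram_det g).
Local Notation Z := (proj_closure X).

Lemma gradient_conormal k (F : 'I_k -> {mpoly CC[n.+1]}) (mu : 'I_k -> CC) y :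
  (forall j, hom_vanishes_on Z (F j)) -> X y -> (gram_det g).@[rpoint y] != 0 ->
  exists lam : 'I_c -> CC, forall i,
    \sum_j mu j * (mderiv i (F j)).@[embed y] = conormal toC g (fun i => toC (y 0 i)) lam i.
Proof.
move=> hF Xy Dy.
have ex j : exists kk : 'rV[RR]_c * 'rV[RR]_c, forall i,
    (mderiv (lift ord0 i) (F j)).@[embed y] =
      \sum_l (toC (kk.1 0 l) + iC * toC (kk.2 0 l)) * toC (mderiv i (g l)).@[rpoint y].
  have [p [q [pX qX e]]] := dehomogenization_vanishing (hF j).
  have /submxP[kp ep] := gradient_in_span gX rank_max pX Xy Dy.
  have /submxP[kq eq] := gradient_in_span gX rank_max qX Xy Dy.
  have comp (k1 : 'rV[RR]_c) (r : {mpoly RR[n]}) :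
      \row_i (mderiv i r).@[rpoint y] = k1 *m jacobian_at g (rpoint y) ->
      forall i, (mderiv i r).@[rpoint y] = \sum_l k1 0 l * (mderiv i (g l)).@[rpoint y].
    move=> er i; have := congr1 (fun B : 'rV[RR]_n => B 0 i) er.
    rewrite [(\row_i0 _) _ _]mxE [(_ *m _) _ _]mxE => ->.
    by apply: eq_bigr => l _; rewrite [jacobian_at _ _ _ _]mxE [jacobian _ _ _]mxE.
  exists (kp, kq) => i; rewrite e (comp _ _ ep) (comp _ _ eq) !rmorph_sum mulr_sumr -big_split.
  by apply: eq_bigr => l _; rewrite /= !rmorphM /=; ring.
have [kk hkk] := boolp.choice ex.
pose lam l := \sum_j mu j * (toC ((kk j).1 0 l) + iC * toC ((kk j).2 0 l)).
have hl i : \sum_j mu j * (mderiv (lift ord0 i) (F j)).@[embed y] =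
    \sum_l lam l * mmap toC (fun i => toC (y 0 i)) (mderiv i (g l)).
  rewrite /lam; under [RHS]eq_bigr do rewrite mulr_suml.
  rewrite exchange_big; apply: eq_bigr => j _; rewrite hkk mulr_sumr.
  by apply: eq_bigr => l _; rewrite -mulrA (mmap_toC_real _ (rpoint y)).
exists lam => i; rewrite /conormal; case: (unliftP ord0 i) => [l|] ->; first exact: hl.
under eq_bigr => j _ do rewrite (mderiv0_embed (hF j) Xy) mulrN mulr_sumr.
rewrite sumrN exchange_big; congr (- _); apply: eq_bigr => l _ /=.
rewrite -hl mulr_sumr; apply: eq_bigr => j _; ring.
Qed.

(** At a fixed real point, [f] on the conormal space is a real polynomial in [lam] vanishing at all
    real multipliers. It is therefore the zero polynomial and vanishes at complex ones. *)
Lemma conormal_ideal_complex (f : {mpoly RR[n.+1]}) y (lam : 'I_c -> CC) :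
  conormal_ideal X g f -> X y ->
  mmap toC (conormal toC g (fun i => toC (y 0 i)) lam) f = 0.
Proof.
move=> hf Xy.
pose u : {mpoly RR[c]} := mmap (@mpolyC c RR)
  (conormal (@mpolyC c RR) g (fun i => (y 0 i)%:MP) (fun j => 'X_j)) f.
have u0 : u = 0.
  apply: mpoly_eq0_all => mu; rewrite -[RHS](hf y mu Xy).
  rewrite -[LHS]/(meval mu (mmap _ _ _)) mmap_rmorph [RHS]/meval.
  apply: mmap_ext => [t|j] /=; first exact: mevalC.
  rewrite -[LHS]/(meval mu (conormal _ _ _ _ _)) conormal_rmorph.
  by apply: conormal_ext => [t|i|k] /=; rewrite ?mevalC ?mevalXU.
pose psi : {rmorphism {mpoly RR[c]} -> CC} := mmap toC lam.
have psiC t : psi t%:MP = toC t by apply: mmapC.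
rewrite -[RHS](rmorph0 psi) -u0 /u mmap_rmorph; apply: mmap_ext => [t|j]; first exact: esym (psiC t).
rewrite -[RHS]/(psi (conormal _ _ _ _ _)) conormal_rmorph.
apply: conormal_ext => [t|i|k]; [exact: esym (psiC _)|exact: esym (psiC _)|].
by rewrite -[RHS]/(psi _) [RHS]mmapX mmap1U.
Qed.

(** The point [p] may be non-real. Letting it vary with the multipliers fixed turns the left side
    into a homogeneous polynomial [Phi], which vanishes at generic real points, then on X by
    irreducibility, then on the closure. *)
Lemma tangent_hyperplanes_vanish d (f : {mpoly RR[n.+1]}) p k
  (F : 'I_k -> {mpoly CC[n.+1]}) (mu : 'I_k -> CC) :
  f \is d.-homog -> conormal_ideal X g f -> Z p -> (forall j, hom_vanishes_on Z (F j)) ->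
  mmap toC (fun i => \sum_j mu j * (mderiv i (F j)).@[p]) f = 0.
Proof.
move=> hf If Zp hF; have [[i0 pi0] _] := Zp.
have [dg hdg] := boolp.choice (fun j => proj1 (hF j)).
pose N := (\sum_j dg j)%N.
have dN j : (dg j <= N)%N by rewrite /N (bigD1 j) //= leq_addr.
(* A power of a coordinate nonzero at [p] brings all equations to degree [N], so that [Phi] is
   homogeneous. Because [F j] vanishes at [p], its gradient there is merely rescaled, which [mu']
   undoes. *)
pose F' j := 'X_i0 ^+ (N - dg j) * F j.
have hF' j : F' j \is N.-homog.
  rewrite -(subnK (dN j)); apply: dhomogM => //.
  by rewrite mpolyXn dhomogX /= mdegMn mdeg1 mul1n.
have F'Z j : hom_vanishes_on Z (F' j).
  split; first by exists N.
  by move=> q Zq; rewrite mevalM (proj2 (hF j)) // mulr0.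
pose mu' j := mu j / p i0 ^+ (N - dg j).
pose L l := \sum_j mu' j *: mderiv l (F' j).
have LE q l : (L l).@[q] = \sum_j mu' j * (mderiv l (F' j)).@[q].
  rewrite rmorph_sum; apply: eq_bigr => j _.
  by rewrite -[LHS]/(_.@[q]) mevalZ.
have Lp l : (L l).@[p] = \sum_j mu j * (mderiv l (F j)).@[p].
  rewrite LE; apply: eq_bigr => j _.
  rewrite mderivM mevalD !mevalM (proj2 (hF j)) // mulr0 add0r rmorphXn /= mevalXU.
  by rewrite mulrA divfK // expf_neq0.
pose fC := map_mpoly toC f.
have hfC : fC \is d.-homog.
  apply/dhomogP => m hm; apply: (dhomog_mf hf).
  by move: hm; rewrite !mcoeff_msupp mcoeff_map_mpoly fmorph_eq0.
pose Phi : {mpoly CC[n.+1]} := mmap (@mpolyC n.+1 CC) L fC.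
have PhiE q : Phi.@[q] = mmap toC (fun l => (L l).@[q]) f.
  rewrite -mmap_toC -[LHS]/(meval q (mmap _ _ _)) mmap_rmorph /meval.
  by apply: mmap_ext => [t|l] //=; apply: mevalC.
have hPhi : Phi \is (d * N.-1).-homog.
  apply: dhomog_mmap => // l; rewrite rpred_sum // => j _.
  by apply: dhomogZ; apply: dhomog_mderiv.
have Phi_gen y : X y -> (gram_det g).@[rpoint y] != 0 -> Phi.@[embed y] = 0.
  move=> Xy Dy; have [lam hlam] := gradient_conormal mu' F'Z Xy Dy.
  rewrite PhiE -[RHS](conormal_ideal_complex lam If Xy); apply: mmap_ext => // l.
  by rewrite LE hlam.
have PhiX y : X y -> Phi.@[embed y] = 0.
  have [a [b hab]] := dehomogenization Phi.
  have ab y' : X y' -> (gram_det g).@[rpoint y'] != 0 -> a.@[rpoint y'] = 0 /\ b.@[rpoint y'] = 0.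
    by move=> Xy' Dy'; apply: toC_comb_eq0; rewrite -(hab y').1 Phi_gen.
  have van r : (forall y', X y' -> (gram_det g).@[rpoint y'] != 0 -> r.@[rpoint y'] = 0) -> vanishing X r.
    move=> hr; have [|//|//] := @irreducible_mul n X (gram_det g) r irrX.
    move=> y' Xy'; rewrite mevalM; have [->|Dy'] := eqVneq (gram_det g).@[rpoint y'] 0.
      by rewrite mul0r.
    by rewrite hr // mulr0.
  move=> Xy; rewrite (hab y).1 (van a) ?(van b) ?rmorph0 ?mulr0 ?addr0 //.
    by move=> y' Xy' Dy'; have [] := ab y' Xy' Dy'.
  by move=> y' Xy' Dy'; have [] := ab y' Xy' Dy'.
rewrite -[RHS](proj2 (hom_vanishes_closure hPhi PhiX) p Zp) PhiE.
by apply: mmap_ext => // l; rewrite Lp.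
Qed.

Lemma conormal_tangent y (lam : 'I_c -> RR) : X y ->
  nonzero_vec (fun i => toC (conormal (@idfun RR) g (rpoint y) lam i)) ->
  tangent_hyperplane Z (embed y) (fun i => toC (conormal (@idfun RR) g (rpoint y) lam i)).
Proof.
move=> Xy nz; split=> // v hv.
have [G hG] : exists G : 'I_c -> {mpoly CC[n.+1]}, forall k, hom_vanishes_on Z (G k) /\ homogenizes (G k) (g k).
  have ex k : exists G, hom_vanishes_on Z G /\ homogenizes G (g k).
    by have [G] := homogenization_vanishing (gX k); exists G.
  by have [G hG] := boolp.choice ex; exists G.
have e i : toC (conormal (@idfun RR) g (rpoint y) lam i) =
    \sum_k toC (lam k) * (mderiv i (G k)).@[embed y].
  have el l : toC (\sum_k lam k * (mderiv l (g k)).@[rpoint y]) =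
      \sum_k toC (lam k) * (mderiv (lift ord0 l) (G k)).@[embed y].
    rewrite rmorph_sum; apply: eq_bigr => k _.
    by rewrite rmorphM; case: (hG k) => _ /(_ y)[_ ->].
  rewrite /conormal; case: (unliftP ord0 i) => [l|] ->; first exact: el.
  under [RHS]eq_bigr => k _ do rewrite (mderiv0_embed (proj1 (hG k)) Xy) mulrN mulr_sumr.
  rewrite sumrN exchange_big rmorphN rmorph_sum; congr (- _); apply: eq_bigr => l _ /=.
  rewrite rmorphM -[X in _ * toC X]/(\sum_k lam k * (mderiv l (g k)).@[rpoint y]) el mulr_sumr.
  by apply: eq_bigr => k _; rewrite mulrCA.
under eq_bigr do rewrite e mulr_suml.
rewrite exchange_big big1 // => k _.
under eq_bigr do rewrite -mulrA.
by rewrite -mulr_sumr hv ?mulr0 //; case: (hG k).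
Qed.

Lemma conormal_ideal_generic (P : {mpoly RR[n.+1]}) :
  (forall y lam, X y -> (gram_det g).@[rpoint y] != 0 ->
     P.@[conormal (@idfun RR) g (rpoint y) lam] = 0) ->
  conormal_ideal X g P.
Proof.
move=> h y lam.
pose r : {mpoly RR[n]} := mmap (@mpolyC n RR)
  (conormal (@mpolyC n RR) g (fun i => 'X_i) (fun k => (lam k)%:MP)) P.
have rE y' : r.@[rpoint y'] = P.@[conormal (@idfun RR) g (rpoint y') lam].
  rewrite -[LHS]/(meval _ (mmap _ _ _)) mmap_rmorph [RHS]/meval.
  apply: mmap_ext => [t|j] /=; first exact: mevalC.
  rewrite -[LHS]/(meval _ (conormal _ _ _ _ _)) conormal_rmorph.
  by apply: conormal_ext => [t|i|k] /=; rewrite ?mevalC ?mevalXU.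
rewrite -rE; move: y; have [|//|//] := @irreducible_mul n X (gram_det g) r irrX.
move=> y Xy; rewrite mevalM; have [->|Dy] := eqVneq (gram_det g).@[rpoint y] 0; first by rewrite mul0r.
by rewrite rE h // mulr0.
Qed.

Hypothesis frame_smooth : forall y, X y -> row_free (jacobian_at g (rpoint y)) ->
  smooth_point Z (embed y).

(** The equation vanishes on tangent hyperplanes, hence on their closure. Conversely, the real and
    imaginary parts of a form vanishing on them belong to the conormal ideal, so both are multiples
    of [f]. *)
Lemma dual_variety_hypersurface d (f : {mpoly RR[n.+1]}) y0 lam0 :
  leq 1 d -> f != 0 -> f \is d.-homog -> conormal_ideal X g f ->
  (forall G, conormal_ideal X g G -> divides f G) ->
  X y0 -> (gram_det g).@[rpoint y0] != 0 ->
  (exists i, conormal (@idfun RR) g (rpoint y0) lam0 i != 0) ->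
  is_hypersurface (dual_variety Z).
Proof.
move=> d1 f0 hf If fdiv Xy0 Dy0 nz0.
have hfC : map_mpoly toC f \is d.-homog.
  apply/dhomogP => m hm; apply: (dhomog_mf hf).
  by move: hm; rewrite !mcoeff_msupp mcoeff_map_mpoly fmorph_eq0.
exists (map_mpoly toC f), d; split=> //; split; last split=> //.
  apply: contraNneq f0 => e; apply/eqP/mpolyP => m; rewrite mcoeff0.
  have := congr1 (mcoeff m) e; rewrite mcoeff_map_mpoly mcoeff0 => /eqP.
  by rewrite fmorph_eq0 => /eqP.
move=> a; split=> [[nza ha]|[nza fa]].
  split=> //; apply: ha; split; first by exists d.
  move=> b [p [[Zp _] /tangent_in_gradient_span[k [F [mu [hF hb]]]]]].
  rewrite mmap_toC -[RHS](tangent_hyperplanes_vanish mu hf If Zp hF).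
  exact: mmap_ext.
split=> // F [[e hF] FT].
have onT y lam : X y -> (gram_det g).@[rpoint y] != 0 ->
    (exists i, conormal (@idfun RR) g (rpoint y) lam i != 0) ->
    F.@[fun i => toC (conormal (@idfun RR) g (rpoint y) lam i)] = 0.
  move=> Xy Dy [i nz]; apply: FT; exists (embed y); split.
    by apply: frame_smooth => //; rewrite -gram_det_at.
  by apply: conormal_tangent => //; exists i; rewrite fmorph_eq0.
have onT' y lam : X y -> (gram_det g).@[rpoint y] != 0 ->
    F.@[fun i => toC (conormal (@idfun RR) g (rpoint y) lam i)] = 0.
  move=> Xy Dy; have [nz|z] := boolp.EM (exists i, conormal (@idfun RR) g (rpoint y) lam i != 0).
    exact: onT.
  (* The zero vector is no hyperplane. Writing it as 0 times a genuine conormal vector handles it in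
     every degree, including a constant [F]. *)
  have z0 i : toC (conormal (@idfun RR) g (rpoint y) lam i) = 0 * toC (conormal (@idfun RR) g (rpoint y0) lam0 i).
    rewrite mul0r; apply/eqP; rewrite fmorph_eq0; apply/negPn/negP => h; apply: z; by exists i.
  by rewrite (meval_eq _ z0) (dhomog_meval _ _ hF) onT // mulr0.
have [P [Q hPQ]] := real_imag_parts F.
have PQ y lam : X y -> (gram_det g).@[rpoint y] != 0 ->
    P.@[conormal (@idfun RR) g (rpoint y) lam] = 0 /\ Q.@[conormal (@idfun RR) g (rpoint y) lam] = 0.
  by move=> Xy Dy; apply: toC_comb_eq0; rewrite -!mmap_toC_real -hPQ onT'.
have [|u eu] := fdiv P.
  by apply: conormal_ideal_generic => y lam Xy Dy; case: (PQ y lam Xy Dy).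
have [|w ew] := fdiv Q.
  by apply: conormal_ideal_generic => y lam Xy Dy; case: (PQ y lam Xy Dy).
by rewrite mmap_toC in fa; rewrite hPQ eu ew !rmorphM /= fa !mulr0 addr0.
Qed.

End DualEquation.

Theorem theorem5p2 (n : nat) (hn : leq 1 n)
  (D : 'rV[RR]_n -> 'rV[RR]_n -> RR) (X : 'rV[RR]_n -> Prop) :
  polyhedral_distance D ->
  irreducible_real_variety X ->
  ~ is_hypersurface (dual_variety (proj_closure X)) ->
  ~ (exists x : 'rV[RR]_n,
       smooth_point_of X x /\ full_dimensional (voronoi_cell D X x)).
Proof.
move=> polyD irrX ndual [x [smx full]]; apply: ndual.
have Xx : X x by case: smx.
have [c [g [gX fg rmax sm]]] := smooth_frame smx.
have [al [eps [eps0 strict]]] := voronoi_strict_local_min polyD hn full.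
have Dx : (gram_det g).@[rpoint x] != 0 by rewrite gram_det_at.
have nD : ~ vanishing X (gram_det g) by move=> /(_ x Xx)/eqP; apply/negP.
have indep := conormal_ideal_mlift irrX gX rmax Xx Dx eps0 strict.
have [f [d [d1 f0 hf If fdiv]]] := conormal_ideal_principal irrX gX indep.
have [del del0 hdel] := nearby_forms_conormal irrX gX rmax Xx Dx eps0 strict.
pose i0 := Ordinal hn.
(* The form [al] may be zero, so one coefficient is moved slightly; the resulting form is still
   conormal and gives a nonzero conormal vector. *)
have [t [ht t0]] : exists t : RR, `|t - al i0| < del /\ t != 0.
  have [e|h] := eqVneq (al i0) 0; last by exists (al i0); rewrite subrr normr0.
  exists (del / 2%:R); rewrite e subr0 gtr0_norm ?divr_gt0 // gt_eqF ?divr_gt0 //.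
  by split=> //; rewrite ltr_pdivrMr // ltr_pMr // ltr1n.
have [|u [lam [Xu Du hu]]] := hdel (fun i => if i == i0 then t else al i).
  by move=> i; case: eqVneq => [->|_] //; rewrite subrr normr0.
apply: (dual_variety_hypersurface irrX gX rmax nD sm d1 f0 hf If fdiv Xu Du (lam0 := lam)).
by exists (lift ord0 i0); rewrite /conormal liftK -[X in X != 0](hu i0) eqxx.
Qed.
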